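(* Let $\epsilon\in\{1,-1\}$. (Direct part) Let $\tilde f\colon\tilde M=\prod_{a=1}^rM_a\to\mathbb{Q}_\epsilon^{N-1}\subset\mathbb{E}^N$ be an extrinsic product, let $\phi\colon\tilde M\times\mathbb{E}^s\to E$ be a parallel vector bundle isometry onto a flat parallel subbundle $E$ of $N_{\tilde f}\tilde M$ having the position vector $\tilde f$ as a section, and let $e_1\in\mathbb{E}^s$ be such that $\phi_{\tilde p}(e_1)=\tilde f(\tilde p)$ for every $\tilde p\in\tilde M$. Let $f_0\colon M_0\to\mathbb{E}^s$ be an immersion with $f_0(M_0)\subset(e_1+\Omega(\tilde f;\phi))\cap\mathbb{Q}_\epsilon^{s-1}$ and define $f\colon M=\prod_{i=0}^rM_i=M_0\times\tilde M\to\mathbb{E}^N$ by $f(p_0,\tilde p)=\phi_{\tilde p}(f_0(p_0))$. Then $f$ is an immersion taking values in $\mathbb{Q}_\epsilon^{N-1}$ whose induced metric is polar and whose second fundamental form is adapted to the product net of $M$. (Converse) Any immersion $f\colon\prod_{i=0}^rM_i\to\mathbb{Q}_\epsilon^{N-1}$ whose induced metric is polar and whose second fundamental form is adapted to the product net is given in this way, i.e. $f(p_0,\tilde p)=\phi_{\tilde p}(f_0(p_0))$ for some $\tilde f,E,\phi,e_1,f_0$ as in the direct part.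
   Context: Product manifolds are connected. $\mathbb{E}^N$ denotes $\mathbb{R}^N$ if $\epsilon=1$ and Lorentzian space $\mathbb{L}^N$ (signature $(-,+,\dots,+)$) if $\epsilon=-1$; $\mathbb{Q}_\epsilon^{N-1}\subset\mathbb{E}^N$ is the unit sphere if $\epsilon=1$ and hyperbolic space $\{X:\langle X,X\rangle=-1,\ x_1>0\}$ if $\epsilon=-1$; similarly for $\mathbb{E}^s,\mathbb{Q}_\epsilon^{s-1}$. Extrinsic products. For $\epsilon=1$: given an orthogonal decomposition $\mathbb{R}^N=\prod_{a=1}^r\mathbb{R}^{m_a}$ and immersions $f_a\colon M_a\to\mathbb{S}^{m_a-1}(R_a)\subset\mathbb{R}^{m_a}$ into spheres of radius $R_a$ centered at the origin with $\sum_aR_a^2=1$, the extrinsic product of $f_1,\dots,f_r$ is $\tilde f(p_1,\dots,p_r)=(f_1(p_1),\dots,f_r(p_r))\in\mathbb{S}^{N-1}$. For $\epsilon=-1$ an extrinsic product is one of the following: (i) given an orthogonal decomposition of $\mathbb{L}^N$ into one Lorentzian factor $\mathbb{L}^{m_b}$ (for some index $b$) and Euclidean factors $\mathbb{R}^{m_a}$, $a\neq b$, an immersion $f_b\colon M_b\to\{X\in\mathbb{L}^{m_b}:\langle X,X\rangle=-R_b^2,\ x_1>0\}$ and immersions $f_a\colon M_a\to\mathbb{S}^{m_a-1}(R_a)\subset\mathbb{R}^{m_a}$, $a\ne b$, with $-R_b^2+\sum_{a\neq b}R_a^2=-1$, the map $\tilde f(p_1,\dots,p_r)=(f_1(p_1),\dots,f_r(p_r))\in\mathbb{H}^{N-1}$;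 or (ii) a composition $j\circ(h_1\times\cdots\times h_r)$, where $h_a\colon M_a\to\mathbb{R}^{m_a}$ are immersions, $\prod_a\mathbb{R}^{m_a}=\mathbb{R}^{N-2}$ is an orthogonal decomposition, $(h_1\times\cdots\times h_r)(p_1,\dots,p_r)=(h_1(p_1),\dots,h_r(p_r))$, and $j\colon\mathbb{R}^{N-2}\to\mathbb{H}^{N-1}$ is the umbilical isometric inclusion as a horosphere. With $\pi_i\colon M\to M_i$ the projections, a Riemannian metric $g$ on $M=\prod_{i=0}^rM_i$ is polar if $g=\pi_0^*g_0+\sum_{a=1}^r\pi_a^*(g_a\circ\pi_0)$ for a Riemannian metric $g_0$ on $M_0$ and smooth families $g_a=(g_a(p_0))_{p_0\in M_0}$ of Riemannian metrics on $M_a$ parametrized by $M_0$, i.e. $g(p)(X,Y)=g_0(\pi_{0*}X,\pi_{0*}Y)+\sum_ag_a(\pi_0(p))(\pi_{a*}X,\pi_{a*}Y)$. The product net is $(E_i)_{i=0,\dots,r}$, $E_i$ being the tangent subbundle to the factor $M_i$; a second fundamental form $\alpha$ is adapted to it if $\alpha(E_i,E_j)=0$ for $i\neq j$. $N_{\tilde f}\tilde M$ is the normal bundle of $\tilde f$ as an immersion into $\mathbb{E}^N$, with its normal connection, and $A^{\tilde f}_\xi$ its shape operators, $\langle A^{\tilde f}_\xi X,Y\rangle=\langle\alpha_{\tilde f}(X,Y),\xi\rangle$. A parallel vector bundle isometry $\phi\colon\tilde M\times\mathbb{E}^s\to E$ is a smooth bundle map such that each $\phi_{\tilde p}=\phi(\tilde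 p,\cdot)\colon\mathbb{E}^s\to E(\tilde p)$ is a linear isometry and, for each fixed $y$, $\tilde p\mapsto\phi_{\tilde p}(y)$ is parallel in the normal connection. $\Omega(\tilde f;\phi)=\{Y\in\mathbb{E}^s:\ I-A^{\tilde f}_{\phi_{\tilde p}(Y)}\text{ is nonsingular on }T_{\tilde p}\tilde M\text{ for every }\tilde p\in\tilde M\}$.
   Formalization: The vector e_1 is required to lie in Q_ε^{s-1} (automatic for ε=1; for ε=-1 otherwise f may land in -H^{N-1}), and in the converse the factors M_a, a≥1, are assumed to have positive dimension, since point factors give counterexamples. *)

(* Defs.v *)
From HB Require Import structures.
From mathcomp Require Import all_boot all_order all_algebra.
From mathcomp Require Import all_classical all_reals all_analysis.

Set Implicit Arguments.
Unset Strict Implicit.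
Unset Printing Implicit Defensive.

Import Order.TTheory GRing.Theory Num.Theory.
Import numFieldNormedType.Exports.

Local Open Scope classical_set_scope.
Local Open Scope ring_scope.

(* C^infinity on an open set: every iterated directional derivative exists and
   is Frechet differentiable. *)
Definition smooth_on (R : realType) (n : nat) (V : normedModType R)
    (U : set 'rV[R]_n) (F : 'rV[R]_n -> V) : Prop :=
  forall (l : seq 'rV[R]_n) (x : 'rV[R]_n), U x ->
    differentiable (foldr (fun v (G : 'rV[R]_n -> V) => 'D_v G) F l) x.

Record chart (R : realType) (T : Type) (n : nat) := Chart {
  cdom : set T;
  cmap : T -> 'rV[R]_n;
  cinv : 'rV[R]_n -> T }.

Definition ccod (R : realType) (T : Type) (n : nat) (c : chart R T n) :
  set 'rV[R]_n := cmap c @` cdom c.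

Definition is_chart (R : realType) (T : topologicalType) (n : nat)
    (c : chart R T n) : Prop :=
  [/\ open (cdom c), open (ccod c),
      forall p, cdom c p -> {for p, continuous (cmap c)},
      forall x, ccod c x -> {for x, continuous (cinv c)} &
      forall p, cdom c p -> cinv c (cmap c p) = p].

(* The data of a manifold; the axioms are in [is_manifold], so that products
   can be formed without proof obligations. *)
Record premanifold (R : realType) := Premanifold {
  carrier :> topologicalType;
  mdim : nat;
  atlas : set (chart R carrier mdim) }.

Definition mchart (R : realType) (M : premanifold R) : Type :=
  chart R M (mdim M).

(* Nonemptiness is included. *)
Definition is_manifold (R : realType) (M : premanifold R) : Prop :=
  [/\ hausdorff_space M, @second_countable M, [set: M] !=set0 &
      [/\ forall c : mchart M, atlas c -> is_chart c,
          forall p : M, exists2 c : mchart M, atlas c & cdom c p &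
          forall c c' : mchart M, atlas c -> atlas c' ->
            smooth_on (cmap c @` (cdom c `&` cdom c')) (cmap c' \o cinv c)]].

Definition smooth_map (R : realType) (M : premanifold R) (V : normedModType R)
    (F : M -> V) : Prop :=
  forall c : mchart M, atlas c -> smooth_on (ccod c) (F \o cinv c).

(* The rows of [jac F c p] are the partial derivatives of F at p in the
   chart c; throughout, a tangent vector at p is its row of components
   in a chart around p. *)
Definition jac (R : realType) (M : premanifold R) (N : nat)
    (F : M -> 'rV[R]_N) (c : mchart M) (p : M) : 'M[R]_(mdim M, N) :=
  'J (F \o cinv c) (cmap c p).

(* A map into a quadric of E^N is an immersion iff it is one into E^N. *)
Definition immersion (R : realType) (M : premanifold R) (N : nat)
    (F : M -> 'rV[R]_N) : Prop :=
  smooth_map F /\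
  forall (c : mchart M) p, atlas c -> cdom c p -> row_free (jac F c p).

Section Products.
Variables (R : realType) (r : nat) (M : 'I_r -> premanifold R).

Definition prod_chart (c : forall i, mchart (M i)) :
    chart R (prod_topology M) (\sum_i mdim (M i))%N :=
  Chart [set p : prod_topology M | forall i, cdom (c i) (p i)]
        (fun p => \mxrow_i cmap (c i) (p i))
        (fun x i => cinv (c i) (submxrow x i)).

Definition prodM : premanifold R :=
  @Premanifold R (prod_topology M) (\sum_i mdim (M i))%N
    [set c' | exists2 c : forall i, mchart (M i),
                (forall i, atlas (c i)) & c' = prod_chart c].

(* Components (in a product chart) of a vector of E_i. *)
Definition in_factor (i : 'I_r) (u : 'rV[R]_(mdim prodM)) : Prop :=
  forall j, j != i -> submxrow u j = 0.

End Products.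

(* prod_(a = 1..r) M_a, out of (M_i)_(i = 0..r). *)
Definition tailM (R : realType) (r : nat) (M : 'I_r.+1 -> premanifold R) :
  premanifold R := prodM (fun a : 'I_r => M (lift ord0 a)).

Definition tail_pt (R : realType) (r : nat) (M : 'I_r.+1 -> premanifold R)
  (p : prodM M) : tailM M := fun a : 'I_r => p (lift ord0 a).

(* eps = 1: Euclidean inner product; eps = -1: signature (-,+,...,+). *)
Definition gram (R : realType) (eps : R) (n : nat) : 'M[R]_n :=
  diag_mx (\row_i if i == 0%N :> nat then eps else 1).

Definition eform (R : realType) (eps : R) (n : nat) (x y : 'rV[R]_n) : R :=
  (x *m gram eps n *m y^T) 0 0.

(* Sphere of radius rad (eps = 1), or upper sheet of <X,X> = - rad^2
   (eps = -1). *)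
Definition quadric (R : realType) (eps : R) (n : nat) (rad : R) :
    set 'rV[R]_n :=
  [set X | eform eps X X = eps * rad ^+ 2 /\
           (eps = -1 -> forall i : 'I_n, i = 0%N :> nat -> 0 < X 0 i)].

(* Q_eps^(n-1) in E^n *)
Definition Qspace (R : realType) (eps : R) (n : nat) : set 'rV[R]_n :=
  quadric eps 1.

Section Extrinsic.
Variables (R : realType) (eps : R) (N : nat).

(* Projection onto the orthogonal complement of the row space of J, when
   the latter is nondegenerate. *)
Definition nproj (n : nat) (J : 'M[R]_(n, N)) (w : 'rV[R]_N) : 'rV[R]_N :=
  let G := gram eps N in
  w - w *m G *m J^T *m invmx (J *m G *m J^T) *m J.

Variables (M : premanifold R) (F : M -> 'rV[R]_N).

Definition induced_metric (c : mchart M) (p : M) : 'M[R]_(mdim M) :=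
  jac F c p *m gram eps N *m (jac F c p)^T.

(* alpha_F(u, v), for F as an immersion into E^N: the normal part of the
   derivative along u of F_* v, v extended with constant components. *)
Definition sff (c : mchart M) (p : M) (u v : 'rV[R]_(mdim M)) : 'rV[R]_N :=
  nproj (jac F c p) ('D_u ('D_v (F \o cinv c)) (cmap c p)).

(* alpha_F for F as an immersion into Q_eps: the normal space of F in Q_eps
   is the orthogonal complement of the position vector, of square eps, in the
   normal space of F in E^N. *)
Definition sffQ (c : mchart M) (p : M) (u v : 'rV[R]_(mdim M)) : 'rV[R]_N :=
  let a := sff c p u v in a - (eps * eform eps a (F p)) *: F p.

(* Matrix, acting on rows X |-> X *m A, of the shape operator A_xi:
   <A_xi X, Y> = <alpha(X, Y), xi>. *)
Definition shape_op (c : mchart M) (p : M) (xi : 'rV[R]_N) :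
    'M[R]_(mdim M) :=
  (\matrix_(i, j) eform eps (sff c p (delta_mx 0 i) (delta_mx 0 j)) xi)
    *m invmx (induced_metric c p).

(* Normal connection, on sections read in the chart c. *)
Definition nconn (c : mchart M) (xi : 'rV[R]_(mdim M) -> 'rV[R]_N)
    (u x : 'rV[R]_(mdim M)) : 'rV[R]_N :=
  nproj ('J (F \o cinv c) x) ('D_u xi x).

(* A field of subspaces of E^N along M is encoded by matrices with the
   given row spaces. *)
Definition local_section (E : M -> 'M[R]_N) (c : mchart M)
    (V : set 'rV[R]_(mdim M)) (xi : 'rV[R]_(mdim M) -> 'rV[R]_N) : Prop :=
  [/\ open V, V `<=` ccod c, smooth_on V xi &
      forall x, V x -> (xi x <= E (cinv c x))%MS].

Definition normal_subbundle (s : nat) (E : M -> 'M[R]_N) : Prop :=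
  (forall c p, atlas c -> cdom c p ->
     E p *m gram eps N *m (jac F c p)^T = 0) /\
  (forall c p, atlas c -> cdom c p ->
     exists V (B : 'rV[R]_(mdim M) -> 'M[R]_(s, N)),
       [/\ open V, V (cmap c p), V `<=` ccod c, smooth_on V B &
           forall x, V x -> row_free (B x) /\ (B x == E (cinv c x))%MS]).

Definition parallel_subbundle (E : M -> 'M[R]_N) : Prop :=
  forall c V xi, atlas c -> local_section E c V xi ->
  forall x u, V x -> (nconn c xi u x <= E (cinv c x))%MS.

(* Vanishing curvature; coordinate fields commute, so that no bracket term
   appears. *)
Definition flat_subbundle (E : M -> 'M[R]_N) : Prop :=
  forall c V xi, atlas c -> local_section E c V xi ->
  forall x u v, V x ->
    nconn c (nconn c xi v) u x = nconn c (nconn c xi u) v x.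

(* phi_p(y) = y *m Phi p *)
Definition parallel_isometry (s : nat) (E : M -> 'M[R]_N)
    (Phi : M -> 'M[R]_(s, N)) : Prop :=
  [/\ smooth_map Phi,
      forall p, (Phi p == E p)%MS,
      forall p y z, eform eps (y *m Phi p) (z *m Phi p) = eform eps y z &
      forall (y : 'rV[R]_s) c p u, atlas c -> cdom c p ->
        nconn c (fun x => y *m Phi (cinv c x)) u (cmap c p) = 0].

Definition Omega (s : nat) (Phi : M -> 'M[R]_(s, N)) : set 'rV[R]_s :=
  [set Y | forall c p, atlas c -> cdom c p ->
     1%:M - shape_op c p (Y *m Phi p) \in unitmx].

End Extrinsic.

Section ExtrinsicProducts.
Variables (R : realType) (r : nat).

(* E^N (with sign eps) is the orthogonal sum of the images of the isometric
   inclusions y |-> y *m J a of E^(m a) (with sign sig a). *)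
Definition orth_decomp (eps : R) (N : nat) (sig : 'I_r -> R)
    (m : 'I_r -> nat) (J : forall a, 'M[R]_(m a, N)) : Prop :=
  [/\ (\sum_a m a)%N = N,
      forall a, J a *m gram eps N *m (J a)^T = gram (sig a) (m a) &
      forall a b, a != b -> J a *m gram eps N *m (J b)^T = 0].

Variables (M : 'I_r -> premanifold R) (N : nat).

Definition product_in_quadrics (eps : R) (sig : 'I_r -> R)
    (ft : prodM M -> 'rV[R]_N) : Prop :=
  exists (m : 'I_r -> nat) (J : forall a, 'M[R]_(m a, N))
         (rad : 'I_r -> R) (h : forall a, M a -> 'rV[R]_(m a)),
    [/\ orth_decomp eps sig J,
        forall a, 0 < rad a,
        forall a, immersion (h a) /\
                  forall x, quadric (sig a) (rad a) (h a x),
        \sum_a sig a * rad a ^+ 2 = eps &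
        forall p : prodM M, ft p = \sum_a h a (p a) *m J a].

(* The inclusion of R^k onto the horosphere {X | <X, w> = 1} of H^(k+1),
   with v, w null vectors, <v, w> = 1, and C a linear isometry of R^k onto
   the orthogonal complement of v and w. *)
Definition horosphere_inclusion (k : nat) (j : 'rV[R]_k -> 'rV[R]_N) : Prop :=
  exists (C : 'M[R]_(k, N)) (v w : 'rV[R]_N),
    [/\ [/\ eform (-1) v v = 0, eform (-1) w w = 0 & eform (-1) v w = 1],
        C *m gram (-1) N *m C^T = 1%:M,
        C *m gram (-1) N *m v^T = 0 /\ C *m gram (-1) N *m w^T = 0,
        forall x, j x = v + x *m C - ((1 + eform 1 x x) / 2) *: w &
        forall x, Qspace (-1) (j x)].

Definition product_in_horosphere (ft : prodM M -> 'rV[R]_N) : Prop :=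
  exists (k : nat) (j : 'rV[R]_k -> 'rV[R]_N)
         (m : 'I_r -> nat) (K : forall a, 'M[R]_(m a, k))
         (h : forall a, M a -> 'rV[R]_(m a)),
    [/\ k.+2 = N, horosphere_inclusion j, orth_decomp 1 (fun=> 1) K,
        forall a, immersion (h a) &
        forall p : prodM M, ft p = j (\sum_a h a (p a) *m K a)].

(* Membership in Q_eps fixes the time orientation of the Lorentzian factor. *)
Definition extrinsic_product (eps : R) (ft : prodM M -> 'rV[R]_N) : Prop :=
  (forall p, Qspace eps (ft p)) /\
  ((eps = 1 /\ product_in_quadrics eps (fun=> 1) ft) \/
   (eps = -1 /\
     ((exists b, product_in_quadrics eps (fun a => if a == b then -1 else 1) ft)
      \/ product_in_horosphere ft))).

End ExtrinsicProducts.

(* Components of a covariant 2-tensor, for every chart and point of it. *)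
Definition tensor2 (R : realType) (M : premanifold R) : Type :=
  mchart M -> M -> 'M[R]_(mdim M).

Definition riemannian (R : realType) (M : premanifold R) (g : tensor2 M) :
    Prop :=
  [/\ forall c p, atlas c -> cdom c p -> (g c p)^T = g c p,
      forall c p (v : 'rV[R]_(mdim M)), atlas c -> cdom c p -> v != 0 ->
        0 < (v *m g c p *m v^T) 0 0,
      forall c c' p, atlas c -> atlas c' -> cdom c p -> cdom c' p ->
        let T := 'J (cmap c' \o cinv c) (cmap c p) in
        g c p = T *m g c' p *m T^T &
      forall c, atlas c -> smooth_on (ccod c) (g c \o cinv c)].

Definition smooth_family (R : realType) (M0 M1 : premanifold R)
    (g : M0 -> tensor2 M1) : Prop :=
  (forall q, riemannian (g q)) /\
  forall c0 c1, atlas c0 -> atlas c1 ->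
    smooth_on [set z : 'rV[R]_(mdim M0 + mdim M1) |
                 ccod c0 (lsubmx z) /\ ccod c1 (rsubmx z)]
      (fun z => g (cinv c0 (lsubmx z)) c1 (cinv c1 (rsubmx z))).

Definition polar (R : realType) (r : nat) (M : 'I_r.+1 -> premanifold R)
    (g : tensor2 (prodM M)) : Prop :=
  exists (g0 : tensor2 (M ord0))
         (ga : forall a : 'I_r, M ord0 -> tensor2 (M (lift ord0 a))),
    [/\ riemannian g0,
        forall a, smooth_family (ga a) &
        forall (c : forall i, mchart (M i)) (p : prodM M)
               (u v : 'rV[R]_(mdim (prodM M))),
          (forall i, atlas (c i)) -> (forall i, cdom (c i) (p i)) ->
          u *m g (prod_chart c) p *m v^T =
          submxrow u ord0 *m g0 (c ord0) (p ord0) *m (submxrow v ord0)^T +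
          \sum_(a < r) submxrow u (lift ord0 a)
            *m ga a (p ord0) (c (lift ord0 a)) (p (lift ord0 a))
            *m (submxrow v (lift ord0 a))^T].

(* For an immersion f into Q_eps. *)
Definition adapted (R : realType) (eps : R) (r N : nat)
    (M : 'I_r -> premanifold R) (f : prodM M -> 'rV[R]_N) : Prop :=
  forall (c : forall i, mchart (M i)) (p : prodM M) (i j : 'I_r)
         (u v : 'rV[R]_(mdim (prodM M))),
    (forall i, atlas (c i)) -> (forall i, cdom (c i) (p i)) ->
    i != j -> in_factor i u -> in_factor j v ->
    sffQ eps f (prod_chart c) p u v = 0.

(* For eps = -1, [tube_e1] says that phi preserves the time orientation: the
   other conditions are invariant under (Phi, e1) |-> (- Phi, - e1), which
   changes the sign of the map [tube_map]. *)
Record tube_data (R : realType) (eps : R) (r N s : nat)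
    (M : 'I_r.+1 -> premanifold R)
    (ft : tailM M -> 'rV[R]_N) (E : tailM M -> 'M[R]_N)
    (Phi : tailM M -> 'M[R]_(s, N)) (e1 : 'rV[R]_s)
    (f0 : M ord0 -> 'rV[R]_s) : Prop := TubeData {
  tube_ft : extrinsic_product eps ft;
  tube_normal : normal_subbundle eps ft s E;
  tube_parallel : parallel_subbundle eps ft E;
  tube_flat : flat_subbundle eps ft E;
  tube_position : forall pt, (ft pt <= E pt)%MS;
  tube_phi : parallel_isometry eps ft E Phi;
  tube_e1 : Qspace eps e1;
  tube_phi_e1 : forall pt, e1 *m Phi pt = ft pt;
  tube_f0 : immersion f0;
  tube_f0_Omega : forall q, Omega eps ft Phi (f0 q - e1);
  tube_f0_Q : forall q, Qspace eps (f0 q) }.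

(* (p_0, pt) |-> phi_pt(f_0(p_0)) *)
Definition tube_map (R : realType) (r N s : nat)
    (M : 'I_r.+1 -> premanifold R) (Phi : tailM M -> 'M[R]_(s, N))
    (f0 : M ord0 -> 'rV[R]_s) (p : prodM M) : 'rV[R]_N :=
  f0 (p ord0) *m Phi (tail_pt p).

(* Main.v *)
(* Write E for the product net and D_u for derivatives in product charts.

   Direct part.  Along an extrinsic product the mixed derivatives D_u D_v ft
   (u, v tangent to different factors) vanish and the factors are mutually
   orthogonal.  For a parallel section xi = phi(y), Weingarten's formula gives
   D_u xi = - A_xi u, which by these two facts is tangent to the same factor as
   u; so xi inherits both properties of ft.  As f0(p0) - e1 lies in Omega, the
   slices phi(f0(p0)) are immersions, and polarity and adaptedness of f follow.

   Converse.  For f adapted with polar metric, Koszul's formula shows that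
   D_u D_v f = 0 for u, v tangent to different factors M_a, M_b with a, b > 0,
   and that D_u D_v f is tangent to E_a for u in E_a and v in E_0.  Hence the
   orthogonal projection onto f_* E_a has zero derivative along M_0, that is, all
   the leaves f(q, .) have the same tangent spaces, and so the inner products
   <f(q, .), f(q', .)> are constant.  The leaves therefore span a parallel flat
   bundle; an orthonormal frame of it, with coefficients independent of the
   point, provides phi, the coordinates of f(q, .) in it are f0(q), and ft is any
   one of the leaves.

   Finally ft = c + sum_a psi_a(p_a), because mixed derivatives vanish, and
   <psi_a, psi_b> = 0 for a <> b, because ft has constant square.  If the span of
   psi_a is positive definite for all a except one, splitting E^N along these
   spans gives a product in quadrics.  Otherwise two of the spans contain
   nonspacelike vectors, which are orthogonal and hence proportional to one null
   vector w; this w is orthogonal to all the psi_a, and ft takes its values in a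
   horosphere <X, w> = const. *)
Require Import Defs.
From HB Require Import structures.
From mathcomp Require Import all_boot all_order all_algebra.
From mathcomp Require Import all_classical all_reals all_analysis.
From mathcomp Require Import ring lra.

Set Implicit Arguments.
Unset Strict Implicit.
Unset Printing Implicit Defensive.

Import Order.TTheory GRing.Theory Num.Theory.
Import numFieldNormedType.Exports.
Local Open Scope classical_set_scope.
Local Open Scope ring_scope.

(** * Calculus of matrix-valued maps *)

(** In both signatures the argument rests on one fact: the orthogonal complement of a vector of
    square eps is positive definite. Applied to the position vector of an immersion into the
    quadric, it makes the induced metric invertible, so that normal projections exist, and it allows
    a tangent vector to be shown zero by computing its square. Computations use partial derivatives
    along single factors. Each reads one chart of one factor, and connectedness turns a vanishing
    partial derivative into independence of that factor. In the converse, Omega comes from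
    Weingarten's formula read backwards: the leaves are immersions, hence I - A is injective.
    Positive dimension of M_a, a > 0, enters through the radii: radius 0 would mean that the
    component of the map along M_a vanishes identically, and such a map is no immersion in positive
    dimension. The presence of an index a > 0 provides a block which can absorb the part of the
    ambient space that the maps psi_a do not span. *)

Section MatrixCalculus.
Variables (R : realType) (V : normedModType R).
Implicit Types (x v : V).

Lemma differentiable_mxP m n (A : V -> 'M[R]_(m, n)) x :
  differentiable A x <-> forall i j, differentiable (fun y => A y i j : R) x.
Proof.
split=> [dA i j|dA].
  apply: (@differentiable_comp _ _ _ _ A (fun B : 'M[R]_(m, n) => B i j : R)) => //.
  exact: differentiable_coord.
have -> : A = \sum_(i < m) \sum_(j < n) (fun y => A y i j *: delta_mx i j).
  apply/funext => y; rewrite fct_sumE {1}[A y]matrix_sum_delta.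
  by apply: eq_bigr => i _; rewrite fct_sumE.
apply: differentiable_sum => i; apply: differentiable_sum => j.
exact: differentiableZl.
Qed.

Lemma derive_entry m n (A : V -> 'M[R]_(m, n)) x v i j :
  derivable A x v -> 'D_v A x i j = 'D_v (fun y => A y i j : R) x.
Proof. by move=> dA; rewrite derive_mx// mxE. Qed.

Lemma differentiable_sumP (I : finType) (W : normedModType R) (F : I -> V -> W) x :
  (forall i, differentiable (F i) x) -> differentiable (fun y => \sum_i F i y) x.
Proof.
move=> dF.
have -> : (fun y => \sum_i F i y) = \sum_(k < #|I|) F (enum_val k).
  by apply/funext => y; rewrite fct_sumE big_enum_val.
exact: differentiable_sum.
Qed.

Lemma derive_sumP (I : finType) (W : normedModType R) (F : I -> V -> W) x v :
  (forall i, differentiable (F i) x) ->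
  'D_v (fun y => \sum_i F i y) x = \sum_i 'D_v (F i) x.
Proof.
move=> dF.
have -> : (fun y => \sum_i F i y) = \sum_(k < #|I|) F (enum_val k).
  by apply/funext => y; rewrite fct_sumE big_enum_val.
rewrite derive_sum; last by move=> i; exact: diff_derivable.
by rewrite [RHS]big_enum_val.
Qed.

Lemma differentiable_mulmx m n p (A : V -> 'M[R]_(m, n)) (B : V -> 'M[R]_(n, p)) x :
  differentiable A x -> differentiable B x ->
  differentiable (fun y => A y *m B y) x.
Proof.
move=> /differentiable_mxP dA /differentiable_mxP dB.
apply/differentiable_mxP => i j.
rewrite (_ : (fun y => _) = fun y => \sum_k (A y i k * B y k j)); last first.
  by apply/funext => y; rewrite mxE.
by apply: differentiable_sumP => k; exact: differentiableM.
Qed.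

Lemma derive_mulmx m n p (A : V -> 'M[R]_(m, n)) (B : V -> 'M[R]_(n, p)) x v :
  differentiable A x -> differentiable B x ->
  'D_v (fun y => A y *m B y) x = 'D_v A x *m B x + A x *m 'D_v B x.
Proof.
move=> dA dB; apply/matrixP => i j.
rewrite derive_entry; last exact/diff_derivable/differentiable_mulmx.
rewrite (_ : (fun y => _) = fun y => \sum_k (A y i k * B y k j)); last first.
  by apply/funext => y; rewrite mxE.
have dAe i' j' : differentiable (fun y => A y i' j' : R) x by move/differentiable_mxP: dA.
have dBe i' j' : differentiable (fun y => B y i' j' : R) x by move/differentiable_mxP: dB.
rewrite derive_sumP; last by move=> k; exact: differentiableM.
rewrite !mxE -big_split; apply: eq_bigr => k _ /=.
rewrite (@deriveM _ _ (fun y => A y i k) (fun y => B y k j)); [|exact: diff_derivable..].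
rewrite !derive_entry; [|exact: diff_derivable..].
by rewrite addrC; congr (_ + _); exact: mulrC.
Qed.

Lemma derive_mulmxl m n p (A : 'M[R]_(m, n)) (B : V -> 'M[R]_(n, p)) x v :
  differentiable B x -> 'D_v (fun y => A *m B y) x = A *m 'D_v B x.
Proof.
move=> dB; rewrite (@derive_mulmx _ _ _ (fun=> A))//.
by rewrite (_ : 'D_v _ x = 0) ?mul0mx ?add0r//; exact: derive_cst.
Qed.

Lemma derive_mulmxr m n p (A : V -> 'M[R]_(m, n)) (B : 'M[R]_(n, p)) x v :
  differentiable A x -> 'D_v (fun y => A y *m B) x = 'D_v A x *m B.
Proof.
move=> dA; rewrite (@derive_mulmx _ _ _ _ (fun=> B))//.
by rewrite (_ : 'D_v (fun=> B) x = 0) ?mulmx0 ?addr0//; exact: derive_cst.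
Qed.

Lemma differentiable_trmx m n (A : V -> 'M[R]_(m, n)) x :
  differentiable A x -> differentiable (fun y => (A y)^T) x.
Proof.
move=> /differentiable_mxP dA; apply/differentiable_mxP => i j.
by rewrite (_ : (fun y => _) = fun y => A y j i)//; apply/funext => y; rewrite mxE.
Qed.

Lemma derive_trmx m n (A : V -> 'M[R]_(m, n)) x v :
  differentiable A x -> 'D_v (fun y => (A y)^T) x = ('D_v A x)^T.
Proof.
move=> dA; apply/matrixP => i j.
rewrite derive_entry; last exact/diff_derivable/differentiable_trmx.
rewrite mxE derive_entry; last exact: diff_derivable.
by congr ('D_v _ x); apply/funext => y; rewrite mxE.
Qed.

Lemma derivative_eq (W : normedModType R) (F G : V -> W) x v (U : set V) :
  open U -> U x -> (forall y, U y -> F y = G y) -> 'D_v F x = 'D_v G x.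
Proof.
move=> oU Ux FG; apply: near_eq_derive; near=> y; apply: FG.
near: y; exact: open_nbhs_nbhs.
Unshelve. all: by end_near. Qed.

(** Near x the two maps agree, so the first-order expansion of F also serves for G, and
    [diff_unique] identifies its linear part with the differential of G. *)
Lemma differentiable_eq (W : normedModType R) (F G : V -> W) x (U : set V) :
  open U -> U x -> (forall y, U y -> F y = G y) ->
  differentiable F x -> differentiable G x.
Proof.
move=> oU Ux FG dF.
have [cd e] := (diff_locallyP _ _).1 dF.
have e2 : G \o shift x = cst (G x) + 'd F x +o_ (0 : V) id.
  apply/eqaddoP => eps eps0.
  have := (eqaddoP _ _ _ _).1 e eps eps0.
  have : \forall y \near (0 : V), U (y + x).
    have h : (fun y => y + x) y @[y --> (0 : V)] --> x.
      by rewrite -[X in _ --> X]add0r; apply: cvgD; [exact: cvg_id|exact: cvg_cst].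
    exact: (h U (open_nbhs_nbhs (conj oU Ux))).
  apply: filterS2 => y Uy /=.
  by rewrite !fctE /= FG // (FG x).
have dG := diff_unique cd e2.
by apply/diff_locallyP; rewrite dG.
Qed.
End MatrixCalculus.

(** * Smooth maps on open sets *)

Section Smooth.
Variables (R : realType) (n : nat).
Implicit Types (U : set 'rV[R]_n).

(** [foldr] applies the last direction of the list first; splitting the list at its end therefore
    exposes ['D_v F] and gives the recursion on which [kdiff] is modelled. *)
Lemma smooth_onE (W : normedModType R) U (F : 'rV[R]_n -> W) :
  smooth_on U F <->
  (forall x, U x -> differentiable F x) /\ (forall v, smooth_on U ('D_v F)).
Proof.
split=> [sF|[dF sF]].
  split=> [x Ux|v l x Ux]; first exact: (sF [::]).
  by have := sF (rcons l v) x Ux; rewrite foldr_rcons.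
by move=> l x Ux; case/lastP: l => [|l v]; [exact: dF|rewrite foldr_rcons; exact: sF].
Qed.

Lemma smooth_differentiable (W : normedModType R) U (F : 'rV[R]_n -> W) x :
  smooth_on U F -> U x -> differentiable F x.
Proof. by move=> sF Ux; exact: (sF [::]). Qed.

Lemma smooth_derive (W : normedModType R) U (F : 'rV[R]_n -> W) v :
  smooth_on U F -> smooth_on U ('D_v F).
Proof. by move=> /smooth_onE[]. Qed.

Lemma smooth_sub (W : normedModType R) U U' (F : 'rV[R]_n -> W) :
  U `<=` U' -> smooth_on U' F -> smooth_on U F.
Proof. by move=> UU' sF l x /UU'; exact: sF. Qed.

(* The form of smoothness on which the rules of differentiation are iterated
   by induction on k. *)
Fixpoint kdiff (W : normedModType R) U (k : nat) (F : 'rV[R]_n -> W) : Prop :=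
  (forall x, U x -> differentiable F x) /\
  if k is k'.+1 then forall v, kdiff U k' ('D_v F) else True.

Lemma kdiff_differentiable (W : normedModType R) U k (F : 'rV[R]_n -> W) x :
  kdiff U k F -> U x -> differentiable F x.
Proof. by case: k => [|k] [dF _]; exact: dF. Qed.

Lemma kdiffS (W : normedModType R) U k (F : 'rV[R]_n -> W) :
  kdiff U k.+1 F -> kdiff U k F.
Proof.
elim: k F => [F []|k IH F [dF sF]]; first by split.
by split=> // v; exact: (IH _ (sF v)).
Qed.

Lemma smooth_kdiff (W : normedModType R) U (F : 'rV[R]_n -> W) :
  smooth_on U F <-> forall k, kdiff U k F.
Proof.
split=> [sF k|sF].
  elim: k F sF => [F /smooth_onE[]//|k IH F /smooth_onE[dF sF]].
  by split=> // v; exact: (IH _ (sF v)).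
move=> l; elim/last_ind: l F sF => [F sF x Ux|l v IH F sF x Ux].
  by have [] := sF 0%N => + _; apply.
by rewrite foldr_rcons; apply: IH => // k; have [_] := sF k.+1; apply.
Qed.

Lemma kdiff_eq (W : normedModType R) U k (F G : 'rV[R]_n -> W) :
  open U -> (forall y, U y -> F y = G y) -> kdiff U k F -> kdiff U k G.
Proof.
move=> oU; elim: k F G => [|k IH] F G FG [dF sF]; (split=> [x Ux|//]);
  try exact: (differentiable_eq oU Ux FG (dF x Ux)).
by move=> v; apply: (IH _ _ _ (sF v)) => y Uy; exact: (derivative_eq _ oU Uy FG).
Qed.

Lemma smooth_eq (W : normedModType R) U (F G : 'rV[R]_n -> W) :
  open U -> (forall y, U y -> F y = G y) -> smooth_on U F -> smooth_on U G.
Proof.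
move=> oU FG /smooth_kdiff sF; apply/smooth_kdiff => k; exact: (kdiff_eq oU FG).
Qed.

Lemma kdiff_cst (W : normedModType R) U k (c : W) :
  kdiff U k ((fun=> c) : 'rV[R]_n -> W).
Proof.
elim: k c => [|k IH] c; split=> // v.
by rewrite (_ : 'D_v _ = fun=> 0)//; apply/funext => x; exact: derive_cst.
Qed.

Lemma smooth_cst (W : normedModType R) U (c : W) :
  smooth_on U ((fun=> c) : 'rV[R]_n -> W).
Proof. by apply/smooth_kdiff => k; exact: kdiff_cst. Qed.

Lemma kdiffD (W : normedModType R) U k (F G : 'rV[R]_n -> W) : open U ->
  kdiff U k F -> kdiff U k G -> kdiff U k (fun x => F x + G x).
Proof.
move=> oU; elim: k F G => [|k IH] F G [dF sF] [dG sG]; (split=> [x Ux|//]);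
  try by apply: differentiableD; [exact: dF|exact: dG].
move=> v; apply: (kdiff_eq oU _ (IH _ _ (sF v) (sG v))) => y Uy /=.
by rewrite deriveD//; apply: diff_derivable; [exact: dF|exact: dG].
Qed.

(** Leibniz: in each term of the derivative one factor is differentiated while the other is only
    lowered from order k.+1 to k, hence [kdiffS]. *)
Lemma kdiff_mulmx U k m p q (A : 'rV[R]_n -> 'M[R]_(m, p)) (B : 'rV[R]_n -> 'M[R]_(p, q)) :
  open U -> kdiff U k A -> kdiff U k B -> kdiff U k (fun x => A x *m B x).
Proof.
move=> oU; elim: k A B => [|k IH] A B; first by
  move=> [dA _] [dB _]; split=> // x Ux; apply: differentiable_mulmx; [exact: dA|exact: dB].
move=> cA cB; have [dA sA] := cA; have [dB sB] := cB; split=> [x Ux|v].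
  by apply: differentiable_mulmx; [exact: dA|exact: dB].
apply: (kdiff_eq oU _ (kdiffD oU (IH _ _ (sA v) (kdiffS cB)) (IH _ _ (kdiffS cA) (sB v)))).
by move=> y Uy /=; rewrite derive_mulmx//; [exact: dA|exact: dB].
Qed.

Lemma kdiff_trmx U k m p (A : 'rV[R]_n -> 'M[R]_(m, p)) :
  open U -> kdiff U k A -> kdiff U k (fun x => (A x)^T).
Proof.
move=> oU; elim: k A => [|k IH] A [dA sA]; (split=> [x Ux|//]);
  try by apply: differentiable_trmx; exact: dA.
by move=> v; apply: (kdiff_eq oU _ (IH _ (sA v))) => y Uy /=; rewrite derive_trmx//; exact: dA.
Qed.

Lemma kdiff_mxP U k m p (A : 'rV[R]_n -> 'M[R]_(m, p)) : open U ->
  (forall i j, kdiff U k (fun x => A x i j : R)) -> kdiff U k A.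
Proof.
move=> oU; elim: k A => [|k IH] A dA; (split=> [x Ux|//]);
  try by apply/differentiable_mxP => i j; exact: (kdiff_differentiable (dA i j)).
move=> v; apply: IH => i j; have [_ /(_ v) sA] := dA i j.
apply: (kdiff_eq oU _ sA) => y Uy; rewrite derive_entry//.
by apply/diff_derivable/differentiable_mxP => i' j'; exact: (kdiff_differentiable (dA i' j')).
Qed.

Lemma kdiff_entry U k m p (A : 'rV[R]_n -> 'M[R]_(m, p)) i j : open U ->
  kdiff U k A -> kdiff U k (fun x => A x i j : R).
Proof.
move=> oU; elim: k A => [|k IH] A [dA sA]; (split=> [x Ux|//]);
  try by move/differentiable_mxP: (dA x Ux).
by move=> v; apply: (kdiff_eq oU _ (IH _ (sA v))) => y Uy; rewrite derive_entry//; exact/diff_derivable/dA.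
Qed.

Lemma smoothD (W : normedModType R) U (F G : 'rV[R]_n -> W) : open U ->
  smooth_on U F -> smooth_on U G -> smooth_on U (fun x => F x + G x).
Proof.
by move=> oU /smooth_kdiff sF /smooth_kdiff sG; apply/smooth_kdiff => k; exact: kdiffD.
Qed.

Lemma smooth_sum (I : finType) (W : normedModType R) U (F : I -> 'rV[R]_n -> W) :
  open U -> (forall i, smooth_on U (F i)) -> smooth_on U (fun x => \sum_i F i x).
Proof.
move=> oU sF; elim: (index_enum I) => [|i s IH].
  by under eq_fun do rewrite big_nil; exact: smooth_cst.
by under eq_fun do rewrite big_cons; exact: smoothD.
Qed.

Lemma smooth_mulmx U m p q (A : 'rV[R]_n -> 'M[R]_(m, p)) (B : 'rV[R]_n -> 'M[R]_(p, q)) :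
  open U -> smooth_on U A -> smooth_on U B -> smooth_on U (fun x => A x *m B x).
Proof.
by move=> oU /smooth_kdiff sF /smooth_kdiff sG; apply/smooth_kdiff => k; exact: kdiff_mulmx.
Qed.

Lemma smooth_mulmxr U m p q (A : 'rV[R]_n -> 'M[R]_(m, p)) (B : 'M[R]_(p, q)) :
  open U -> smooth_on U A -> smooth_on U (fun x => A x *m B).
Proof. by move=> oU sA; apply: smooth_mulmx => //; exact: smooth_cst. Qed.

Lemma smooth_mulmxl U m p q (A : 'M[R]_(m, p)) (B : 'rV[R]_n -> 'M[R]_(p, q)) :
  open U -> smooth_on U B -> smooth_on U (fun x => A *m B x).
Proof. by move=> oU sA; apply: smooth_mulmx => //; exact: smooth_cst. Qed.

Lemma smooth_trmx U m p (A : 'rV[R]_n -> 'M[R]_(m, p)) :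
  open U -> smooth_on U A -> smooth_on U (fun x => (A x)^T).
Proof. by move=> oU /smooth_kdiff sF; apply/smooth_kdiff => k; exact: kdiff_trmx. Qed.

Lemma smooth_mxP U m p (A : 'rV[R]_n -> 'M[R]_(m, p)) : open U ->
  (forall i j, smooth_on U (fun x => A x i j : R)) <-> smooth_on U A.
Proof.
move=> oU; split=> [sA|/smooth_kdiff sA i j]; apply/smooth_kdiff => k.
  by apply: kdiff_mxP => // i j; move/smooth_kdiff: (sA i j).
exact: kdiff_entry.
Qed.

Lemma smooth_rowP U m p (A : 'rV[R]_n -> 'M[R]_(m, p)) : open U ->
  (forall i, smooth_on U (fun x => row i (A x))) -> smooth_on U A.
Proof.
move=> oU sA; apply/smooth_mxP => // i j.
have /smooth_mxP/(_ 0 j) h := sA i; rewrite (_ : (fun x => _) = (fun x => row i (A x) 0 j)).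
  exact: h.
by apply/funext => x; rewrite mxE.
Qed.

End Smooth.

(** * Affine substitutions *)

Section Affine.
Variables (R : realType) (n : nat).

(** The identity says that A is affine with linear part L; linearity of L follows from it by
    subtracting [A 0]. In this form it rewrites difference quotients directly. *)
Definition affine_with m (A : 'rV[R]_n -> 'rV[R]_m) (L : 'rV[R]_n -> 'rV[R]_m) :=
  forall h v x, A (h *: v + x) = h *: L v + A x.

Lemma affine_differentiable m (A L : 'rV[R]_n -> 'rV[R]_m) x :
  affine_with A L -> differentiable A x.
Proof.
move=> AL.
have L0 v : L v = A v - A 0 by have := AL 1 v 0; rewrite !scale1r addr0 => ->; rewrite addrK.
have Llin : linear L.
  by move=> h v w; rewrite (L0 (h *: v + w)) AL (L0 w) addrA.
pose LM := GRing.isLinear.Build _ _ _ _ _ Llin.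
pose LL : {linear _ -> _} := HB.pack L LM.
have -> : A = fun y => y *m lin1_mx LL + A 0.
  by apply/funext => y; rewrite mul_rV_lin1 /= L0 subrK.
apply: differentiableD; last exact: differentiable_cst.
by apply: differentiable_mulmx => //; exact: differentiable_cst.
Qed.

Lemma derive_affine (W : normedModType R) m (A L : 'rV[R]_n -> 'rV[R]_m)
    (F : 'rV[R]_m -> W) v x :
  affine_with A L -> 'D_v (F \o A) x = 'D_(L v) F (A x).
Proof.
move=> AL; rewrite /derive; set f := fun h : R => _; set g := fun h : R => _.
by have -> : f = g by apply/funext => h; rewrite /f /g /= AL.
Qed.

Lemma smooth_affine (W : normedModType R) m (A L : 'rV[R]_n -> 'rV[R]_m)
    (F : 'rV[R]_m -> W) (U : set 'rV[R]_n) (U' : set 'rV[R]_m) :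
  affine_with A L -> (forall x, U x -> U' (A x)) ->
  smooth_on U' F -> smooth_on U (F \o A).
Proof.
move=> AL UU' sF l; elim/last_ind: l F sF => [|l v IH] F sF x Ux.
  apply: differentiable_comp; first exact: (affine_differentiable x AL).
  by apply: (smooth_differentiable sF); exact: UU'.
rewrite foldr_rcons (_ : 'D_v (F \o A) = 'D_(L v) F \o A).
  by apply: IH => //; exact: smooth_derive.
by apply/funext => y; rewrite /= (derive_affine F v y AL).
Qed.

End Affine.

(** * Mean value theorem and symmetry of second derivatives *)

Section MeanValue.
Variables (R : realType) (V : normedModType R).
Implicit Types (x u v w : V).

Lemma is_derive_line (g : V -> R) u w (t : R) :
  derivable g (t *: u + w) u ->
  is_derive t (1 : R) (fun s : R => g (s *: u + w)) ('D_u g (t *: u + w)).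
Proof.
move=> dg; have e : (fun h : R => h^-1 *: (((fun s : R => g (s *: u + w)) \o shift t) (h *: (1 : R)) - g (t *: u + w))) =
   (fun h : R => h^-1 *: ((g \o shift (t *: u + w)) (h *: u) - g (t *: u + w))).
  by apply/funext => h /=; rewrite scalerDl addrA [h%:A]mulr1.
by split; [rewrite /derivable e|rewrite /derive e].
Qed.

Lemma derive_shiftr (g : V -> R) u w x : 'D_u (fun y => g (y + w)) x = 'D_u g (x + w).
Proof.
rewrite /derive; set a := fun h : R => _; set b := fun h : R => _.
by have -> : a = b by apply/funext => h; rewrite /a /b /= addrA.
Qed.

Lemma derivable_shiftr (g : V -> R) u w x :
  derivable g (x + w) u -> derivable (fun y => g (y + w)) x u.
Proof.
rewrite /derivable; set a := fun h : R => _; set b := fun h : R => _.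
by have -> : a = b by apply/funext => h; rewrite /a /b /= addrA.
Qed.

Lemma MVT_line (g : V -> R) u w (h : R) : 0 < h ->
  (forall t, 0 <= t <= h -> derivable g (t *: u + w) u) ->
  exists2 c, 0 < c < h & g (h *: u + w) - g w = h * 'D_u g (c *: u + w).
Proof.
move=> h0 dg.
have [||c + e] := @MVT R (fun s : R => g (s *: u + w)) (fun s => 'D_u g (s *: u + w)) 0 h h0.
- move=> t; rewrite in_itv /= => /andP[t0 th].
  by apply/is_derive_line/dg; rewrite !ltW.
- apply: derivable_within_continuous => t; rewrite in_itv /= => th.
  by have [] := is_derive_line (dg t th).
rewrite in_itv /= => ch; exists c => //.
by move: e; rewrite scale0r add0r subr0 mulrC.
Qed.

(** The mean value theorem in direction u, applied to the increment of g by h v, turns the second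
    difference into h times a difference of values of ['D_u g]. The first-order expansion of
    ['D_u g] at x evaluates the latter. *)
Lemma second_difference (U : set V) (g : V -> R) x u v (e : R) :
  open U -> U x -> (forall y, U y -> derivable g y u) ->
  differentiable ('D_u g) x -> 0 < e ->
  \forall h \near 0^'+,
    `|g (h *: u + (h *: v + x)) - g (h *: u + x) - g (h *: v + x) + g x
      - h ^+ 2 * 'D_v ('D_u g) x| <= h ^+ 2 * e.
Proof.
move=> oU Ux dg d2 e0.
(* The two remainders are taken at c u and c u + h v with c <= h, of norms at most h |u| and h (|u|
   + |v|). Their sum is below h K, and the final 1 makes K positive. *)
pose K := `|u| + (`|u| + `|v|) + 1.
have K0 : 0 < K by rewrite ltr_wpDl// ?addr_ge0.
have [_ /eqaddoP E] := (diff_locallyP _ _).1 d2.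
have eK : 0 < e / K by rewrite divr_gt0.
have /nbhs_ballP[d1 /= d10 Ed] := E _ eK.
have /nbhs_ballP[d2' /= d20 Ud] : nbhs x U by exact: open_nbhs_nbhs.
pose d := Num.min d1 d2'.
have d0 : 0 < d by rewrite lt_min d10.
near=> h.
have h0 : 0 < h by near: h; exact: nbhs_right_gt.
have hK : h * K < d.
  by rewrite -ltr_pdivlMr//; near: h; apply: nbhs_right_lt; rewrite divr_gt0.
have small t s : 0 <= t <= h -> 0 <= s <= h -> `|t *: u + s *: v| < d.
  move=> /andP[t0 th] /andP[s0 sh]; apply: le_lt_trans hK.
  rewrite (le_trans (ler_normD _ _))// !normrZ !ger0_norm//.
  have a1 : t * `|u| <= h * `|u| by rewrite ler_wpM2r.
  have a2 : s * `|v| <= h * `|v| by rewrite ler_wpM2r.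
  rewrite /K !mulrDr mulr1; have := mulr_ge0 (ltW h0) (normr_ge0 u); lra.
have inU t s : 0 <= t <= h -> 0 <= s <= h -> U (t *: u + (s *: v + x)).
  move=> th sh; apply: Ud; rewrite -ball_normE /= addrA opprD addrCA subrr addr0 normrN.
  by rewrite (lt_le_trans (small t s th sh))// ge_min lexx orbT.
have rest t s : 0 <= t <= h -> 0 <= s <= h ->
    `|'D_u g (t *: u + s *: v + x) - ('D_u g x + 'd ('D_u g) x (t *: u + s *: v))| <= e / K * `|t *: u + s *: v|.
  move=> th sh; apply: (Ed (t *: u + s *: v)).
  by rewrite -ball_normE /= sub0r normrN (lt_le_trans (small t s th sh))// ge_min lexx.
have hh : 0 <= h <= h by apply/andP; split=> //; exact: ltW.
have h00 : (0 : R) <= 0 <= h by apply/andP; split=> //; exact: ltW.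
have d1g t : 0 <= t <= h -> derivable g (t *: u + x + h *: v) u.
  by move=> th; rewrite -addrA [x + _]addrC; apply: dg; exact: inU.
have d2g t : 0 <= t <= h -> derivable g (t *: u + x) u.
  by move=> th; have := dg _ (inU t 0 th h00); rewrite scale0r add0r.
have [|c ch E1] := @MVT_line (fun y => g (y + h *: v) - g y) u x h h0.
  by move=> t th; apply: derivableB; [exact/derivable_shiftr/d1g|exact: d2g].
have {}ch : 0 <= c <= h by case/andP: ch => *; rewrite !ltW.
rewrite deriveB in E1; [|exact/derivable_shiftr/d1g|exact: d2g].
rewrite derive_shiftr -!addrA ![x + _]addrC !addrA in E1.
have -> : g (h *: u + (h *: v + x)) - g (h *: u + x) - g (h *: v + x) + g x =
   h * ('D_u g (c *: u + h *: v + x) - 'D_u g (c *: u + x)).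
  by rewrite -E1 !addrA; ring.
rewrite (deriveE v d2) expr2 -!mulrA -mulrBr normrM gtr0_norm// ler_pM2l//.
have lin : 'd ('D_u g) x (c *: u + h *: v) = 'd ('D_u g) x (c *: u) + h *: 'd ('D_u g) x v.
  rewrite linearD; congr (_ + _); exact: linearZ.
have := rest c h ch hh; have := rest c 0 ch h00; rewrite scale0r addr0 lin.
set a1 := 'D_u g _; set a2 := 'D_u g _; set a3 := 'D_u g _; set a4 := 'd _ _ _; set a5 := 'd _ _ _.
move=> R1 R2.
have -> : a3 - a1 - h * a5 = (a3 - (a2 + (a4 + h *: a5))) - (a1 - (a2 + a4)).
  by rewrite /GRing.scale /=; ring.
apply: (le_trans (ler_normB _ _)); apply: (le_trans (lerD R2 R1)).
rewrite -mulrDr mulrAC ler_pdivrMr// [h * e]mulrC -mulrA ler_pM2l//.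
have n1 : `|c *: u + h *: v| <= h * `|u| + h * `|v|.
  rewrite (le_trans (ler_normD _ _))// !normrZ [`|h|]gtr0_norm// ger0_norm; last by case/andP: ch.
  by rewrite lerD2r ler_wpM2r//; case/andP: ch.
have n2 : `|c *: u| <= h * `|u|.
  by case/andP: ch => c0 ch; rewrite normrZ ger0_norm// ler_wpM2r.
rewrite /K !mulrDr mulr1; lra.
Unshelve. all: by end_near. Qed.

Lemma close_quotients (a b D D' k e : R) : 0 < k -> D = D' ->
  `|D - k * b| <= k * (e / 2) -> `|D' - k * a| <= k * (e / 2) -> `|a - b| <= e.
Proof.
move=> k0 <- T1 T2; rewrite -(ler_pM2l k0) -[k in leLHS]gtr0_norm// -normrM.
rewrite (_ : k * (a - b) = (D - k * b) - (D - k * a)); last by ring.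
apply: (le_trans (ler_normB _ _)); apply: (le_trans (lerD T1 T2)).
by rewrite -mulrDr -splitr.
Qed.

#[local] Opaque derive.

(** The second difference is symmetric in u and v, and up to h^2 e it equals h^2 times either mixed
    derivative; one common small h compares the two. *)
Lemma derivative_symmetry (U : set V) (g : V -> R) x u v :
  open U -> U x -> (forall y, U y -> differentiable g y) ->
  differentiable ('D_u g) x -> differentiable ('D_v g) x ->
  'D_u ('D_v g) x = 'D_v ('D_u g) x.
Proof.
move=> oU Ux dg du dv; apply/eqP; rewrite -subr_eq0 -normr_eq0; apply/eqP/le_anti.
rewrite normr_ge0 andbT; apply/ler_addgt0Pr => e e0; rewrite add0r.
have dgu w y : U y -> derivable g y w by move=> /dg; exact: diff_derivable.
have e2 : 0 < e / 2 by rewrite divr_gt0.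
have S1 := second_difference v oU Ux (dgu u) du e2.
have S2 := second_difference u oU Ux (dgu v) dv e2.
have [h [T1 [T2 h0]]] := filter_ex (filterI S1 (filterI S2 (nbhs_right_gt (0 : R)))).
rewrite /= in T1 T2 h0; have h2 : 0 < h ^+ 2 by rewrite exprn_gt0.
rewrite addrCA in T2; apply: (close_quotients h2 _ T1 T2).
by congr (_ + _); rewrite addrAC.
Qed.

Lemma derive0_cst_line (g : V -> R) x y :
  (forall t : R, 0 <= t <= 1 ->
    derivable g (t *: (y - x) + x) (y - x) /\ 'D_(y - x) g (t *: (y - x) + x) = 0) ->
  g y = g x.
Proof.
move=> H; have [|c /andP[c0 c1]] := @MVT_line g (y - x) x 1 ltr01; first by move=> t /H[].
rewrite scale1r subrK mul1r => E; have [|_ Z] := H c; first by rewrite !ltW.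
by apply/eqP; rewrite -subr_eq0 E Z.
Qed.

End MeanValue.

Lemma derivative_symmetry_mx (R : realType) (n m p : nat) (U : set 'rV[R]_n)
    (F : 'rV[R]_n -> 'M[R]_(m, p)) x u v :
  open U -> U x -> smooth_on U F -> 'D_u ('D_v F) x = 'D_v ('D_u F) x.
Proof.
move=> oU Ux sF; apply/matrixP => i j.
have dF w y : U y -> derivable F y w.
  by move=> Uy; apply: diff_derivable; exact: smooth_differentiable sF Uy.
have ddF w w' : derivable ('D_w F) x w'.
  by apply: diff_derivable; apply: smooth_differentiable (smooth_derive w sF) Ux.
have E w : forall y, U y -> 'D_w F y i j = 'D_w (fun y => F y i j : R) y.
  by move=> y Uy; exact: (derive_entry i j (dF w y Uy)).
have sFij : smooth_on U (fun y => F y i j : R) by move/smooth_mxP: sF; exact.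
have H w w' : 'D_w ('D_w' F) x i j = 'D_w ('D_w' (fun y => F y i j : R)) x.
  apply: (etrans (derive_entry i j (ddF w' w))).
  exact: (derivative_eq w oU Ux (E w')).
apply: (etrans (H u v)); symmetry; apply: (etrans (H v u)).
apply: (derivative_symmetry oU Ux) => [y Uy||].
- exact: smooth_differentiable sFij Uy.
- exact: smooth_differentiable (smooth_derive v sFij) Ux.
- exact: smooth_differentiable (smooth_derive u sFij) Ux.
Qed.

(** * Differentiability of the inverse matrix *)

Section Inverse.
Variables (R : realType) (V : normedModType R).

Lemma differentiable_prodP (I : Type) (s : seq I) (F : I -> V -> R) x :
  (forall i, differentiable (F i) x) -> differentiable (fun y => \prod_(i <- s) F i y) x.
Proof.
move=> dF; elim: s => [|i s IH].
  by under eq_fun do rewrite big_nil; exact: differentiable_cst.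
by under eq_fun do rewrite big_cons; exact: differentiableM.
Qed.

Lemma differentiable_det n (A : V -> 'M[R]_n) x :
  differentiable A x -> differentiable (fun y => \det (A y) : R) x.
Proof.
move=> /differentiable_mxP dA; apply: differentiable_sumP => s.
apply: (@differentiableM _ _ (fun=> _)); first exact: differentiable_cst.
by apply: differentiable_prodP => i.
Qed.

(** Cramer's rule: the inverse is the adjugate over the determinant, both polynomial in the
    entries. *)
Lemma differentiable_invmx n (A : V -> 'M[R]_n) x (U : set V) :
  open U -> U x -> (forall y, U y -> A y \in unitmx) ->
  differentiable A x -> differentiable (fun y => invmx (A y)) x.
Proof.
move=> oU Ux uA dA.
apply: (@differentiable_eq _ _ _ (fun y => (\det (A y))^-1 *: \adj (A y)) _ _ _ oU Ux).
  by move=> y /uA uAy; rewrite /invmx uAy.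
apply/differentiable_mxP => i j.
rewrite (_ : (fun y => _) = fun y => (\det (A y))^-1 * \adj (A y) i j); last first.
  by apply/funext => y; rewrite mxE.
have nz : \det (A x) != 0 by have := uA x Ux; rewrite unitmxE unitfE.
apply: differentiableM; first by apply: differentiableV => //; exact: differentiable_det.
rewrite (_ : (fun y => _) = fun y => (-1) ^+ (j + i) * \det (row' j (col' i (A y)))); last first.
  by apply/funext => y; rewrite mxE.
apply: (@differentiableM _ _ (fun=> _)); first exact: differentiable_cst.
apply: differentiable_det; apply/differentiable_mxP => k l.
rewrite (_ : (fun y => _) = fun y => A y (lift j k) (lift i l)); last first.
  by apply/funext => y; rewrite !mxE.
by move/differentiable_mxP: dA.
Qed.

End Inverse.

(** * Euclidean and Lorentzian forms *)

Section Forms.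
Variables (R : realType) (eps : R).
Local Notation G n := (gram eps n).

Lemma gramE n (i j : 'I_n) :
  G n i j = (if i == 0%N :> nat then eps else 1) *+ (i == j).
Proof. by rewrite /gram !mxE. Qed.

Lemma tr_gram n : (G n)^T = G n.
Proof. exact: tr_diag_mx. Qed.

Lemma eformE n (x y : 'rV[R]_n) :
  eform eps x y = \sum_(i < n) (if i == 0%N :> nat then eps else 1) * (x 0 i * y 0 i).
Proof.
rewrite /eform /gram mul_mx_diag mxE; apply: eq_bigr => i _.
by rewrite !mxE -mulrA mulrCA mulrA mulrC mulrA [y 0 i * _]mulrC.
Qed.

Lemma eformC n (x y : 'rV[R]_n) : eform eps x y = eform eps y x.
Proof. by rewrite !eformE; apply: eq_bigr => i _; rewrite [x 0 i * _]mulrC. Qed.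

Lemma eformDl n (x y z : 'rV[R]_n) : eform eps (x + y) z = eform eps x z + eform eps y z.
Proof. by rewrite /eform !mulmxDl mxE. Qed.

Lemma eformZl n a (x z : 'rV[R]_n) : eform eps (a *: x) z = a * eform eps x z.
Proof. by rewrite /eform -!scalemxAl mxE. Qed.

Lemma eformDr n (x y z : 'rV[R]_n) : eform eps z (x + y) = eform eps z x + eform eps z y.
Proof. by rewrite ![eform eps z _]eformC eformDl. Qed.

Lemma eformZr n a (x z : 'rV[R]_n) : eform eps z (a *: x) = a * eform eps z x.
Proof. by rewrite ![eform eps z _]eformC eformZl. Qed.

Lemma eform0l n (z : 'rV[R]_n) : eform eps 0 z = 0.
Proof. by rewrite -(scale0r 0) eformZl mul0r. Qed.

Lemma eform0r n (z : 'rV[R]_n) : eform eps z 0 = 0.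
Proof. by rewrite eformC eform0l. Qed.

Lemma eformNl n (x z : 'rV[R]_n) : eform eps (- x) z = - eform eps x z.
Proof. by rewrite -scaleN1r eformZl mulN1r. Qed.

Lemma eformNr n (x z : 'rV[R]_n) : eform eps z (- x) = - eform eps z x.
Proof. by rewrite -scaleN1r eformZr mulN1r. Qed.

Lemma eformBl n (x y z : 'rV[R]_n) : eform eps (x - y) z = eform eps x z - eform eps y z.
Proof. by rewrite eformDl eformNl. Qed.

Lemma eformBr n (x y z : 'rV[R]_n) : eform eps z (x - y) = eform eps z x - eform eps z y.
Proof. by rewrite eformDr eformNr. Qed.

Lemma eform_suml n (I : finType) (D : pred I) (x : I -> 'rV[R]_n) z :
  eform eps (\sum_(i | D i) x i) z = \sum_(i | D i) eform eps (x i) z.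
Proof.
elim/big_ind2 : _ => [|x1 x2 y1 y2 e1 e2|//]; first exact: eform0l.
by rewrite eformDl e1 e2.
Qed.

Lemma eform_sumr n (I : finType) (D : pred I) (x : I -> 'rV[R]_n) z :
  eform eps z (\sum_(i | D i) x i) = \sum_(i | D i) eform eps z (x i).
Proof. by rewrite eformC eform_suml; apply: eq_bigr => i _; rewrite eformC. Qed.

Lemma eform_mul n m p (u : 'rV[R]_m) (v : 'rV[R]_p) (A : 'M[R]_(m, n)) (B : 'M[R]_(p, n)) :
  eform eps (u *m A) (v *m B) = (u *m (A *m G n *m B^T) *m v^T) 0 0.
Proof. by rewrite /eform trmx_mul !mulmxA. Qed.

Lemma eform_mulr n p (x : 'rV[R]_n) (v : 'rV[R]_p) (B : 'M[R]_(p, n)) :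
  eform eps x (v *m B) = (x *m G n *m B^T *m v^T) 0 0.
Proof. by rewrite /eform trmx_mul !mulmxA. Qed.

Lemma mul_gram_tr n m (x : 'rV[R]_n) (A : 'M[R]_(m, n)) i :
  (x *m G n *m A^T) 0 i = eform eps x (row i A).
Proof.
rewrite /eform tr_row colE mulmxA -colE [in RHS]mxE.
by [].
Qed.

Lemma mul_gram_trmx n m p (A : 'M[R]_(m, n)) (B : 'M[R]_(p, n)) i j :
  (A *m G n *m B^T) i j = eform eps (row i A) (row j B).
Proof. by rewrite -mul_gram_tr -!row_mul [RHS]mxE. Qed.

Lemma eform_orth_sub n m (x y : 'rV[R]_n) (A : 'M[R]_(m, n)) :
  x *m G n *m A^T = 0 -> (y <= A)%MS -> eform eps x y = 0.
Proof. by move=> xA /submxP[z ->]; rewrite eform_mulr xA mul0mx mxE. Qed.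

Lemma tr_form m n p (A : 'M[R]_(m, n)) (B : 'M[R]_(p, n)) : (A *m G n *m B^T)^T = B *m G n *m A^T.
Proof. by rewrite !trmx_mul trmxK tr_gram mulmxA. Qed.

Hypothesis heps : eps = 1 \/ eps = -1.

Lemma eps_sq : eps * eps = 1.
Proof. by case: heps => ->; rewrite ?mulr1// mulrNN mulr1. Qed.

Lemma gram_sq n : G n *m G n = 1%:M.
Proof.
rewrite /gram mulmx_diag -diag_const_mx; congr diag_mx; apply/rowP => i.
by rewrite !mxE; case: ifP => _; rewrite ?eps_sq ?mulr1.
Qed.

End Forms.

Lemma gram1 (R : realType) n : gram (1 : R) n = 1%:M.
Proof. by apply/matrixP => i j; rewrite gramE mxE if_same. Qed.

Lemma gram_block (R : realType) (s : R) m :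
  gram s (1 + m) = block_mx s%:M 0 0 (gram 1 m).
Proof.
rewrite gram1; apply/matrixP => i j; rewrite gramE.
case: (split_ordP i) => i' ->; case: (split_ordP j) => j' ->;
  rewrite ?block_mxEul ?block_mxEur ?block_mxEdl ?block_mxEdr !mxE /=.
- by rewrite !ord1.
- by rewrite ord1 eq_lrshift mulr0n.
- by rewrite ord1 eq_rlshift mulr0n.
- by rewrite eq_rshift.
Qed.

(** * Causal character of vectors in Lorentzian space *)

Section Lorentz.
Variable (R : realType).

Lemma eform1_ge0 n (x : 'rV[R]_n) : 0 <= eform 1 x x.
Proof.
rewrite eformE; apply: sumr_ge0 => i _.
by rewrite if_same mul1r -expr2 sqr_ge0.
Qed.

Lemma eform1_gt0 n (x : 'rV[R]_n) : x != 0 -> 0 < eform 1 x x.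
Proof.
move=> x0; rewrite lt_neqAle eform1_ge0 andbT eq_sym.
apply: contraNneq x0; rewrite eformE => /eqP; rewrite psumr_eq0; last first.
  by move=> i _; rewrite if_same mul1r -expr2 sqr_ge0.
move=> /allP x0; apply/eqP/rowP => i; rewrite mxE; apply/eqP.
by have := x0 i (mem_index_enum _); rewrite if_same mul1r -expr2 sqrf_eq0.
Qed.

Lemma cauchy_schwarz n (x y : 'rV[R]_n) :
  eform 1 x y ^+ 2 <= eform 1 x x * eform 1 y y.
Proof.
have [->|y0] := eqVneq y 0; first by rewrite !eform0r expr0n mulr0.
have := eform1_ge0 (eform 1 y y *: x - eform 1 x y *: y).
rewrite !(eformBl, eformBr, eformZl, eformZr) [eform 1 y x]eformC.
set a := eform 1 x x; set b := eform 1 y y; set c := eform 1 x y => h.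
have b0 : 0 < b by exact: eform1_gt0.
rewrite -(ler_pM2l b0) -subr_ge0; apply: le_trans h _.
by rewrite le_eqVlt; apply/orP; left; apply/eqP; ring.
Qed.

Lemma lshift1 n (k : 'I_1) : lshift n k = (0 : 'I_n.+1) :> 'I_(1 + n).
Proof. by apply: val_inj; rewrite /= ord1. Qed.

Lemma eform_split n (x y : 'rV[R]_(1 + n)) e :
  eform e x y = e * (x 0 0 * y 0 0) + eform 1 (rsubmx x) (rsubmx y).
Proof.
rewrite !eformE big_split_ord /= big_ord1 /=; congr (_ + _).
  by rewrite lshift1.
by apply: eq_bigr => i _; rewrite if_same !mxE.
Qed.

Lemma row_split_eq0 n (x : 'rV[R]_(1 + n)) : x 0 0 = 0 -> rsubmx x = 0 -> x = 0.
Proof.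
move=> x0 xr; rewrite -[x]hsubmxK xr; apply/rowP => i; rewrite mxE.
case: splitP => j _; rewrite ?mxE// ord1.
by rewrite lshift1.
Qed.

(** Positivity of the time coordinate, quantified over indices of value 0 as in [quadric], so that
    it makes sense for n = 0 too. *)
Definition future n (x : 'rV[R]_n) := forall i : 'I_n, i = 0%N :> nat -> 0 < x 0 i.

(** With time parts t0, x0 and space parts of squares T, X and product S, orthogonality reads S = t0
    x0. Cauchy-Schwarz gives (t0 x0)^2 <= T X, while T < t0^2; hence x0^2 < X as soon as X > 0, and
    X = 0 would force x = 0. *)
Lemma timelike_orth n (t x : 'rV[R]_n) :
  eform (-1) t t < 0 -> eform (-1) t x = 0 -> x != 0 -> 0 < eform (-1) x x.
Proof.
case: n t x => [|n] t x; first by rewrite eformE big_ord0 ltxx.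
rewrite !(@eform_split n) !mulN1r => t0 tx x0.
have cs := cauchy_schwarz (@rsubmx _ 1 1 n t) (@rsubmx _ 1 1 n x).
move: t0 tx cs; set T := eform 1 _ _; set S := eform 1 _ _; set X := eform 1 _ _ => t0 tx cs.
have T0 : 0 <= T by exact: eform1_ge0.
have X0 : 0 < X.
  rewrite lt_neqAle eform1_ge0 andbT eq_sym; apply: contraNneq x0 => X0.
  have xr : @rsubmx _ 1 1 n x = 0.
    by apply/eqP; apply: contraTT isT => /eform1_gt0; rewrite -/X X0 ltxx.
  apply/eqP/row_split_eq0 => //; move: tx; rewrite /S xr eform0r addr0 => /eqP.
  rewrite oppr_eq0 mulf_eq0 => /orP[/eqP tt|/eqP//].
  by move: t0; rewrite tt mulr0 oppr0 add0r => /(le_lt_trans T0); rewrite ltxx.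
have tt0 : 0 < t 0 0 * t 0 0 by move: t0; lra.
have e : S = t 0 0 * x 0 0 by move: tx; lra.
rewrite -(pmulr_rgt0 _ tt0); move: cs; rewrite e; nra.
Qed.

(** The combination y0 x - x0 y has no time part, so its square is nonnegative and vanishes only at
    0. By orthogonality that square is y0^2 <x,x> + x0^2 <y,y> <= 0. *)
Lemma nonspacelike_orth n (x y : 'rV[R]_n) :
  x != 0 -> y != 0 -> eform (-1) x x <= 0 -> eform (-1) y y <= 0 ->
  eform (-1) x y = 0 -> exists2 c, c != 0 & x = c *: y.
Proof.
case: n x y => [|n] x y; first by rewrite thinmx0 eqxx.
move=> x0 y0 xx yy xy.
have nz (z : 'rV[R]_n.+1) : eform (-1) z z <= 0 -> z 0 0 = 0 -> z = 0.
  move=> zz z0; apply: (@row_split_eq0 n) => //; apply/eqP.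
  apply: contraTT zz => /eform1_gt0 zr; rewrite -ltNge (@eform_split n) z0.
  by rewrite mulr0 mulr0 add0r.
have x00 : x 0 0 != 0 by apply: contraNneq x0 => /(nz _ xx)/eqP.
have y00 : y 0 0 != 0 by apply: contraNneq y0 => /(nz _ yy)/eqP.
have z : y 0 0 *: x - x 0 0 *: y = 0.
  apply: nz; last by rewrite !mxE; ring.
  rewrite !(eformBl, eformBr, eformZl, eformZr) [eform _ y x]eformC xy.
  have := mulr_ge0 (sqr_ge0 (x 0 0)) (_ : 0 <= - eform (-1) y y).
  have := mulr_ge0 (sqr_ge0 (y 0 0)) (_ : 0 <= - eform (-1) x x).
  rewrite !oppr_ge0 => /(_ xx) h1 /(_ yy) h2; lra.
exists (x 0 0 / y 0 0); first by rewrite mulf_neq0 ?invr_neq0.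
move/eqP: z; rewrite subr_eq0 => /eqP z.
by rewrite mulrC -scalerA -z scalerA mulVf// scale1r.
Qed.

(** Otherwise the product of the space parts would be at least x0 y0 > 0, against Cauchy-Schwarz,
    since each space part is shorter than the time part. *)
Lemma future_timelike n (x y : 'rV[R]_n) :
  eform (-1) x x < 0 -> eform (-1) y y < 0 -> future x -> future y ->
  eform (-1) x y < 0.
Proof.
case: n x y => [|n] x y; first by rewrite eformE big_ord0 ltxx.
rewrite !(@eform_split n) !mulN1r => xx yy /(_ 0 erefl) x0 /(_ 0 erefl) y0.
have cs := cauchy_schwarz (@rsubmx _ 1 1 n x) (@rsubmx _ 1 1 n y).
move: xx yy cs; set T := eform 1 _ _; set X := eform 1 _ _; set S := eform 1 _ _ => xx yy cs.
have T0 : 0 <= T by exact: eform1_ge0.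
have X0 : 0 <= X by exact: eform1_ge0.
rewrite ltNge; apply/negP => h.
have xy : 0 < x 0 0 * y 0 0 by rewrite mulr_gt0.
have : (x 0 0 * y 0 0) ^+ 2 <= S ^+ 2 by rewrite ler_sqr ?nnegrE; lra.
move=> /le_trans/(_ cs); rewrite leNgt => /negP; apply.
rewrite exprMn !expr2; apply: ltr_pM => //; lra.
Qed.

(** If y were not future, [- y] would be, and [future_timelike] would give the product with x the
    opposite sign. *)
Lemma timelike_future n (x y : 'rV[R]_n) :
  eform (-1) x x < 0 -> eform (-1) y y < 0 -> future x -> eform (-1) x y < 0 ->
  future y.
Proof.
case: n x y => [|n] x y; first by rewrite eformE big_ord0 ltxx.
move=> xx yy x0 xy i i0; rewrite ltNge; apply/negP => y0.
have {i0}i0 : i = 0 by exact/val_inj.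
rewrite {}i0 in y0.
have fy : future (- y).
  move=> j j0; rewrite (_ : j = 0); last exact/val_inj.
  rewrite mxE oppr_gt0 lt_neqAle y0 andbT; apply: contraTneq yy => y00.
  by rewrite -leNgt (@eform_split n) y00 mulr0 mulr0 add0r eform1_ge0.
have := future_timelike xx _ x0 fy; rewrite eformNl !eformNr opprK => /(_ yy).
by rewrite oppr_lt0 => /(lt_trans xy); rewrite ltxx.
Qed.

End Lorentz.

(** * Orthonormal bases and orthogonal projections *)

Section Frames.
Variables (R : realType) (eps : R).
Hypothesis heps : eps = 1 \/ eps = -1.

Definition posdef n m (A : 'M[R]_(m, n)) :=
  forall x : 'rV[R]_n, (x <= A)%MS -> x != 0 -> 0 < eform eps x x.

Lemma posdef_sub n m p (A : 'M[R]_(m, n)) (B : 'M[R]_(p, n)) :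
  (A <= B)%MS -> posdef B -> posdef A.
Proof. by move=> AB pB x xA; apply: pB; exact: submx_trans xA AB. Qed.

(** The premise on t says that its square has the sign of eps, which treats both signatures at once.
    With t a position vector this is the source of all nondegeneracy used below. *)
Lemma complement_pos n (t x : 'rV[R]_n) :
  0 < eps * eform eps t t -> eform eps t x = 0 -> x != 0 -> 0 < eform eps x x.
Proof.
case: heps => ->; first by move=> _ _; exact: eform1_gt0.
by rewrite mulN1r oppr_gt0; exact: timelike_orth.
Qed.

Definition orthonormal_mx n m (J : 'M[R]_(m, n)) (s : R) := J *m gram eps n *m J^T = gram s m.

Lemma orthonormal_row_free n m (J : 'M[R]_(m, n)) s :
  s = 1 \/ s = -1 -> orthonormal_mx J s -> row_free J.
Proof.
move=> hs oJ; apply/row_freeP; exists (gram eps n *m J^T *m gram s m).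
by rewrite !mulmxA oJ gram_sq.
Qed.

(** One Gram-Schmidt step. The vector e is put in front because [gram s] carries s at index 0; the
    coefficient of e in a is s <a,e> because s is its own inverse. *)
Lemma orthonormal_extend n m (A : 'M[R]_(m, n)) (e : 'rV[R]_n) s k (J : 'M[R]_(k, n)) :
  s = 1 \/ s = -1 -> (e <= A)%MS -> eform eps e e = s -> orthonormal_mx J 1 ->
  (J :=: A :&: kermx (gram eps n *m e^T))%MS ->
  orthonormal_mx (col_mx e J) s /\ (col_mx e J :=: A)%MS.
Proof.
move=> hs eA ee oJ JA; split.
  have Je : J *m gram eps n *m e^T = 0.
    have : (J <= kermx (gram eps n *m e^T))%MS by rewrite JA capmxSr.
    by move/sub_kermxP; rewrite mulmxA.
  rewrite /orthonormal_mx mul_col_mx tr_col_mx mul_col_row oJ Je gram_block.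
  have -> : e *m gram eps n *m J^T = 0 by rewrite -tr_form Je trmx0.
  congr (block_mx _ 0 0 _).
  by apply/matrixP => i j; rewrite !ord1 [RHS]mxE eqxx mulr1n -ee.
apply/eqmxP; rewrite col_mx_sub eA JA capmxSl /=.
apply/row_subP => i; set a := row i A.
have -> : a = (s * eform eps a e) *: e + (a - (s * eform eps a e) *: e) by rewrite addrC subrK.
have ss : s * s = 1 by case: hs => ->; rewrite ?mulr1// mulrNN mulr1.
apply: addmx_sub.
  by apply: scalemx_sub; rewrite -addsmxE addsmxSl.
suff: (a - (s * eform eps a e) *: e <= J)%MS.
  by move/submx_trans; apply; rewrite -addsmxE addsmxSr.
rewrite JA sub_capmx; apply/andP; split.
  by apply: addmx_sub; [exact: row_sub|rewrite eqmx_opp scalemx_sub].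
apply/sub_kermxP/matrixP => j l; rewrite !ord1 mulmxA [RHS]mxE.
rewrite -[LHS]/(eform eps (a - (s * eform eps a e) *: e) e).
by rewrite eformBl eformZl ee mulrAC ss mul1r subrr.
Qed.

(** Induction on the rank: a normalized row e of A does not lie in its own orthogonal complement, so
    the complement of e inside A has smaller rank. *)
Lemma orthonormal_basis n m (A : 'M[R]_(m, n)) : posdef A ->
  exists k (J : 'M[R]_(k, n)), orthonormal_mx J 1 /\ (J :=: A)%MS.
Proof.
have [r] := ubnP (\rank A); elim: r m A => // r IH m A rA pA.
have [A0|An0] := eqVneq A 0.
  exists 0%N, 0; split; first by rewrite /orthonormal_mx; apply/matrixP => -[].
  by rewrite A0; apply/eqmxP; rewrite !sub0mx.
pose x := nz_row A; have xA : (x <= A)%MS by exact: nz_row_sub.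
have x0 : x != 0 by rewrite nz_row_eq0.
have xx := pA _ xA x0.
pose e := (Num.sqrt (eform eps x x))^-1 *: x.
have s0 : Num.sqrt (eform eps x x) != 0 by rewrite gt_eqF// sqrtr_gt0.
have ee : eform eps e e = 1.
  rewrite /e eformZl eformZr -{3}[eform eps x x]sqr_sqrtr ?ltW// expr2.
  by rewrite mulKf// mulVf.
have eA : (e <= A)%MS by exact: scalemx_sub.
have [||k [J [oJ JA]]] := IH _ (A :&: kermx (gram eps n *m e^T))%MS.
- rewrite -ltnS; apply: leq_trans rA; rewrite ltnS ltn_neqAle mxrankS ?capmxSl// andbT.
  apply/negP => /eqP rk; have : (e <= A :&: kermx (gram eps n *m e^T))%MS.
    apply: submx_trans eA _.
    by have := (mxrank_leqif_sup (capmxSl A (kermx (gram eps n *m e^T)))).2; rewrite rk eqxx => <-.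
  rewrite sub_capmx => /andP[_ /sub_kermxP/matrixP/(_ 0 0)].
  rewrite mulmxA -[LHS]/(eform eps e e) ee mxE => /eqP.
  by rewrite oner_eq0.
- exact: posdef_sub (capmxSl _ _) pA.
exists (1 + k)%N, (col_mx e J).
by apply: orthonormal_extend => //; left.
Qed.

(* In the Lorentzian case the first basis vector is chosen along t, so that
   time orientations can be compared. *)
Lemma quadric_basis n m (A : 'M[R]_(m, n)) (t : 'rV[R]_n) :
  (eps = -1 -> (t <= A)%MS /\ eform eps t t < 0) ->
  exists k (J : 'M[R]_(k, n)), [/\ orthonormal_mx J eps, (J :=: A)%MS &
    eps = -1 -> forall i : 'I_k, i = 0%N :> nat -> exists2 a, 0 < a & row i J = a *: t].
Proof.
case: heps => [e1 _|em1 /(_ em1)[tA tt]].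
  have [|k [J [oJ JA]]] := @orthonormal_basis n m A.
    by move=> x _; rewrite e1; exact: eform1_gt0.
  exists k, J; split=> //; first by rewrite /orthonormal_mx {2}e1.
  by rewrite e1 => /eqP; rewrite -subr_eq0 opprK gt_eqF.
pose a := (Num.sqrt (- eform eps t t))^-1.
have s0 : 0 < Num.sqrt (- eform eps t t) by rewrite sqrtr_gt0 oppr_gt0.
have a0 : 0 < a by rewrite invr_gt0.
pose e := a *: t.
have ee : eform eps e e = eps.
  rewrite /e eformZl eformZr mulrA.
  have -> : eform eps t t = - (Num.sqrt (- eform eps t t)) ^+ 2.
    by rewrite sqr_sqrtr ?opprK// oppr_ge0 ltW.
  have as1 : a * Num.sqrt (- eform eps t t) = 1 by rewrite /a mulVf ?gt_eqF.
  by rewrite mulrN expr2 mulrACA as1 mulr1 -em1.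
have [|k [J [oJ JA]]] := @orthonormal_basis n _ (A :&: kermx (gram eps n *m e^T))%MS.
  move=> x; rewrite sub_capmx => /andP[_ /sub_kermxP/matrixP/(_ 0 0)].
  rewrite mulmxA -[in X in X -> _]/(eform eps x e) mxE => xe.
  apply: (@complement_pos _ e); last by rewrite eformC.
  by rewrite ee eps_sq.
have [h1 h2] := orthonormal_extend heps (scalemx_sub a tA) ee oJ JA.
exists (1 + k)%N, (col_mx e J); split=> // _ i i0; exists a => //.
have -> : i = lshift k 0 by apply/val_inj.
by rewrite rowKu; apply/rowP => j; rewrite mxE.
Qed.

Section NormalProjection.
Variables (n m : nat) (J : 'M[R]_(n, m)).
Hypothesis uJ : J *m gram eps m *m J^T \in unitmx.

Lemma nproj_orth w : w *m gram eps m *m J^T = 0 -> nproj eps J w = w.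
Proof. by move=> w0; rewrite /nproj w0 !mul0mx subr0. Qed.

Lemma nproj_sub w : (w <= J)%MS -> nproj eps J w = 0.
Proof.
move=> /submxP[z ->]; rewrite /nproj.
have -> : z *m J *m gram eps m *m J^T = z *m (J *m gram eps m *m J^T) by rewrite !mulmxA.
by rewrite mulmxK// subrr.
Qed.

Lemma nprojD w w' : nproj eps J (w + w') = nproj eps J w + nproj eps J w'.
Proof. by rewrite /nproj !mulmxDl opprD addrACA. Qed.

Lemma nproj_eq0 w : nproj eps J w = 0 -> (w <= J)%MS.
Proof. by move=> /eqP; rewrite /nproj subr_eq0 => /eqP ->; exact: submxMl. Qed.

Lemma nproj_diff w : (nproj eps J w - w <= J)%MS.
Proof. by rewrite /nproj addrAC subrr add0r eqmx_opp submxMl. Qed.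

Lemma eform_nproj w xi : xi *m gram eps m *m J^T = 0 ->
  eform eps (nproj eps J w) xi = eform eps w xi.
Proof.
move=> xi0; apply/eqP; rewrite -subr_eq0 -eformBl eformC.
by rewrite (eform_orth_sub xi0)// nproj_diff.
Qed.

End NormalProjection.

Lemma gram_unitmx n m (J : 'M[R]_(n, m)) :
  (forall u : 'rV[R]_n, u != 0 -> 0 < eform eps (u *m J) (u *m J)) ->
  J *m gram eps m *m J^T \in unitmx.
Proof.
move=> pJ; rewrite -row_free_unit -kermx_eq0; apply/eqP/row_matrixP => i.
rewrite row0; apply/eqP; apply: contraT => /pJ; rewrite eform_mul.
have -> : row i (kermx (J *m gram eps m *m J^T)) *m (J *m gram eps m *m J^T) = 0.
  by apply/sub_kermxP/row_sub.
by rewrite mul0mx mxE ltxx.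
Qed.

End Frames.

(** Greedy choice: while an element of P escapes the span, it is prepended to the family. The number
    d bounds how many more vectors fit into dimension n. The chosen vectors are themselves elements
    of P. *)
Lemma finite_span (R : fieldType) n (P : set 'rV[R]_n) :
  exists k (X : 'I_k -> 'rV[R]_n), [/\ forall i, P (X i),
    row_free (\matrix_i X i) & forall x, P x -> (x <= \matrix_i X i)%MS].
Proof.
suff H d : forall k (X : 'I_k -> 'rV[R]_n), (n <= k + d)%N -> (forall i, P (X i)) ->
    row_free (\matrix_i X i) ->
    exists k (X : 'I_k -> 'rV[R]_n), [/\ forall i, P (X i),
    row_free (\matrix_i X i) & forall x, P x -> (x <= \matrix_i X i)%MS].
  apply: (H n 0%N (fun=> 0)); [by []|by case|].
  by rewrite /row_free -leqn0 rank_leq_row.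
elim: d => [|d IH] k X kd PX fX.
  exists k, X; split=> // x _; apply: submx_full; rewrite /row_full.
  have /eqP -> := fX; rewrite eqn_leq -{2}[k]addn0 kd andbT.
  by have /eqP <- := fX; exact: rank_leq_col.
have [h|/existsNP[x /not_implyP[Px xX]]] := pselect (forall x, P x -> (x <= \matrix_i X i)%MS).
  by exists k, X.
refine (IH (1 + k)%N (fun i : 'I_(1 + k) => match fintype.split i with inl _ => x | inr j => X j end) _ _ _).
- by rewrite add1n addSnnS.
- by move=> i; case: fintype.split.
- have -> : \matrix_(i < 1 + k) (match fintype.split i with inl _ => x | inr j => X j end) = col_mx x (\matrix_i X i).
    apply/row_matrixP => i; rewrite rowK; case: splitP => j ij.
      have -> : i = lshift k j by exact/val_inj.
      by rewrite rowKu ord1; apply/rowP => l; rewrite mxE.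
    have -> : i = rshift 1 j by exact/val_inj.
    by rewrite rowKd rowK.
  rewrite /row_free -addsmxE; have /eqP fXe := fX.
  rewrite eqn_leq; apply/andP; split; first by rewrite addsmxE rank_leq_row.
  rewrite ltnNge; apply/negP => h; apply: xX.
  have := geq_leqif (mxrank_leqif_sup (addsmxSr x (\matrix_i X i))).
  by rewrite fXe h => /esym; rewrite addsmx_sub => /andP[].
Qed.

(** * Charts and partial derivatives on products *)

Section Charts.
Variables (R : realType) (M : premanifold R).
Hypothesis hM : is_manifold M.
Implicit Types (c : mchart M).

Lemma manifold_chart c : atlas c -> is_chart c.
Proof. by case: hM => _ _ _ [h _ _]; exact: h. Qed.

Lemma manifold_cover (p : M) : exists2 c : mchart M, atlas c & cdom c p.
Proof. by case: hM => _ _ _ [_ h _]; exact: h. Qed.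

Lemma ccod_cmap c p : cdom c p -> ccod c (cmap c p).
Proof. by move=> h; exists p. Qed.

Lemma cinvK c p : atlas c -> cdom c p -> cinv c (cmap c p) = p.
Proof. by move=> /manifold_chart[_ _ _ _ h]; exact: h. Qed.

Lemma cdom_cinv c x : atlas c -> ccod c x -> cdom c (cinv c x).
Proof. by move=> ac [p dp <-]; rewrite cinvK. Qed.

Lemma cmapK c x : atlas c -> ccod c x -> cmap c (cinv c x) = x.
Proof. by move=> ac [p dp <-]; rewrite cinvK. Qed.

Lemma open_ccod c : atlas c -> open (ccod c).
Proof. by move=> /manifold_chart[]. Qed.

Lemma locally_constant (T : Type) (F : M -> T) :
  connected [set: M] -> (forall p, \forall q \near p, F q = F p) ->
  forall p q, F p = F q.
Proof.
move=> cM lF p q.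
have oA (B : set T) : open (F @^-1` B).
  by rewrite openE => x Bx; apply: filterS (lF x) => y /= ->.
pose A := F @^-1` [set F p].
have : A = setT.
  apply: (cM A); first by exists p.
    by exists A; [exact: oA|rewrite setTI].
  exists A; last by rewrite setTI.
  rewrite -[A]setCK; apply: open_closedC.
  rewrite (_ : ~` A = F @^-1` (~` [set F p])); [exact: oA|by []].
by move=> /(congr1 (fun B => B q)) /= e; have : A q by rewrite e.
Qed.

(** A chart image contains a ball around the image of p; on segments from its centre the mean value
    theorem applies to each entry, so F is locally constant. *)
Lemma constant_of_zero_derivative m k (F : M -> 'M[R]_(m, k)) :
  connected [set: M] ->
  (forall c x, atlas c -> ccod c x -> differentiable (F \o cinv c) x /\
     forall v, 'D_v (F \o cinv c) x = 0) ->
  forall p q, F p = F q.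
Proof.
move=> cM dF; apply: locally_constant => // p.
have [c ac dp] := manifold_cover p.
have [oc od cc ci K] := manifold_chart ac.
have /nbhs_ballP[d /= d0 bd] : nbhs (cmap c p) (ccod c).
  by apply: open_nbhs_nbhs; split=> //; exact: ccod_cmap.
have nb : nbhs p (cmap c @^-1` (ball (cmap c p) d)).
  by apply: (cc p dp); apply/nbhs_ballP; exists d.
have nd : nbhs p (cdom c) by exact: open_nbhs_nbhs.
apply: filterS2 nb nd => q /= bq dq.
suff E : (F \o cinv c) (cmap c q) = (F \o cinv c) (cmap c p) by rewrite /= !K in E.
apply/matrixP => i j.
apply: (@derive0_cst_line _ _ (fun x => (F \o cinv c) x i j)) => t /andP[t0 t1].
set x := _ + cmap c p.
have cx : ccod c x.
  apply: bd; rewrite -ball_normE /= /x opprD addrCA subrr addr0 normrN normrZ ger0_norm//.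
  rewrite -ball_normE /= distrC in bq; apply: le_lt_trans bq.
  by rewrite -[leRHS]mul1r ler_wpM2r.
have [df d0f] := dF c x ac cx.
split.
  by apply: diff_derivable; move/differentiable_mxP: df; exact.
have dv : derivable (F \o cinv c) x (cmap c q - cmap c p) by exact: diff_derivable.
by rewrite -(derive_entry i j dv) d0f mxE.
Qed.

End Charts.

Section DfWith.
Variables (I : eqType) (T : I -> Type).
Implicit Types (p : forall i, T i).

Lemma dfwith_id p i : dfwith p i (p i) = p.
Proof. by apply: functional_extensionality_dep => j; case: dfwithP. Qed.

Lemma dfwith_idem p i x y : dfwith (dfwith p i x) i y = dfwith p i y.
Proof.
apply: functional_extensionality_dep => j.
have [<-|ij] := eqVneq i j; first by rewrite !dfwithin.
by rewrite !dfwithout.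
Qed.

Lemma dfwithC p i j x y : i != j ->
  dfwith (dfwith p i x) j y = dfwith (dfwith p j y) i x.
Proof.
move=> ij; apply: functional_extensionality_dep => k.
have [<-|ik] := eqVneq i k.
  by rewrite dfwithin dfwithout 1?eq_sym// dfwithin.
rewrite [RHS]dfwithout//; have [<-|jk] := eqVneq j k; first by rewrite !dfwithin.
by rewrite !dfwithout.
Qed.

End DfWith.

Lemma submxrowZ (R : pzRingType) m n (q : 'I_n -> nat) (h : R) (A : 'M[R]_(m, \sum_i q i)) j :
  submxrow (h *: A) j = h *: submxrow A j.
Proof. by rewrite -[LHS]/(colsub _ _) linearZ. Qed.

Section ProductCalculus.
Variables (R : realType) (r : nat) (M : 'I_r -> premanifold R).
Hypothesis hM : forall i, is_manifold (M i).
Local Notation P := (prodM M).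
Implicit Types (c : forall i, mchart (M i)) (p : P).

Definition in_charts c := forall i, atlas (c i).
Definition in_domains c p := forall i, cdom (c i) (p i).

Lemma exists_charts p : exists2 c, in_charts c & in_domains c p.
Proof.
exists (fun i => sval (cid2 (manifold_cover (hM i) (p i)))) => i; by case: cid2.
Qed.

(** Statements about one factor mention a chart of that factor only. Completing it to a product
    chart gives access to the calculus on open subsets of the model space. *)
Lemma exists_charts1 p i (ci : mchart (M i)) : atlas ci -> cdom ci (p i) ->
  exists c, [/\ in_charts c, in_domains c p & c i = ci].
Proof.
move=> ai di; have [c ac dc] := exists_charts p.
exists (dfwith c i ci); split; last by rewrite dfwithin.
  by move=> j; have [<-|ij] := eqVneq i j; rewrite ?dfwithin ?dfwithout.
by move=> j; have [<-|ij] := eqVneq i j; rewrite ?dfwithin ?dfwithout.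
Qed.

Lemma exists_charts2 p i j (ci : mchart (M i)) (cj : mchart (M j)) : i != j ->
  atlas ci -> cdom ci (p i) -> atlas cj -> cdom cj (p j) ->
  exists c, [/\ in_charts c, in_domains c p, c i = ci & c j = cj].
Proof.
move=> ij ai di aj dj; have [c [ac dc ej]] := exists_charts1 aj dj.
exists (dfwith c i ci); split; [| |by rewrite dfwithin|by rewrite dfwithout].
  by move=> k; have [<-|ik] := eqVneq i k; rewrite ?dfwithin ?dfwithout.
by move=> k; have [<-|ik] := eqVneq i k; rewrite ?dfwithin ?dfwithout.
Qed.

Lemma in_domains_dfwith c p i (q : M i) :
  in_domains c p -> cdom (c i) q -> in_domains c (dfwith p i q).
Proof.
by move=> dp dq j; have [<-|ij] := eqVneq i j; rewrite ?dfwithin ?dfwithout.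
Qed.

Lemma submxrow_differentiable n (q : 'I_n -> nat) i (x : 'rV[R]_(\sum_i q i)) :
  differentiable (fun y : 'rV[R]_(\sum_i q i) => submxrow y i) x.
Proof.
apply/differentiable_mxP => k l.
rewrite (_ : (fun y => _) = fun y : 'rV[R]_(\sum_i q i) => y k (tagnat.Rank i l)).
  exact: differentiable_coord.
by apply/funext => y; rewrite mxE.
Qed.

Lemma ccod_prod c x : in_charts c ->
  ccod (prod_chart c) x <-> forall i, ccod (c i) (submxrow x i).
Proof.
move=> ac; split=> [[p dp <-] i|dx].
  by rewrite /= mxrowK; apply: ccod_cmap; exact: dp.
exists (cinv (prod_chart c) x); first by move=> i /=; exact: cdom_cinv.
by apply/mxrowP => i; rewrite mxrowK /= cmapK.
Qed.

Lemma ccod_prod_cmap c p : in_domains c p -> ccod (prod_chart c) (cmap (prod_chart c) p).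
Proof. by move=> dp; exists p. Qed.

Lemma prod_cinvK c p : in_charts c -> in_domains c p ->
  cinv (prod_chart c) (cmap (prod_chart c) p) = p.
Proof.
move=> ac dp; apply: functional_extensionality_dep => i.
by rewrite /= mxrowK cinvK//; exact: dp.
Qed.

Lemma open_ccod_prod c : in_charts c -> open (ccod (prod_chart c)).
Proof.
move=> ac; rewrite openE => x /(ccod_prod _ ac) hx.
have : (nbhs x) (fun y => forall i, ccod (c i) (submxrow y i)).
  pose f i := [set y : 'rV[R]_(mdim P) | ccod (c i) (submxrow y i)].
  have FF : Filter (nbhs x) by exact: nbhs_filter.
  refine (@filter_forall _ _ f _ FF _) => i.
  have := differentiable_continuous (submxrow_differentiable i x).
  apply; apply: open_nbhs_nbhs; split; [exact: open_ccod|exact: hx].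
by apply: filterS => y hy; apply/ccod_prod.
Qed.

Lemma atlas_prod c : in_charts c -> atlas (prod_chart c : mchart P).
Proof. by move=> ac; exists c. Qed.

(* The vector of E_i with components w. *)
Definition factor_vec i (w : 'rV[R]_(mdim (M i))) : 'rV[R]_(mdim P) :=
  \mxrow_j dfwith (fun j => 0 : 'rV[R]_(mdim (M j))) i w j.

Lemma factor_vecK i w : submxrow (factor_vec w) i = w :> 'rV[R]_(mdim (M i)).
Proof. by rewrite mxrowK dfwithin. Qed.

Lemma factor_vec_out i j (w : 'rV[R]_(mdim (M i))) : i != j -> submxrow (factor_vec w) j = 0.
Proof. by move=> ij; rewrite mxrowK dfwithout. Qed.

Lemma in_factor_vec i (w : 'rV[R]_(mdim (M i))) : in_factor i (factor_vec w).
Proof. by move=> j ji; rewrite factor_vec_out// eq_sym. Qed.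

Lemma in_factorE i (u : 'rV[R]_(mdim P)) : in_factor i u -> u = factor_vec (submxrow u i).
Proof.
move=> ui; apply/mxrowP => j; have [<-|ij] := eqVneq i j; first by rewrite factor_vecK.
by rewrite factor_vec_out// ui// eq_sym.
Qed.

Lemma sum_factor_vec (u : 'rV[R]_(mdim P)) : u = \sum_i factor_vec (submxrow u i).
Proof.
apply/mxrowP => j; rewrite submxrow_sum (bigD1 j)//= factor_vecK big1 ?addr0// => i ij.
by rewrite factor_vec_out.
Qed.

Lemma factor_vecP h i (v : 'rV[R]_(mdim (M i))) (x : 'rV[R]_(mdim P)) j :
  submxrow (h *: factor_vec v + x) j =
  dfwith (fun j => submxrow x j) i (h *: v + submxrow x i) j.
Proof.
rewrite submxrowD submxrowZ.
have [<-|ij] := eqVneq i j; first by rewrite factor_vecK dfwithin.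
by rewrite factor_vec_out// dfwithout// scaler0 add0r.
Qed.

Section Partial.
Variables (m k : nat).
Implicit Types (f : P -> 'M[R]_(m, k)).

(* Partial derivative along the factor M_i, in the direction with components w
   in the chart ci. *)
Definition pd i (ci : mchart (M i)) w f p : 'M[R]_(m, k) :=
  'D_w (fun y => f (dfwith p i (cinv ci y))) (cmap ci (p i)).

Definition smooth_in c f := smooth_on (ccod (prod_chart c)) (f \o cinv (prod_chart c)).

(** Along a vector of E_i only coordinate i moves, so the difference quotient in the product chart
    is that of the slice through the point. *)
Lemma pd_cinv c i w f x : in_charts c -> ccod (prod_chart c) x ->
  'D_(factor_vec w) (f \o cinv (prod_chart c)) x = pd (c i) w f (cinv (prod_chart c) x).
Proof.
move=> ac /(ccod_prod _ ac) cx; rewrite /pd [cmap _ _](cmapK (hM i) (ac i) (cx i)) /derive.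
set a := fun h : R => _; set b := fun h : R => _.
have -> : a = b; last by [].
apply/funext => h; rewrite /a /b /=; congr (_ *: (f _ - f _)).
  apply: functional_extensionality_dep => j; rewrite factor_vecP.
  have [<-|ij] := eqVneq i j; first by rewrite !dfwithin.
  by rewrite !dfwithout.
by rewrite (dfwith_id (fun i => cinv (c i) (submxrow x i))).
Qed.

Lemma pd_cmap c i w f p : in_charts c -> in_domains c p ->
  pd (c i) w f p = 'D_(factor_vec w) (f \o cinv (prod_chart c)) (cmap (prod_chart c) p).
Proof.
by move=> ac dp; rewrite (pd_cinv w f ac (ccod_prod_cmap dp)) (prod_cinvK ac dp).
Qed.

Lemma smooth_in_pd c i w f : in_charts c -> smooth_in c f -> smooth_in c (pd (c i) w f).
Proof.
move=> ac sf; apply: (smooth_eq (open_ccod_prod ac) _ (smooth_derive (factor_vec w) sf)).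
by move=> y cy; exact: pd_cinv.
Qed.

Lemma affine_slice c i (x : 'rV[R]_(mdim P)) :
  affine_with (fun y : 'rV[R]_(mdim (M i)) => \mxrow_j dfwith (fun j => submxrow x j) i y j : 'rV[R]_(mdim P))
    (@factor_vec i).
Proof.
move=> h v y; apply/mxrowP => j; rewrite factor_vecP.
have [<-|ij] := eqVneq i j; first by rewrite !mxrowK !dfwithin.
by rewrite !mxrowK !dfwithout// mxrowK dfwithout.
Qed.

Lemma smooth_slice c p i f : in_charts c -> smooth_in c f ->
  (forall j, j != i -> cdom (c j) (p j)) ->
  smooth_on (ccod (c i)) (fun y => f (dfwith p i (cinv (c i) y))).
Proof.
move=> ac sf dp; have oi := open_ccod (hM i) (ac i).
pose x : 'rV[R]_(mdim P) := \mxrow_j cmap (c j) (p j).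
have := smooth_affine (U := ccod (c i)) (affine_slice c x) _ sf.
move=> H; apply: (smooth_eq oi _ (H _)) => [y cy|y cy].
  rewrite /=; congr f; apply: functional_extensionality_dep => j; rewrite mxrowK.
  have [<-|ij] := eqVneq i j; first by rewrite !dfwithin.
  by rewrite !dfwithout// mxrowK cinvK//; apply: dp; rewrite eq_sym.
apply/ccod_prod => // j; rewrite mxrowK.
have [<-|ij] := eqVneq i j; first by rewrite dfwithin.
by rewrite dfwithout// mxrowK; apply: ccod_cmap; apply: dp; rewrite eq_sym.
Qed.

Lemma differentiable_slice c p i f : in_charts c -> smooth_in c f -> in_domains c p ->
  differentiable (fun y => f (dfwith p i (cinv (c i) y))) (cmap (c i) (p i)).
Proof.
move=> ac sf dp; apply: (smooth_differentiable (smooth_slice ac sf _)).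
  by move=> j _; exact: dp.
exact: ccod_cmap.
Qed.

Lemma pdC c i j w w' f p : in_charts c -> smooth_in c f -> in_domains c p ->
  pd (c i) w (pd (c j) w' f) p = pd (c j) w' (pd (c i) w f) p.
Proof.
move=> ac sf dp.
have H i' j' v v' : pd (c i') v (pd (c j') v' f) p =
    'D_(factor_vec v) ('D_(factor_vec v') (f \o cinv (prod_chart c))) (cmap (prod_chart c) p).
  apply: (etrans (pd_cmap _ _ ac dp)).
  apply: (derivative_eq _ (open_ccod_prod ac) (ccod_prod_cmap dp)) => y cy /=.
  by symmetry; exact: pd_cinv.
apply: (etrans (H _ _ _ _)); symmetry; apply: (etrans (H _ _ _ _)).
exact: (derivative_symmetry_mx _ _ (open_ccod_prod ac) (ccod_prod_cmap dp) sf).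
Qed.

Lemma derive_prod c (u : 'rV[R]_(mdim P)) f p : in_charts c -> smooth_in c f -> in_domains c p ->
  'D_u (f \o cinv (prod_chart c)) (cmap (prod_chart c) p) =
  \sum_i pd (c i) (submxrow u i) f p.
Proof.
move=> ac sf dp; have df := smooth_differentiable sf (ccod_prod_cmap dp).
rewrite deriveE// {1}[u]sum_factor_vec linear_sum; apply: eq_bigr => i _.
by rewrite pd_cmap// deriveE.
Qed.

Lemma pd_slice (i : 'I_r) (ci : mchart (M i)) w f p y :
  atlas ci -> ccod ci y ->
  'D_w (fun z => f (dfwith p i (cinv ci z))) y = pd ci w f (dfwith p i (cinv ci y)).
Proof.
move=> ai cy; rewrite /pd dfwithin cmapK//.
by under eq_fun do rewrite -(dfwith_idem p (cinv ci y)).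
Qed.

Lemma constant_slice p i f : connected [set: M i] ->
  (forall ci : mchart (M i), atlas ci ->
     smooth_on (ccod ci) (fun y => f (dfwith p i (cinv ci y)))) ->
  (forall (ci : mchart (M i)) q w, atlas ci -> cdom ci q -> pd ci w f (dfwith p i q) = 0) ->
  forall q, f (dfwith p i q) = f p.
Proof.
move=> cMi sf df q; rewrite -[in RHS](dfwith_id p i).
apply: (constant_of_zero_derivative (F := fun q => f (dfwith p i q)) (hM i) cMi).
move=> ci x ai cx; split; first exact: (smooth_differentiable (sf ci ai)).
by move=> v; rewrite pd_slice//; apply: df => //; exact: cdom_cinv.
Qed.

Lemma constant_prod f : (forall p i q, f (dfwith p i q) = f p) -> forall p q, f p = f q.
Proof.
move=> fc p q.
(* The first n coordinates are those of q, the others those of p; consecutive points differ in one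
   coordinate. *)
pose mix n : P := fun i => if (i < n)%N then q i else p i.
have H n : (n <= r)%N -> f (mix n) = f p.
  elim: n => [_|n IH nr]; first by congr f; apply: functional_extensionality_dep.
  apply: etrans (IH (ltnW nr)); apply: etrans (fc (mix n) (Ordinal nr) (q (Ordinal nr))).
  congr f.
  apply: functional_extensionality_dep => i; rewrite /mix.
  have [<-|ni] := eqVneq (Ordinal nr) i; first by rewrite dfwithin ltnS leqnn.
  rewrite dfwithout// ltnS leq_eqVlt; case: eqP => // e.
  by case/eqP: ni; exact/val_inj.
rewrite -(H r (leqnn r)); congr f; apply: functional_extensionality_dep => i.
by rewrite /mix ltn_ord.
Qed.

End Partial.

End ProductCalculus.

(** * Extrinsic products *)

Section EformCalculus.
Variables (R : realType) (V : normedModType R) (eps : R).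
Implicit Types (x v : V).

Lemma derive_eform n (F H : V -> 'rV[R]_n) x v : differentiable F x -> differentiable H x ->
  'D_v (fun y => eform eps (F y) (H y)) x = eform eps ('D_v F x) (H x) + eform eps (F x) ('D_v H x).
Proof.
move=> dF dH; have dFG : differentiable (fun y => F y *m gram eps n) x.
  by apply: differentiable_mulmx => //; exact: differentiable_cst.
have dHT := differentiable_trmx dH.
have dE := differentiable_mulmx dFG dHT.
have dv : derivable (fun y => F y *m gram eps n *m (H y)^T) x v by exact: diff_derivable.
apply: (etrans (esym (derive_entry 0 0 dv))).
by rewrite (derive_mulmx v dFG dHT) (derive_mulmxr _ v dF) (derive_trmx v dH) mxE.
Qed.

Lemma derive_eform_const n (F H : V -> 'rV[R]_n) x v (U : set V) k :
  open U -> U x -> (forall y, U y -> eform eps (F y) (H y) = k) ->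
  differentiable F x -> differentiable H x ->
  eform eps ('D_v F x) (H x) + eform eps (F x) ('D_v H x) = 0.
Proof.
move=> oU Ux Fk dF dH; rewrite -(derive_eform v dF dH).
by rewrite (derivative_eq v oU Ux Fk); exact: derive_cst.
Qed.

Lemma derive_sub n p q (F : V -> 'M[R]_(q, n)) (A : 'M[R]_(p, n)) x v (U : set V) :
  open U -> U x -> (forall y, U y -> (F y <= A)%MS) -> differentiable F x ->
  ('D_v F x <= A)%MS.
Proof.
move=> oU Ux FA dF; rewrite submxE -(derive_mulmxr (cokermx A) v dF); apply/eqP.
apply: etrans (derivative_eq v oU Ux _) (derive_cst 0 _ _) => y /FA.
by rewrite submxE => /eqP.
Qed.

End EformCalculus.

Lemma jacobianE (R : realType) n m (F : 'rV[R]_n -> 'rV[R]_m) x u :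
  differentiable F x -> u *m 'J F x = 'D_u F x.
Proof. by move=> dF; rewrite deriveEjacobian. Qed.

(** * Sums of maps of the single factors *)

Section SumForm.
Variables (R : realType) (eps : R) (r N : nat) (M : 'I_r -> premanifold R).
Hypothesis hM : forall i, is_manifold (M i).
Local Notation P := (prodM M).
Implicit Types (c : forall i, mchart (M i)).

Lemma submxrow_affine i :
  affine_with (fun x : 'rV[R]_(mdim P) => submxrow x i) (fun v => submxrow v i).
Proof.
by move=> h v x; rewrite submxrowD submxrowZ.
Qed.

Lemma smooth_in_coord m k i (psi : M i -> 'M[R]_(m, k)) c : in_charts c ->
  smooth_map psi -> smooth_in c (fun p : P => psi (p i)).
Proof.
move=> ac spsi.
apply: (smooth_affine (submxrow_affine i) _ (spsi (c i) (ac i))) => x.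
by move=> /(ccod_prod hM _ ac).
Qed.

Lemma smooth_map_prod m k (f : P -> 'M[R]_(m, k)) :
  (forall c, in_charts c -> smooth_in c f) -> smooth_map f.
Proof. by move=> sf c' [c ac ->]; exact: sf. Qed.

Lemma smooth_map_in m k (f : P -> 'M[R]_(m, k)) c :
  smooth_map f -> in_charts c -> smooth_in c f.
Proof. by move=> sf ac; apply: sf; exact: atlas_prod. Qed.

Lemma jac_prod (f : P -> 'rV[R]_N) c p (u : 'rV[R]_(mdim P)) :
  in_charts c -> smooth_in c f -> in_domains c p ->
  u *m jac f (prod_chart c) p = \sum_i pd (c i) (submxrow u i) f p.
Proof.
move=> ac sf dp; rewrite -derive_prod// /jac jacobianE//.
exact: (smooth_differentiable sf (ccod_prod_cmap dp)).
Qed.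

Lemma factor_jac (f : P -> 'rV[R]_N) c p i (w : 'rV[R]_(mdim (M i))) :
  in_charts c -> smooth_in c f -> in_domains c p ->
  factor_vec w *m jac f (prod_chart c) p = pd (c i) w f p.
Proof.
move=> ac sf dp; rewrite pd_cmap// /jac jacobianE//.
exact: (smooth_differentiable sf (ccod_prod_cmap dp)).
Qed.

Variables (ft : P -> 'rV[R]_N) (c0 : 'rV[R]_N) (psi : forall a, M a -> 'rV[R]_N).
Hypothesis ftE : forall p, ft p = c0 + \sum_a psi (p a).
Hypothesis spsi : forall a, smooth_map (@psi a).

Lemma sum_form_smooth : smooth_map ft.
Proof.
apply: smooth_map_prod => c ac.
apply: (smooth_eq (open_ccod_prod hM ac) (F := fun x => c0 + \sum_a psi (cinv (prod_chart c) x a))).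
  by move=> x _; rewrite /= ftE.
apply: smoothD; [exact: open_ccod_prod|exact: smooth_cst|].
apply: smooth_sum; [exact: open_ccod_prod|] => a.
exact: (smooth_in_coord ac (@spsi a)).
Qed.

Lemma sum_form_pd a (ca : mchart (M a)) w p : atlas ca -> cdom ca (p a) ->
  pd ca w ft p = 'D_w (@psi a \o cinv ca) (cmap ca (p a)).
Proof.
move=> aa da; rewrite /pd.
have dpsi := smooth_differentiable (@spsi a ca aa) (ccod_cmap da).
pose k := c0 + \sum_(b | b != a) psi (p b).
have -> : (fun y => ft (dfwith p a (cinv ca y))) = (fun y => k) + (@psi a \o cinv ca).
  apply/funext => y; rewrite ftE (bigD1 a)//= dfwithin fctE /= /k -addrA; congr (_ + _).
  rewrite addrC; congr (_ + _); apply: eq_bigr => b ba.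
  by rewrite dfwithout// eq_sym.
rewrite deriveD; [|exact: derivable_cst|exact: diff_derivable].
by rewrite (_ : 'D_w _ _ = 0) ?add0r//; exact: derive_cst.
Qed.

Lemma sum_form_pd2 a b (ca : mchart (M a)) (cb : mchart (M b)) w w' p : a != b ->
  atlas cb -> cdom cb (p b) -> pd ca w (pd cb w' ft) p = 0.
Proof.
move=> ab ab' db; rewrite {1}/pd.
rewrite (_ : (fun y => _) = fun=> 'D_w' (@psi b \o cinv cb) (cmap cb (p b))).
  exact: derive_cst.
by apply/funext => y; rewrite sum_form_pd// dfwithout.
Qed.

Hypothesis opsi : forall a b (q : M a) (q' : M b), a != b -> eform eps (psi q) (psi q') = 0.

(** The relation <psi a q, psi b q'> = 0 holds for independent q and q', and is differentiated first
    in q', then in q. *)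
Lemma sum_form_orth a b (ca : mchart (M a)) (cb : mchart (M b)) w w' p : a != b ->
  atlas ca -> cdom ca (p a) -> atlas cb -> cdom cb (p b) ->
  eform eps (pd ca w ft p) (pd cb w' ft p) = 0.
Proof.
move=> ab aa da bb db; rewrite !sum_form_pd//.
have dpa := smooth_differentiable (@spsi a ca aa) (ccod_cmap da).
have dpb := smooth_differentiable (@spsi b cb bb) (ccod_cmap db).
have oa := open_ccod (hM a) aa; have ob := open_ccod (hM b) bb.
have H (q : M a) : eform eps (psi q) ('D_w' (@psi b \o cinv cb) (cmap cb (p b))) = 0.
  have := @derive_eform_const _ _ eps _ (fun=> psi q) (@psi b \o cinv cb) _ w' _ 0 ob (ccod_cmap db).
  rewrite (_ : 'D_w' (fun=> psi q) _ = 0); last exact: derive_cst.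
  rewrite eform0l add0r; apply=> [y _||//]; first exact: opsi.
  exact: differentiable_cst.
set d := 'D_w' (@psi b \o cinv cb) (cmap cb (p b)) in H *.
have := @derive_eform_const _ _ eps _ (@psi a \o cinv ca) (fun=> d) _ w _ 0 oa (ccod_cmap da).
rewrite (_ : 'D_w (fun=> d) _ = 0); last exact: derive_cst.
rewrite eform0r addr0; apply=> [y _|//|]; first exact: H.
exact: differentiable_cst.
Qed.

Variables (m : 'I_r -> nat) (h : forall a, M a -> 'rV[R]_(m a)) (Q : forall a, 'M[R]_(N, m a)).
Arguments h : clear implicits.
Hypothesis psiQ : forall a (q : M a), psi q *m Q a = h a q.
Hypothesis psiQ0 : forall a b (q : M a), a != b -> psi q *m Q b = 0.
Hypothesis ih : forall a, immersion (h a).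

(** Applying [Q b] to the equation for a vector u in the kernel of the differential isolates the
    derivative of [h b] along the component of u in E_b, which is injective. *)
Lemma sum_form_immersion : immersion ft.
Proof.
split=> [|c' p [c ac ->] dp]; first exact: sum_form_smooth.
have sf : smooth_in c ft by apply: smooth_map_in => //; exact: sum_form_smooth.
apply/inj_row_free => u; rewrite jac_prod// => u0.
apply/mxrowP => b; rewrite submxrow0.
have [_ fb] := ih b; have {}fb := fb (c b) (p b) (ac b) (dp b).
apply: (row_free_inj fb); rewrite mul0mx /jac.
have oc a := open_ccod (hM a) (ac a).
have dpsi a := smooth_differentiable (@spsi a (c a) (ac a)) (ccod_cmap (dp a)).
have dh : differentiable (h b \o cinv (c b)) (cmap (c b) (p b)).
  by apply: smooth_differentiable (ccod_cmap (dp b)); have [+ _] := ih b; apply.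
rewrite jacobianE//.
have : (\sum_i pd (c i) (submxrow u i) ft p) *m Q b = 0 by rewrite u0 mul0mx.
rewrite mulmx_suml (bigD1 b)//= big1 ?addr0.
  move=> <-; rewrite sum_form_pd// -(derive_mulmxr (Q b) (submxrow u b) (dpsi b)).
  by apply: (derivative_eq _ (oc b) (ccod_cmap (dp b))) => y _; rewrite /= psiQ.
move=> a ab; rewrite sum_form_pd// -(derive_mulmxr (Q b) (submxrow u a) (dpsi a)).
apply: etrans (derivative_eq _ (oc a) (ccod_cmap (dp a)) _) (derive_cst 0 _ _) => y _.
by rewrite psiQ0.
Qed.

End SumForm.

Section ExtrinsicProductProperties.
Variables (R : realType) (eps : R) (r N : nat) (M : 'I_r -> premanifold R).
Hypothesis heps : eps = 1 \/ eps = -1.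
Hypothesis hM : forall i, is_manifold (M i).
Local Notation P := (prodM M).

(** The infinitesimal properties of extrinsic products on which the direct part relies. In the
    converse the leaves are shown to have them, and [product_like_extrinsic] integrates them
    back. *)
Definition product_like (ft : P -> 'rV[R]_N) : Prop :=
  [/\ immersion ft,
      forall a b (ca : mchart (M a)) (cb : mchart (M b)) w w' p, a != b ->
        atlas ca -> cdom ca (p a) -> atlas cb -> cdom cb (p b) ->
        pd ca w (pd cb w' ft) p = 0 &
      forall a b (ca : mchart (M a)) (cb : mchart (M b)) w w' p, a != b ->
        atlas ca -> cdom ca (p a) -> atlas cb -> cdom cb (p b) ->
        eform eps (pd ca w ft p) (pd cb w' ft p) = 0].

Lemma product_in_quadrics_like sig (ft : P -> 'rV[R]_N) :
  (forall a, sig a = 1 \/ sig a = -1) ->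
  product_in_quadrics eps sig ft -> product_like ft.
Proof.
move=> hs [m [J [rad [h [[_ JJ JJ0] _ hh _ ftE]]]]].
have ih a : immersion (h a) by have [] := hh a.
pose psi a (q : M a) := h a q *m J a.
have ftE' p : ft p = 0 + \sum_a psi a (p a) by rewrite add0r ftE.
have spsi a : smooth_map (psi a).
  move=> c ac; apply: smooth_mulmxr; first exact: open_ccod.
  by have [+ _] := ih a; apply.
split.
(* The matrices supplied for Q: since [J a] has Gram matrix [gram (sig a) (m a)], an involution, the
   a-th one is a right inverse of [J a]; it is annihilated by the other blocks. *)
- apply: (@sum_form_immersion _ r N _ hM _ 0 psi ftE' spsi m h (fun a => gram eps N *m (J a)^T *m gram (sig a) (m a))) => //.
    by move=> a q; rewrite /psi !mulmxA -(mulmxA (h a q)) -(mulmxA (h a q)) JJ -mulmxA gram_sq// mulmx1.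
  by move=> a b q ab; rewrite /psi !mulmxA -(mulmxA (h a q)) -(mulmxA (h a q)) JJ0// mulmx0 mul0mx.
- by move=> *; apply: (sum_form_pd2 ftE').
- move=> *; apply: (sum_form_orth hM ftE') => // a b q q' ab.
  by rewrite /psi eform_mul JJ0// mulmx0 mul0mx mxE.
Qed.

Lemma product_in_horosphere_like (ft : P -> 'rV[R]_N) : eps = -1 ->
  product_in_horosphere ft -> product_like ft.
Proof.
move=> em1 [k [j [m [K [h [kN [C [v [w [[vv ww vw] CC [Cv Cw] jE _]]]] [_ KK KK0] ih ftE]]]]]].
rewrite -em1 in vv ww vw CC Cv Cw.
have wC : w *m gram eps N *m C^T = 0 by rewrite -tr_form Cw trmx0.
(* The quadratic term of the horosphere inclusion splits over the factors because the images of the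
   [K a] are orthogonal. Its constant part -1/2 w joins v in the constant term. *)
pose psi a (q : M a) := h a q *m K a *m C - ((eform 1 (h a q) (h a q)) / 2) *: w.
have KK' a b (q : M a) (q' : M b) : eform 1 (h a q *m K a) (h b q' *m K b) =
    if a == b then eform 1 (h a q *m K a) (h b q' *m K b) else 0.
  case: eqVneq => // ab.
  by rewrite eform_mul KK0// mulmx0 mul0mx mxE.
have KK1 a (q : M a) : eform 1 (h a q *m K a) (h a q *m K a) = eform 1 (h a q) (h a q).
  by rewrite eform_mul KK.
have ftE' p : ft p = (v - 2^-1 *: w) + \sum_a psi a (p a).
  rewrite ftE jE eform_suml.
  have -> : \sum_a eform 1 (h a (p a) *m K a) (\sum_b h b (p b) *m K b) =
      \sum_a eform 1 (h a (p a)) (h a (p a)).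
    apply: eq_bigr => a _; rewrite eform_sumr (bigD1 a)//= big1 ?addr0 ?KK1// => b ba.
    by rewrite KK' eq_sym (negPf ba).
  rewrite /psi sumrB mulmx_suml -scaler_suml -mulr_suml mulrDl scalerDl mul1r opprD.
  by rewrite -!addrA; congr (_ + _); rewrite addrCA.
have spsi a : smooth_map (psi a).
  move=> c ac; have oc := open_ccod (hM a) ac.
  have sh : smooth_on (ccod c) (h a \o cinv c) by have [+ _] := ih a; apply.
  apply: smoothD => //; first by do 2!apply: smooth_mulmxr => //.
  have -> : (fun x => - (eform 1 (h a (cinv c x)) (h a (cinv c x)) / 2 *: w)) =
    (fun x => ((h a \o cinv c) x *m gram 1 (m a) *m ((h a \o cinv c) x)^T) *m (- 2^-1 *: w)).
    apply/funext => x; rewrite -scalemxAr -scalerA scaleNr; congr (- _).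
    rewrite scalerA mulrC -scalerA; congr (_ *: _).
    by rewrite [_ *m _^T]mx11_scalar mul_scalar_mx.
  apply: smooth_mulmxr => //; apply: smooth_mulmx => //; first exact: smooth_mulmxr.
  exact: smooth_trmx.
split.
- apply: (@sum_form_immersion _ r N _ hM _ (v - 2^-1 *: w) psi ftE' spsi m h (fun a => gram eps N *m C^T *m (K a)^T)) => //.
    move=> a q; rewrite /psi mulmxBl -scalemxAl !mulmxA wC mul0mx scaler0 subr0.
    rewrite -(mulmxA (h a q *m K a)) -(mulmxA (h a q *m K a)) CC mulmx1.
    by have := KK a; rewrite !gram1 mulmx1 => KKa; rewrite -mulmxA KKa mulmx1.
  move=> a b q ab; rewrite /psi mulmxBl -scalemxAl !mulmxA wC mul0mx scaler0 subr0.
  rewrite -(mulmxA (h a q *m K a)) -(mulmxA (h a q *m K a)) CC mulmx1.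
  by have := KK0 _ _ ab; rewrite !gram1 mulmx1 => KKa; rewrite -mulmxA KKa mulmx0.
- by move=> *; apply: (sum_form_pd2 ftE').
- move=> *; apply: (sum_form_orth hM ftE') => // a b q q' ab.
  rewrite /psi !(eformBl, eformBr, eformZl, eformZr) ww !mulr0 subr0.
  have wh x : eform eps w (x *m C) = 0 by rewrite eform_mulr wC mul0mx mxE.
  rewrite wh [eform _ _ w]eformC wh !mulr0 !subr0.
  have e : (h a q *m K a *m (h b q' *m K b)^T) 0 0 = 0.
    by have := KK' a b q q'; rewrite (negPf ab) /eform gram1 mulmx1.
  by rewrite eform_mul CC mulmx1.
Qed.

Lemma extrinsic_product_like (ft : P -> 'rV[R]_N) :
  extrinsic_product eps ft -> product_like ft.
Proof.
move=> [_ [[e1 h]|[em1 [[b h]|h]]]].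
- by apply: product_in_quadrics_like h => a; left.
- rewrite -em1 in h; apply: product_in_quadrics_like h => a.
  by case: ifP => _; [right|left].
- exact: product_in_horosphere_like.
Qed.

End ExtrinsicProductProperties.

(** * Immersions into quadrics *)

Section ChartGeometry.
Variables (R : realType) (eps : R) (N : nat) (M : premanifold R).
Hypothesis heps : eps = 1 \/ eps = -1.
Implicit Types (F : M -> 'rV[R]_N) (c : mchart M).

(** What the local computations use of a chart. Charts of a manifold and product charts share it, so
    that both are treated together without a manifold structure on the product. *)
Definition good_chart c :=
  open (ccod c) /\ forall p, cdom c p -> cinv c (cmap c p) = p.

Lemma good_cmapK c x : good_chart c -> ccod c x -> cmap c (cinv c x) = x.
Proof. by move=> [_ K] [p dp <-]; rewrite K. Qed.

Lemma good_cdom c x : good_chart c -> ccod c x -> cdom c (cinv c x).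
Proof. by move=> [_ K] [p dp <-]; rewrite K. Qed.

Section AtPoint.
Variables (F : M -> 'rV[R]_N) (c : mchart M).
Hypothesis gc : good_chart c.
Hypothesis sF : smooth_on (ccod c) (F \o cinv c).

Lemma mul_jac p u : cdom c p -> u *m jac F c p = 'D_u (F \o cinv c) (cmap c p).
Proof.
by move=> dp; rewrite /jac jacobianE//; exact: smooth_differentiable sF (ccod_cmap dp).
Qed.

Lemma row_jac p i : cdom c p -> row i (jac F c p) = 'D_(delta_mx 0 i) (F \o cinv c) (cmap c p).
Proof. by move=> dp; rewrite rowE mul_jac. Qed.

Lemma smooth_jacobian : smooth_on (ccod c) (fun x => 'J (F \o cinv c) x).
Proof.
case: gc => oc _; apply: smooth_rowP => // i.
apply: (smooth_eq oc _ (smooth_derive (delta_mx 0 i) sF)) => y cy.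
by rewrite rowE jacobianE//; exact: smooth_differentiable sF cy.
Qed.

Lemma position_normal p : (forall q, eform eps (F q) (F q) = eps) -> cdom c p ->
  F p *m gram eps N *m (jac F c p)^T = 0.
Proof.
move=> FF dp; apply/matrixP => i j; rewrite ord1 mul_gram_tr row_jac// [RHS]mxE.
have [oc K] := gc.
have dF := smooth_differentiable sF (ccod_cmap dp).
have := derive_eform_const (delta_mx 0 j) oc (ccod_cmap dp) (fun y _ => FF (cinv c y)) dF dF.
rewrite /= K// [X in X + _]eformC -mulr2n => /eqP.
by rewrite mulrn_eq0 => /eqP.
Qed.

Lemma spacelike p u : (forall q, eform eps (F q) (F q) = eps) -> cdom c p ->
  row_free (jac F c p) -> u != 0 -> 0 < eform eps (u *m jac F c p) (u *m jac F c p).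
Proof.
move=> FF dp fJ u0; apply: (complement_pos heps (t := F p)).
- by rewrite FF eps_sq.
- by apply: eform_orth_sub (submxMl u _); exact: position_normal.
- by apply: contraNneq u0 => h; apply/eqP/(row_free_inj fJ); rewrite h mul0mx.
Qed.

Lemma metric_unit p : (forall q, eform eps (F q) (F q) = eps) -> cdom c p ->
  row_free (jac F c p) -> induced_metric eps F c p \in unitmx.
Proof. by move=> FF dp fJ; apply: gram_unitmx => u; exact: spacelike. Qed.

(** Differentiating <D_j F, xi> = 0 along i gives <alpha(i,j), xi> = - <D_j F, D_i xi>. Writing the
    tangent vectors D_i xi as the rows of Z times [jac F c p], the right side is minus Z times the
    metric, so A_xi = - Z. *)
Lemma weingarten (xi : M -> 'rV[R]_N) p :
  smooth_on (ccod c) (xi \o cinv c) ->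
  (forall q, cdom c q -> xi q *m gram eps N *m (jac F c q)^T = 0) ->
  (jac xi c p <= jac F c p)%MS -> cdom c p ->
  induced_metric eps F c p \in unitmx ->
  jac xi c p = - shape_op eps F c p (xi p) *m jac F c p.
Proof.
move=> sxi nxi /submxP[Z JZ] dp um; have [oc K] := gc.
suff -> : shape_op eps F c p (xi p) = - Z by rewrite opprK.
rewrite /shape_op (_ : \matrix_(i, j) _ = - (Z *m induced_metric eps F c p)).
  by rewrite mulNmx mulmxK.
apply/matrixP => i j; rewrite mxE /sff eform_nproj//; last exact: nxi.
rewrite /induced_metric !mulmxA -JZ [RHS]mxE mul_gram_trmx.
have -> : row i (jac xi c p) = 'D_(delta_mx 0 i) (xi \o cinv c) (cmap c p).
  by rewrite rowE /jac jacobianE//; exact: smooth_differentiable sxi (ccod_cmap dp).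
rewrite row_jac//.
have cp := ccod_cmap dp.
have dxi := smooth_differentiable sxi cp.
have dDF := smooth_differentiable (smooth_derive (delta_mx 0 j) sF) cp.
have H y : ccod c y -> eform eps ('D_(delta_mx 0 j) (F \o cinv c) y) ((xi \o cinv c) y) = 0.
  move=> cy; have dy := good_cdom gc cy.
  rewrite eformC -{2}(good_cmapK gc cy) -row_jac// /=.
  by apply: eform_orth_sub (row_sub _ _); exact: nxi.
have := derive_eform_const (delta_mx 0 i) oc cp H dDF dxi.
by rewrite /= K// [X in _ + X]eformC => /eqP; rewrite addr_eq0 => /eqP.
Qed.

End AtPoint.

End ChartGeometry.

Lemma manifold_good_chart (R : realType) (M : premanifold R) (c : mchart M) :
  is_manifold M -> atlas c -> good_chart c.
Proof. by move=> hM ac; split; [exact: open_ccod|move=> p; exact: cinvK]. Qed.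

Lemma prod_good_chart (R : realType) r (M : 'I_r -> premanifold R) (c : forall i, mchart (M i)) :
  (forall i, is_manifold (M i)) -> in_charts c -> good_chart (prod_chart c : mchart (prodM M)).
Proof. by move=> hM ac; split; [exact: open_ccod_prod|move=> p; exact: prod_cinvK]. Qed.

Lemma derive_comp (R : realType) (U V W : normedModType R) (f : U -> V) (g : V -> W) x u :
  differentiable f x -> differentiable g (f x) ->
  'D_u (g \o f) x = 'D_('D_u f x) g (f x).
Proof.
move=> df dg; rewrite (deriveE _ dg) (deriveE _ df) deriveE.
  by rewrite diff_comp.
exact: differentiable_comp.
Qed.

Section InducedMetric.
Variables (R : realType) (eps : R) (N : nat) (M : premanifold R).
Hypothesis heps : eps = 1 \/ eps = -1.
Hypothesis hM : is_manifold M.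
Variable F : M -> 'rV[R]_N.
Hypothesis iF : immersion F.
Hypothesis FF : forall q, eform eps (F q) (F q) = eps.

Lemma jac_transition (c c' : mchart M) p : atlas c -> atlas c' -> cdom c p -> cdom c' p ->
  jac F c p = 'J (cmap c' \o cinv c) (cmap c p) *m jac F c' p.
Proof.
move=> ac ac' dp dp'; have [sF _] := iF.
have cp := ccod_cmap dp; have cp' := ccod_cmap dp'.
set x := cmap c p; set tr := cmap c' \o cinv c.
have dF := smooth_differentiable (sF c ac) cp.
have trx : tr x = cmap c' p by rewrite /tr /= cinvK.
have dF' : differentiable (F \o cinv c') (tr x).
  by rewrite trx; exact: smooth_differentiable (sF c' ac') cp'.
have dtr : differentiable tr x.
  case: hM => _ _ _ [_ _ h]; apply: (smooth_differentiable (h c c' ac ac')).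
  by exists p.
have [oc _ _ ccont _] := manifold_chart hM ac.
have [oc' _ _ _ _] := manifold_chart hM ac'.
apply/row_matrixP => i; rewrite !rowE mulmxA (mul_jac (sF c ac) _ dp).
rewrite /jac -trx (jacobianE _ dtr) (jacobianE _ dF') -(derive_comp _ dtr dF').
apply: near_eq_derive.
have n1 : nbhs x (cinv c @^-1` cdom c').
  by apply: (ccont x cp); apply: open_nbhs_nbhs; split=> //; rewrite /x cinvK.
by apply: filterS n1 => y /= dy; rewrite cinvK.
Qed.

Lemma riemannian_induced : riemannian (induced_metric eps F).
Proof.
have [sF fF] := iF; split.
- by move=> c p _ _; exact: tr_form.
- move=> c p v ac dp v0; rewrite /induced_metric -eform_mul.
  apply: spacelike v0 => //; [exact: manifold_good_chart|exact: sF|exact: fF].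
- move=> c c' p ac ac' dp dp' T; rewrite /induced_metric (jac_transition ac ac' dp dp').
  by rewrite trmx_mul !mulmxA.
- move=> c ac; have oc := open_ccod hM ac; have gc := manifold_good_chart hM ac.
  have sJ := smooth_jacobian gc (sF c ac).
  apply: (smooth_eq oc (F := fun x => 'J (F \o cinv c) x *m gram eps N *m ('J (F \o cinv c) x)^T)).
    by move=> y cy; rewrite /= /induced_metric /jac (good_cmapK gc cy).
  by apply: smooth_mulmx => //; [exact: smooth_mulmxr|exact: smooth_trmx].
Qed.

End InducedMetric.

(** * Slices of a product through a point *)

Section Slices.
Variables (R : realType) (r : nat) (M : 'I_r -> premanifold R).
Hypothesis hM : forall i, is_manifold (M i).
Hypothesis cM : forall i, connected [set: M i].
Local Notation P := (prodM M).

(** Smoothness is tested at one x at a time. There [ci] is completed to a product chart around the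
    point of the slice, which may replace the base point by [dfwith_idem]. *)
Lemma smooth_map_slice m k (f : P -> 'M[R]_(m, k)) (p : P) (i : 'I_r) :
  smooth_map f -> smooth_map (fun q => f (dfwith p i q)).
Proof.
move=> sf ci ai l x cx.
have di : cdom ci (dfwith p i (cinv ci x) i) by rewrite dfwithin; exact: cdom_cinv.
have [c [ac dc ci_]] := exists_charts1 hM ai di; subst ci.
suff H : smooth_on (ccod (c i)) (fun y => f (dfwith p i (cinv (c i) y))) by exact: (H l x cx).
have E : (fun y => f (dfwith p i (cinv (c i) y))) =
    (fun y => f (dfwith (dfwith p i (cinv (c i) x)) i (cinv (c i) y))).
  by apply/funext => y; rewrite dfwith_idem.
rewrite E; apply: (smooth_slice hM ac (smooth_map_in sf ac)) => j _; exact: dc.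
Qed.

Lemma smooth_slice_pd m k (f : P -> 'M[R]_(m, k)) (p : P) (a b : 'I_r) (ca : mchart (M a)) (cb : mchart (M b)) w :
  smooth_map f -> a != b -> atlas ca -> cdom ca (p a) -> atlas cb ->
  smooth_on (ccod cb) (fun y => pd ca w f (dfwith p b (cinv cb y))).
Proof.
move=> sf ab aa da bb l x cx.
have db : cdom cb (dfwith p b (cinv cb x) b) by rewrite dfwithin; exact: cdom_cinv.
have da' : cdom ca (dfwith p b (cinv cb x) a) by rewrite dfwithout// eq_sym.
have [c [ac dc ca_ cb_]] := exists_charts2 hM ab aa da' bb db; subst ca cb.
have sc := smooth_in_pd hM w ac (smooth_map_in sf ac) (i := a).
suff H : smooth_on (ccod (c b)) (fun y => pd (c a) w f (dfwith p b (cinv (c b) y))).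
  exact: (H l x cx).
have E : (fun y => pd (c a) w f (dfwith p b (cinv (c b) y))) =
    (fun y => pd (c a) w f (dfwith (dfwith p b (cinv (c b) x)) b (cinv (c b) y))).
  by apply/funext => y; rewrite dfwith_idem.
rewrite E; apply: (smooth_slice hM ac sc) => j _; exact: dc.
Qed.

Lemma pd_dfwith m k (f : P -> 'M[R]_(m, k)) (p : P) (i : 'I_r) (ci : mchart (M i)) w q :
  pd ci w f (dfwith p i q) = 'D_w (fun y => f (dfwith p i (cinv ci y))) (cmap ci q).
Proof.
rewrite /pd dfwithin; set g1 := fun y => _; set g2 := fun y => _.
by have -> : g1 = g2 by apply/funext => y; rewrite /g1 /g2 dfwith_idem.
Qed.

Lemma immersion_slice N (f : P -> 'rV[R]_N) (p : P) (i : 'I_r) :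
  immersion f -> immersion (fun q => f (dfwith p i q)).
Proof.
move=> [sf ff]; split; first exact: smooth_map_slice.
move=> ci q ai di.
have sci := smooth_map_slice p (i := i) sf ai.
have gi := manifold_good_chart (hM i) ai.
have di' : cdom ci (dfwith p i q i) by rewrite dfwithin.
have [c [ac dc ci_]] := exists_charts1 hM ai di'; subst ci.
apply/inj_row_free => u; rewrite mul_jac// => u0.
have f0 := ff (prod_chart c : mchart P) (dfwith p i q) (atlas_prod ac) dc.
rewrite -(factor_vecK u) (_ : factor_vec u = 0) ?submxrow0//.
apply: (row_free_inj f0); rewrite mul0mx.
apply: etrans (factor_jac hM u ac (smooth_map_in sf ac) dc) _.
exact: etrans (pd_dfwith _ _ _ _ _) u0.
Qed.

Lemma pd_indep m k (f : P -> 'M[R]_(m, k)) a (ca : mchart (M a)) w (p : P) (b : 'I_r) (q : M b) :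
  smooth_map f -> atlas ca -> a != b ->
  (forall (cb : mchart (M b)) w' (t : P), atlas cb -> cdom ca (t a) -> cdom cb (t b) ->
     pd cb w' (pd ca w f) t = 0) ->
  cdom ca (p a) -> pd ca w f (dfwith p b q) = pd ca w f p.
Proof.
move=> sf aa ab H da; refine (@constant_slice R r M hM m k p b (pd ca w f) (@cM b) _ _ q).
  by move=> cb bb; exact: smooth_slice_pd.
move=> cb q' w' bb db; apply: H => //; first by rewrite dfwithout// eq_sym.
by rewrite dfwithin.
Qed.

Lemma pd_indep_all m k (f : P -> 'M[R]_(m, k)) a (ca : mchart (M a)) w (p o : P) :
  smooth_map f -> atlas ca ->
  (forall b (cb : mchart (M b)) w' (t : P), a != b -> atlas cb -> cdom ca (t a) -> cdom cb (t b) ->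
     pd cb w' (pd ca w f) t = 0) ->
  cdom ca (p a) -> pd ca w f p = pd ca w f (dfwith o a (p a)).
Proof.
move=> sf aa H da.
(* Coordinate a is frozen at [p a], so that the point stays in the domain of [ca] while the
   remaining coordinates travel from p to o. *)
have := @constant_prod R r M m k (fun t => pd ca w f (dfwith t a (p a))) _ p o.
rewrite dfwith_id; apply=> t b q; case: (eqVneq a b) => [ab|ab]; first by subst b; rewrite dfwith_idem.
have ba : b != a by rewrite eq_sym.
have E := @dfwithC _ (fun i => M i : Type) t b a q (p a) ba.
apply: etrans (congr1 (pd ca w f) E) _.
by apply: pd_indep => //; [move=> *; exact: H|rewrite dfwithin].
Qed.

Lemma pd_eform_const eps N (f g : P -> 'rV[R]_N) (c : forall i, mchart (M i)) p i w k :
  in_charts c -> smooth_in c f -> smooth_in c g -> in_domains c p ->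
  (forall q, cdom (c i) q -> eform eps (f (dfwith p i q)) (g (dfwith p i q)) = k) ->
  eform eps (pd (c i) w f p) (g p) + eform eps (f p) (pd (c i) w g p) = 0.
Proof.
move=> ac sf sg dp H; have cp := ccod_cmap (dp i); have oi := open_ccod (hM i) (ac i).
have df : differentiable (fun y => f (dfwith p i (cinv (c i) y))) (cmap (c i) (p i)).
  exact: differentiable_slice.
have dg : differentiable (fun y => g (dfwith p i (cinv (c i) y))) (cmap (c i) (p i)).
  exact: differentiable_slice.
have H' y : ccod (c i) y -> eform eps (f (dfwith p i (cinv (c i) y))) (g (dfwith p i (cinv (c i) y))) = k.
  by move=> cy; apply: H; exact: (cdom_cinv (hM i) (ac i) cy).
have := derive_eform_const w oi cp H' df dg.
by rewrite cinvK// ?dfwith_id//; exact: dp.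
Qed.

Lemma pd_sub N n q (f : P -> 'M[R]_(q, N)) (A : 'M[R]_(n, N)) (c : forall i, mchart (M i)) p i w :
  in_charts c -> smooth_in c f -> in_domains c p ->
  (forall q, cdom (c i) q -> (f (dfwith p i q) <= A)%MS) ->
  (pd (c i) w f p <= A)%MS.
Proof.
move=> ac sf dp H; have cp := ccod_cmap (dp i); have oi := open_ccod (hM i) (ac i).
apply: (derive_sub w oi cp) => [y cy|]; last exact: differentiable_slice.
by apply: H; exact: (cdom_cinv (hM i) (ac i) cy).
Qed.

End Slices.

(** * Parallel frames along an extrinsic product *)

Lemma derive_pointwiseD (R : realType) (V W : normedModType R) (F G H : V -> W) x u :
  differentiable G x -> differentiable H x -> (forall y, F y = G y + H y) ->
  'D_u F x = 'D_u G x + 'D_u H x.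
Proof.
move=> dG dH FE; have -> : F = G + H by apply/funext => y; exact: FE.
by apply: deriveD; exact: diff_derivable.
Qed.

(** Tangent spaces are positive definite; to show that a component of a tangent vector vanishes it
    is therefore enough that its square does. *)
Lemma pd_spacelike (R : realType) (eps : R) (r N : nat) (M : 'I_r -> premanifold R)
    (f : prodM M -> 'rV[R]_N) (c : forall i, mchart (M i)) p i (z : 'rV[R]_(mdim (M i))) :
  eps = 1 \/ eps = -1 -> (forall i, is_manifold (M i)) -> immersion f ->
  (forall p, eform eps (f p) (f p) = eps) -> in_charts c -> in_domains c p ->
  eform eps (pd (c i) z f p) (pd (c i) z f p) = 0 -> z = 0.
Proof.
move=> heps hM [sf ff] fQ ac dp; have sfc := smooth_map_in sf ac.
rewrite -(factor_jac hM z ac sfc dp) => z0.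
rewrite -(factor_vecK z); suff -> : factor_vec z = 0 by rewrite submxrow0.
apply/eqP; apply: contraT => nz.
have := spacelike heps (prod_good_chart hM ac) sfc fQ dp (ff _ _ (atlas_prod ac) dp) nz.
by rewrite [X in 0 < X]z0 ltxx.
Qed.

Lemma pd_zero_vec (R : realType) (r m k : nat) (M : 'I_r -> premanifold R)
    (c : forall i, mchart (M i)) i (f : prodM M -> 'M[R]_(m, k)) p :
  (forall i, is_manifold (M i)) -> in_charts c -> smooth_in c f -> in_domains c p ->
  pd (c i) 0 f p = 0.
Proof.
move=> hM ac sf dp; rewrite (pd_cmap hM _ _ ac dp) (_ : factor_vec _ = 0) ?derive0//.
apply/mxrowP => j; rewrite submxrow0; have [<-|ij] := eqVneq i j; first by rewrite factor_vecK.
exact: factor_vec_out.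
Qed.

Section ParallelFrame.
Variables (R : realType) (eps : R) (r N s : nat) (M : 'I_r -> premanifold R).
Hypothesis heps : eps = 1 \/ eps = -1.
Hypothesis hM : forall i, is_manifold (M i).
Hypothesis cM : forall i, connected [set: M i].
Local Notation P := (prodM M).
Variables (ft : P -> 'rV[R]_N) (Phi : P -> 'M[R]_(s, N)).
Hypothesis pl : product_like eps ft.
Hypothesis ftQ : forall p, eform eps (ft p) (ft p) = eps.
Hypothesis sPhi : smooth_map Phi.
Hypothesis nPhi : forall (c : mchart P) p, atlas c -> cdom c p ->
  Phi p *m gram eps N *m (jac ft c p)^T = 0.
Hypothesis parPhi : forall (y : 'rV[R]_s) (c : mchart P) p u, atlas c -> cdom c p ->
  nconn eps ft c (fun x => y *m Phi (cinv c x)) u (cmap c p) = 0.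
Implicit Types (c : forall i, mchart (M i)) (p : P) (y : 'rV[R]_s).

Definition section_of y p : 'rV[R]_N := y *m Phi p.

Lemma smooth_section y : smooth_map (section_of y).
Proof.
apply: smooth_map_prod => c ac.
by apply: smooth_mulmxl; [exact: open_ccod_prod|exact: smooth_map_in].
Qed.

Lemma smooth_ft : smooth_map ft. Proof. by case: pl => -[]. Qed.

Lemma ft_row_free c p : in_charts c -> in_domains c p -> row_free (jac ft (prod_chart c) p).
Proof. by move=> ac dp; case: pl => -[_ h] _ _; apply: h => //; exact: atlas_prod. Qed.

Lemma ft_spacelike c p i (z : 'rV[R]_(mdim (M i))) : in_charts c -> in_domains c p ->
  eform eps (pd (c i) z ft p) (pd (c i) z ft p) = 0 -> z = 0.
Proof. by move=> ac dp; apply: pd_spacelike => //; case: pl. Qed.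

Lemma section_normal y (c : mchart P) p : atlas c -> cdom c p ->
  section_of y p *m gram eps N *m (jac ft c p)^T = 0.
Proof. by move=> ac dp; rewrite /section_of -!mulmxA (mulmxA (Phi p)) nPhi ?mulmx0. Qed.

Lemma section_derive_sub y c p u : in_charts c -> in_domains c p ->
  ('D_u (section_of y \o cinv (prod_chart c)) (cmap (prod_chart c) p) <= jac ft (prod_chart c) p)%MS.
Proof.
by move=> ac dp; have := parPhi y u (atlas_prod ac) dp; exact: nproj_eq0.
Qed.

Lemma section_pd y c p a w : in_charts c -> in_domains c p ->
  exists z, pd (c a) w (section_of y) p = pd (c a) z ft p.
Proof.
move=> ac dp; have sft := smooth_map_in smooth_ft ac; have sxi := smooth_map_in (smooth_section y) ac.
have := section_derive_sub y (factor_vec w) ac dp.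
rewrite -(pd_cmap hM w (section_of y) ac dp) => /submxP[Z WZ].
rewrite (jac_prod hM Z ac sft dp) in WZ.
suff Z0 b : b != a -> submxrow Z b = 0.
  exists (submxrow Z a); rewrite WZ (bigD1 a)//= big1 ?addr0// => b ba.
  by rewrite Z0// pd_zero_vec.
move=> ba; apply: (ft_spacelike ac dp).
(* Differentiate <xi, D_b ft> = 0 along M_a: the term with the mixed derivative of ft drops out, so
   D_a xi is orthogonal to E_b. Its E_b component is orthogonal to the other components, hence has
   square 0. *)
have H : eform eps (pd (c a) w (section_of y) p) (pd (c b) (submxrow Z b) ft p) = 0.
  have Sb := smooth_in_pd hM (submxrow Z b) ac sft (i := b).
  have Eq q : cdom (c a) q ->
      eform eps (section_of y (dfwith p a q)) (pd (c b) (submxrow Z b) ft (dfwith p a q)) = 0.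
    move=> dq; have dpq := in_domains_dfwith dp dq.
    rewrite -(factor_jac hM _ ac sft dpq); apply: eform_orth_sub (submxMl _ _).
    by apply: section_normal => //; exact: atlas_prod.
  have := pd_eform_const hM w ac sxi Sb dp Eq.
  case: pl => _ pl2 _; rewrite (pl2 a b) ?eform0r ?addr0//; last by rewrite eq_sym.
apply: etrans _ H; rewrite WZ eform_suml (bigD1 b)//= big1 ?addr0// => b' bb'.
by case: pl => _ _ pl3; apply: pl3 => //.
Qed.

Lemma ft_pd_indep a (ca : mchart (M a)) w p (b : 'I_r) (q : M b) : atlas ca -> a != b -> cdom ca (p a) ->
  pd ca w ft (dfwith p b q) = pd ca w ft p.
Proof.
move=> aa ab da; apply: (pd_indep hM cM q smooth_ft aa ab _ da) => cb w' t bb da' db.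
by case: pl => _ pl2 _; apply: pl2 => //; rewrite eq_sym.
Qed.

(** By [ft_pd_indep] the image of E_a under the differential of ft is the same fixed subspace all
    along M_b. As D_a xi stays in it, so does its derivative along M_b. *)
Lemma section_pd_sub y c p (a b : 'I_r) w w' : a != b -> in_charts c -> in_domains c p ->
  exists z, pd (c b) w' (pd (c a) w (section_of y)) p = pd (c a) z ft p.
Proof.
move=> ab ac dp; have sxi := smooth_map_in (smooth_section y) ac.
pose A := jac (fun q => ft (dfwith p a q)) (c a) (p a).
have sA := smooth_map_slice hM p (i := a) smooth_ft (ac a).
have AE z : pd (c a) z ft p = z *m A.
  by rewrite (mul_jac sA)//; exact: dp.
have : (pd (c b) w' (pd (c a) w (section_of y)) p <= A)%MS.
  apply: (pd_sub hM w' ac (smooth_in_pd hM w ac sxi) dp) => q dq.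
  have [z ->] := section_pd y w ac (in_domains_dfwith dp dq).
  by rewrite ft_pd_indep//; rewrite ?AE ?submxMl//; exact: dp.
by move/submxP => [z zA]; exists z; rewrite AE.
Qed.

(** By [section_pd_sub] and the symmetry of second derivatives the vector is tangent both to E_a and
    to E_b, which are orthogonal. *)
Lemma section_pd2 y c p (a b : 'I_r) w w' : a != b -> in_charts c -> in_domains c p ->
  pd (c b) w' (pd (c a) w (section_of y)) p = 0.
Proof.
move=> ab ac dp; have sxi := smooth_map_in (smooth_section y) ac.
have sft := smooth_map_in smooth_ft ac.
have [z zE] := section_pd_sub y w w' ab ac dp.
have ba : b != a by rewrite eq_sym.
have [z' z'E] := section_pd_sub y w' w ba ac dp.
have E : pd (c a) z ft p = pd (c b) z' ft p.
  by apply: etrans (esym zE) _; apply: etrans (pdC hM _ _ ac sxi dp) z'E.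
have z0 : z = 0.
  apply: (ft_spacelike ac dp); rewrite {2}E.
  by case: pl => _ _ pl3; apply: pl3 => //.
by rewrite zE z0 pd_zero_vec.
Qed.

Lemma section_pd_indep y a (ca : mchart (M a)) w p o : atlas ca -> cdom ca (p a) ->
  pd ca w (section_of y) p = pd ca w (section_of y) (dfwith o a (p a)).
Proof.
move=> aa da; apply: (pd_indep_all hM cM o (smooth_section y) aa _ da).
move=> b cb w' t ab bb da' db.
have [c [ac dc ca_ cb_]] := exists_charts2 hM ab aa da' bb db; subst ca cb.
exact: section_pd2.
Qed.

Lemma section_weingarten y c p : in_charts c -> in_domains c p ->
  jac (section_of y) (prod_chart c) p =
  - shape_op eps ft (prod_chart c) p (y *m Phi p) *m jac ft (prod_chart c) p.
Proof.
move=> ac dp; have gc := prod_good_chart hM ac; have sft := smooth_map_in smooth_ft ac.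
have sxi := smooth_map_in (smooth_section y) ac; have aP := atlas_prod ac.
refine (weingarten gc sft sxi _ _ dp _).
- by move=> q dq; exact: section_normal.
- apply/row_subP => i; rewrite rowE.
  have E := @mul_jac R N P (section_of y) (prod_chart c) sxi p (delta_mx 0 i) dp.
  by rewrite E; exact: section_derive_sub.
- by apply: metric_unit => //; exact: ft_row_free.
Qed.

(** Since phi(e1) = ft, the section phi(y + e1) is ft plus a parallel normal field. This is the
    origin of the shift in e1 + Omega: invertibility of I - A makes such a section an immersion. *)
Lemma section_jac (e1 : 'rV[R]_s) y c p : (forall p, e1 *m Phi p = ft p) ->
  in_charts c -> in_domains c p ->
  jac (section_of (y + e1)) (prod_chart c) p =
  (1%:M - shape_op eps ft (prod_chart c) p (y *m Phi p)) *m jac ft (prod_chart c) p.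
Proof.
move=> e1E ac dt; rewrite mulmxBl mul1mx -mulNmx [RHS]addrC.
rewrite -(section_weingarten y ac dt).
have sy := smooth_map_in (smooth_section y) ac.
have sft := smooth_map_in smooth_ft ac.
have s12 := smooth_map_in (smooth_section (y + e1)) ac.
have cp := ccod_prod_cmap dt.
have dy := smooth_differentiable sy cp.
have dft := smooth_differentiable sft cp.
have e x : (section_of (y + e1) \o cinv (prod_chart c)) x =
    (section_of y \o cinv (prod_chart c)) x + (ft \o cinv (prod_chart c)) x.
  by rewrite /= /section_of mulmxDl e1E.
have mj (F : P -> 'rV[R]_N) u : smooth_in c F ->
    u *m jac F (prod_chart c) p = 'D_u (F \o cinv (prod_chart c)) (cmap (prod_chart c) p).
  by move=> sF; exact: (mul_jac (c := prod_chart c : mchart P) sF u dt).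
apply/row_matrixP => i; rewrite !rowE mulmxDr.
apply: etrans (mj _ _ s12) _; apply: etrans (derive_pointwiseD _ dy dft e) _.
by congr (_ + _); symmetry; exact: mj.
Qed.

End ParallelFrame.

(** * Tubes: the direct part *)

Section Tail.
Variables (R : realType) (r : nat) (M : 'I_r.+1 -> premanifold R).
Local Notation Mt := (fun a : 'I_r => M (lift ord0 a)).
Implicit Types (p : prodM M) (c : forall i, mchart (M i)).

Lemma factor_connected (n : nat) (K : 'I_n -> premanifold R) :
  (forall i, is_manifold (K i)) -> connected [set: prodM K] ->
  forall i, connected [set: K i].
Proof.
move=> hK cK i.
have pt : prodM K by move=> j; have [_ _ /cid[x _] _] := hK j; exact: x.
have -> : [set: K i] = (fun p : prodM K => p i) @` [set: prodM K].
  apply/seteqP; split=> [q _|//]; exists (dfwith pt i q) => //.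
  by rewrite dfwithin.
apply: connected_continuous_connected cK _; apply: continuous_subspaceT.
exact: proj_continuous.
Qed.

Definition tail_charts c : forall a : 'I_r, mchart (Mt a) := fun a => c (lift ord0 a).

Lemma tail_pt_dfwith p a (q : M (lift ord0 a)) :
  tail_pt (dfwith p (lift ord0 a) q) = dfwith (tail_pt p) a q.
Proof.
apply: functional_extensionality_dep => b; rewrite /tail_pt.
case: (eqVneq a b) => [ab|ab]; first by subst b; rewrite !dfwithin.
by rewrite !dfwithout//; apply: contraNneq ab => /lift_inj ->.
Qed.

Lemma tail_pt_dfwith0 p (q : M ord0) : tail_pt (dfwith p ord0 q) = tail_pt p.
Proof.
by apply: functional_extensionality_dep => b; rewrite /tail_pt dfwithout.
Qed.

Lemma dfwith_lift0 p a (q : M (lift ord0 a)) : dfwith p (lift ord0 a) q ord0 = p ord0.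
Proof. by rewrite dfwithout. Qed.

Definition tail_row (u : 'rV[R]_(mdim (prodM M))) : 'rV[R]_(mdim (tailM M)) :=
  \mxrow_(a < r) submxrow u (lift ord0 a).

Lemma tail_rowK u a : submxrow (tail_row u) a = submxrow u (lift ord0 a).
Proof. exact: mxrowK. Qed.

Lemma tail_row_affine : affine_with tail_row tail_row.
Proof.
by move=> h v x; apply/mxrowP => a; rewrite mxrowK !submxrowD !submxrowZ !tail_rowK.
Qed.

Lemma row_eq0 (u : 'rV[R]_(mdim (prodM M))) :
  submxrow u ord0 = 0 -> tail_row u = 0 -> u = 0.
Proof.
move=> u0 ut; apply/mxrowP => i; rewrite submxrow0.
by case: (unliftP ord0 i) => [a ->|-> //]; rewrite -tail_rowK ut submxrow0.
Qed.

Lemma tail_cinv c x : tail_pt (cinv (prod_chart c) x) = cinv (prod_chart (tail_charts c)) (tail_row x).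
Proof.
apply: functional_extensionality_dep => a.
by rewrite /tail_pt /= tail_rowK.
Qed.

Variables (s N : nat) (f0 : M ord0 -> 'rV[R]_s) (Phi : tailM M -> 'M[R]_(s, N)).
Hypothesis hM : forall i, is_manifold (M i).
Local Notation f := (tube_map Phi f0).

Lemma in_tail_charts c : in_charts c -> in_charts (tail_charts c).
Proof. by move=> ac a; exact: ac. Qed.

Lemma in_tail_domains c p : in_domains c p -> in_domains (tail_charts c) (tail_pt p).
Proof. by move=> dp a; exact: dp. Qed.

Lemma tube_map_smooth c : in_charts c -> smooth_map f0 -> smooth_map Phi -> smooth_in c f.
Proof.
move=> ac sf0 sPhi; have oc := open_ccod_prod hM ac.
have s0 := smooth_affine (U := ccod (prod_chart c)) (@submxrow_affine R _ M ord0) _ (sf0 _ (ac ord0)).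
have hMt a : is_manifold (Mt a) by exact: hM.
have s1 := smooth_affine (U := ccod (prod_chart c)) tail_row_affine _
  (smooth_map_in (M := Mt) sPhi (in_tail_charts ac)).
have {}s0 := s0 (fun x cx => (ccod_prod hM x ac).1 cx ord0).
have {}s1 := s1 (fun x cx => (ccod_prod hMt _ (in_tail_charts ac)).2
  (fun a => eq_ind_r (ccod (c (lift ord0 a))) ((ccod_prod hM x ac).1 cx (lift ord0 a)) (tail_rowK x a))).
apply: (smooth_eq oc _ (smooth_mulmx oc s0 s1)) => x cx /=.
by rewrite /tube_map tail_cinv.
Qed.

Lemma tube_map_pd0 (c : mchart (M ord0)) w p : smooth_map f0 -> atlas c -> cdom c (p ord0) ->
  pd c w f p = 'D_w (f0 \o cinv c) (cmap c (p ord0)) *m Phi (tail_pt p).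
Proof.
move=> sf0 ac dp; have df0 := smooth_differentiable (sf0 c ac) (ccod_cmap dp).
apply: etrans _ (derive_mulmxr (Phi (tail_pt p)) w df0); rewrite /pd.
have e : (fun y => f (dfwith p ord0 (cinv c y))) = (fun y => (f0 \o cinv c) y *m Phi (tail_pt p)).
  by apply/funext => y; rewrite /tube_map tail_pt_dfwith0 dfwithin.
by rewrite e.
Qed.

Lemma tube_map_pd a (c : mchart (M (lift ord0 a))) w p :
  pd c w f p = pd (M := Mt) (i := a) c w (section_of Phi (f0 (p ord0))) (tail_pt p).
Proof.
rewrite /pd.
have e : (fun y => f (dfwith p (lift ord0 a) (cinv c y))) =
    (fun y => section_of Phi (f0 (p ord0)) (dfwith (tail_pt p) a (cinv c y))).
  by apply/funext => y; rewrite /tube_map tail_pt_dfwith dfwith_lift0.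
by rewrite e.
Qed.

End Tail.

Lemma section_pdE (R : realType) (n s N : nat) (K : 'I_n -> premanifold R)
    (Phi : prodM K -> 'M[R]_(s, N)) (c : forall i, mchart (K i)) p i w (y : 'rV[R]_s) :
  (forall i, is_manifold (K i)) -> smooth_map Phi -> in_charts c -> in_domains c p ->
  pd (c i) w (section_of Phi y) p = y *m pd (c i) w Phi p.
Proof.
move=> hK sPhi ac dp; apply: derive_mulmxl.
by apply: differentiable_slice => //; exact: smooth_map_in.
Qed.

Section Direct.
Variables (R : realType) (eps : R) (r N s : nat) (M : 'I_r.+1 -> premanifold R).
Hypothesis heps : eps = 1 \/ eps = -1.
Hypothesis hM : forall i, is_manifold (M i).
Hypothesis cM : forall i, connected [set: M i].
Local Notation Mt := (fun a : 'I_r => M (lift ord0 a)).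
Variables (ft : tailM M -> 'rV[R]_N) (E : tailM M -> 'M[R]_N)
  (Phi : tailM M -> 'M[R]_(s, N)) (e1 : 'rV[R]_s) (f0 : M ord0 -> 'rV[R]_s).
Hypothesis td : tube_data eps ft E Phi e1 f0.
Local Notation f := (tube_map Phi f0).
Implicit Types (p : prodM M) (c : forall i, mchart (M i)).

Let hMt (a : 'I_r) : is_manifold (Mt a). Proof. exact: hM. Qed.
Let cMt (a : 'I_r) : connected [set: Mt a]. Proof. exact: cM. Qed.

Let pl : product_like (M := Mt) eps ft.
Proof. exact: (extrinsic_product_like hMt (tube_ft td)). Qed.

Lemma Qspace_eform n (x : 'rV[R]_n) : Qspace eps x -> eform eps x x = eps.
Proof. by case=> + _; rewrite expr1n mulr1. Qed.

Let ftQ t : eform eps (ft t) (ft t) = eps.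
Proof. by apply: Qspace_eform; have [h _] := tube_ft td; exact: h. Qed.

Let sPhi : smooth_map Phi. Proof. by have [] := tube_phi td. Qed.

Let nPhi (c : mchart (tailM M)) t : atlas c -> cdom c t ->
  Phi t *m gram eps N *m (jac ft c t)^T = 0.
Proof.
move=> ac dt; have [h _] := tube_normal td; have [_ PE _ _] := tube_phi td.
have /submxP[Z ->] : (Phi t <= E t)%MS by have /andP[] := PE t.
by rewrite -!mulmxA (mulmxA (E t)) h ?mulmx0.
Qed.

Let parPhi (y : 'rV[R]_s) (c : mchart (tailM M)) t u : atlas c -> cdom c t ->
  nconn eps ft c (fun x => y *m Phi (cinv c x)) u (cmap c t) = 0.
Proof. by have [_ _ _ h] := tube_phi td; exact: h. Qed.

Let iPhi t : Phi t *m gram eps N *m (Phi t)^T = gram eps s.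
Proof.
have [_ _ h _] := tube_phi td; apply/matrixP => i j.
rewrite mul_gram_trmx !rowE h.
have <- : row i 1%:M = delta_mx 0 i :> 'rV[R]_s by rewrite rowE mulmx1.
have <- : row j 1%:M = delta_mx 0 j :> 'rV[R]_s by rewrite rowE mulmx1.
by rewrite -mul_gram_trmx mul1mx trmx1 mulmx1.
Qed.

Lemma tube_map_immersion : immersion f.
Proof.
have [sf0 ff0] := tube_f0 td.
split; first by apply: smooth_map_prod => // c ac; exact: tube_map_smooth.
move=> c' p [c ac ->] dp; apply/inj_row_free => u.
have sf : smooth_in c f by exact: tube_map_smooth.
rewrite (jac_prod hM u ac sf dp) big_ord_recl (tube_map_pd0 _ _ sf0 (ac ord0) (dp ord0)).
have act := in_tail_charts ac; have dpt := in_tail_domains dp.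
have sxi := smooth_map_in (M := Mt) (smooth_section hMt sPhi (f0 (p ord0))) act.
rewrite (_ : \sum_(i < r) _ = tail_row u *m jac (section_of Phi (f0 (p ord0))) (prod_chart (tail_charts c)) (tail_pt p)); last first.
  rewrite (jac_prod hMt (tail_row u) act sxi dpt); apply: eq_bigr => a _.
  by rewrite tail_rowK; exact: tube_map_pd.
rewrite -[f0 (p ord0)](subrK e1) (section_jac (M := Mt) heps hMt pl ftQ sPhi nPhi parPhi _ (tube_phi_e1 td))//.
set D := 'D__ _ _; set B := 1%:M - _; set J := jac _ _ _ => u0.
have uB : B \in unitmx by apply: (tube_f0_Omega td) => //; exact: atlas_prod.
have nJ : J *m gram eps N *m (Phi (tail_pt p))^T = 0.
  by rewrite -tr_form nPhi ?trmx0//; exact: atlas_prod.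
have fJ : row_free J by exact: (ft_row_free pl act dpt).
(* Pairing with [Phi] annihilates the part tangent to ft, because phi has normal values, and returns
   D times the Gram matrix of E^s, because phi is isometric. *)
have D0 : D = 0.
  clearbody B J.
  have := congr1 (fun A => A *m gram eps N *m (Phi (tail_pt p))^T) u0.
  rewrite !mulmxDl !mul0mx -!mulmxA (mulmxA (Phi _)) iPhi (mulmxA J) nJ !mulmx0 addr0.
  move=> /(congr1 (fun A => A *m gram eps s)).
  by rewrite mul0mx -mulmxA gram_sq// mulmx1.
apply: row_eq0.
  apply: (row_free_inj (ff0 _ _ (ac ord0) (dp ord0))).
  by rewrite mul0mx (mul_jac (sf0 _ (ac ord0)) _ (dp ord0)).
move: u0; rewrite D0 mul0mx add0r mulmxA => u0.
have uB0 : tail_row u *m B = 0 by apply: (row_free_inj fJ); rewrite mul0mx.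
by rewrite -(mulmxK uB (tail_row u)) uB0 mul0mx.
Qed.

Lemma tube_map_Qspace p : Qspace eps (f p).
Proof.
have ff : eform eps (f p) (f p) = eps.
  by rewrite /tube_map eform_mul iPhi -/(eform _ _ _) Qspace_eform//; exact: (tube_f0_Q td _).
split; first by rewrite expr1n mulr1.
move=> em1; have [ftq _] := tube_ft td; have [_ fut] := ftq (tail_pt p).
(* As ft is future timelike, it suffices that <ft, f> is negative; this equals <e1, f0> by isometry,
   and both vectors lie on the upper sheet. *)
apply: (timelike_future (x := ft (tail_pt p))).
- by rewrite -em1 ftQ em1 oppr_lt0.
- by rewrite -em1 ff em1 oppr_lt0.
- exact: fut.
have [ee ef] := tube_e1 td; have [fe ffut] := tube_f0_Q td (p ord0).
rewrite -em1 -(tube_phi_e1 td) /tube_map eform_mul iPhi -/(eform _ _ _) em1.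
apply: future_timelike.
- by rewrite -em1 ee em1 mulN1r oppr_lt0 expr1n.
- by rewrite -em1 fe em1 mulN1r oppr_lt0 expr1n.
- exact: ef.
- exact: ffut.
Qed.

Let pt : prodM M := fun i => sval (cid (let: And4 _ _ ne _ := hM i in ne)).

(** The metric of the slice through the base point [pt] with p_0 = q. By [section_pd_indep] the
    other coordinates of [pt] do not influence it. *)
Let ga (a : 'I_r) (q : M ord0) : tensor2 (M (lift ord0 a)) :=
  induced_metric eps (fun x => f (dfwith (dfwith pt ord0 q) (lift ord0 a) x)).

Let ga_jac (a : 'I_r) (q : M ord0) (c : mchart (M (lift ord0 a))) x u : atlas c -> cdom c x ->
  u *m jac (fun x => f (dfwith (dfwith pt ord0 q) (lift ord0 a) x)) c x =
  pd (M := Mt) (i := a) c u (section_of Phi (f0 q)) (dfwith (tail_pt pt) a x).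
Proof.
move=> ac dx; have [sf _] := tube_map_immersion.
have ss := smooth_map_slice hM (dfwith pt ord0 q) (i := lift ord0 a) sf ac.
apply: etrans (mul_jac ss u dx) _; rewrite -[LHS](pd_dfwith _ _ c).
by rewrite tube_map_pd tail_pt_dfwith tail_pt_dfwith0 dfwith_lift0 dfwithin.
Qed.

Let ga_smooth a : @smooth_family R (M ord0) (M (lift ord0 a)) (@ga a).
Proof.
have [sf0 _] := tube_f0 td; split=> [q|c0 c1 ac0 ac1].
  apply: riemannian_induced => //; first exact: immersion_slice tube_map_immersion.
  by move=> x; apply: Qspace_eform; exact: tube_map_Qspace.
set U := [set z | _].
have oc0 := open_ccod (hM ord0) ac0; have oc1 := open_ccod (hM (lift ord0 a)) ac1.
have oU : open U.
  rewrite openE => z [z0 z1]; apply: filterI.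
    apply: (differentiable_continuous (differentiable_lsubmx z)).
    exact: open_nbhs_nbhs.
  apply: (differentiable_continuous (differentiable_rsubmx z)).
  exact: open_nbhs_nbhs.
pose PhiS x := Phi (dfwith (tail_pt pt) a x).
have sPhiS : smooth_map PhiS by exact: (smooth_map_slice (M := Mt) hMt).
(* The rows frame the tangent space of the slice. They are products of a function of the first
   variable, f0, and one of the second, a derivative of phi, which yields joint smoothness in p_0
   and p_a. *)
pose B (z : 'rV[R]_(mdim (M ord0) + mdim (M (lift ord0 a)))) : 'M[R]_(_, N) :=
  \matrix_k ((f0 \o cinv c0) (lsubmx z) *m 'D_(delta_mx 0 k) (PhiS \o cinv c1) (rsubmx z)).
have sB : smooth_on U B.
  apply: smooth_rowP => // k; under eq_fun do rewrite rowK.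
  apply: smooth_mulmx => //.
    apply: (smooth_affine (A := lsubmx) (L := lsubmx) _ _ (sf0 c0 ac0)); last by move=> z [].
    by move=> h v z; rewrite linearP.
  apply: (smooth_affine (A := rsubmx) (L := rsubmx) _ _ (smooth_derive (delta_mx 0 k) (sPhiS c1 ac1))).
    by move=> h v z; rewrite linearP.
  by move=> z [].
apply: (smooth_eq oU (F := fun z => B z *m gram eps N *m (B z)^T)).
  move=> z [z0 z1]; have dz := cdom_cinv (hM _) ac1 z1.
  suff -> : B z = jac (fun x => f (dfwith (dfwith pt ord0 (cinv c0 (lsubmx z))) (lift ord0 a) x)) c1 (cinv c1 (rsubmx z)) by [].
  apply/row_matrixP => k; rewrite rowK [RHS]rowE ga_jac//.
  rewrite [RHS](pd_dfwith (M := Mt) _ _ c1) (cmapK (hM _) ac1 z1).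
  by rewrite -derive_mulmxl//; exact: smooth_differentiable (sPhiS c1 ac1) z1.
by apply: smooth_mulmx => //; [exact: smooth_mulmxr|exact: smooth_trmx].
Qed.

Lemma tube_map_polar : polar (induced_metric eps f).
Proof.
have [sf0 ff0] := tube_f0 td; have [sf _] := tube_map_immersion.
exists (induced_metric eps f0), @ga; split.
- apply: (riemannian_induced heps (hM ord0) (tube_f0 td)).
  by move=> q; apply: Qspace_eform; exact: (tube_f0_Q td q).
- exact: ga_smooth.
move=> c p u v ac dp; have act := in_tail_charts ac; have dpt := in_tail_domains dp.
have sfc := smooth_map_in sf ac.
pose t := tail_pt p; pose xi := section_of Phi (f0 (p ord0)).
pose X (w : 'rV[R]_(mdim (prodM M))) := submxrow w ord0 *m jac f0 (c ord0) (p ord0).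
pose Y (w : 'rV[R]_(mdim (prodM M))) (a : 'I_r) :=
  pd (M := Mt) (i := a) (c (lift ord0 a)) (submxrow w (lift ord0 a)) xi t.
have jE w : w *m jac f (prod_chart c) p = X w *m Phi t + \sum_a Y w a.
  rewrite (jac_prod hM w ac sfc dp) big_ord_recl (tube_map_pd0 _ _ sf0 (ac ord0) (dp ord0)).
  rewrite /X (mul_jac (sf0 _ (ac ord0)) _ (dp ord0)); congr (_ + _).
  by apply: eq_bigr => a _; exact: tube_map_pd.
have Yft w a : exists z, Y w a = pd (M := Mt) (i := a) (c (lift ord0 a)) z ft t.
  exact: (section_pd (M := Mt) heps hMt pl ftQ sPhi nPhi parPhi (f0 (p ord0)) (submxrow w (lift ord0 a)) act dpt).
(* The M_0 part of the differential takes values in the image of phi, normal to ft, whereas the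
   other parts are tangent to ft. *)
have XY w w' a : eform eps (X w *m Phi t) (Y w' a) = 0.
  have [z ->] := Yft w' a.
  rewrite -(factor_jac (M := Mt) hMt z act (smooth_map_in (smooth_ft pl) act) dpt) eform_mul.
  by rewrite nPhi ?mulmx0 ?mul0mx ?mxE//; exact: atlas_prod.
have YY w w' a b : a != b -> eform eps (Y w a) (Y w' b) = 0.
  move=> ab; have [z ->] := Yft w a; have [z' ->] := Yft w' b.
  by case: pl => _ _ pl3; apply: pl3 => //.
have Yg w w' a : eform eps (Y w a) (Y w' a) =
    (submxrow w (lift ord0 a) *m @ga a (p ord0) (c (lift ord0 a)) (p (lift ord0 a)) *m (submxrow w' (lift ord0 a))^T) 0 0.
  pose Jg := jac (fun x => f (dfwith (dfwith pt ord0 (p ord0)) (lift ord0 a) x)) (c (lift ord0 a)) (p (lift ord0 a)).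
  have YJ z : Y z a = submxrow z (lift ord0 a) *m Jg.
    apply: etrans _ (esym (ga_jac _ _ (ac (lift ord0 a)) (dp (lift ord0 a)))).
    exact: (section_pd_indep (M := Mt) heps hMt cMt pl ftQ sPhi nPhi parPhi _ _ (tail_pt pt) (act a) (dpt a)).
  rewrite !YJ; exact: eform_mul.
apply/matrixP => i j; rewrite !ord1 -[LHS]eform_mul.
rewrite [RHS]mxE summxE [X in X + _]/=.
have -> : (submxrow u ord0 *m induced_metric eps f0 (c ord0) (p ord0) *m (submxrow v ord0)^T) 0 0 =
    eform eps (X u *m Phi t) (X v *m Phi t).
  by rewrite [RHS]eform_mul iPhi -[RHS]/(eform eps _ _) /X eform_mul.
rewrite !jE eformDl !eformDr eform_sumr big1 ?addr0; last by move=> a _; exact: XY.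
rewrite eform_suml [X in _ + (X + _)]big1 ?add0r; last first.
  by move=> a _; rewrite eformC; exact: XY.
congr (_ + _); rewrite eform_suml; apply: eq_bigr => a _.
rewrite -Yg eform_sumr (bigD1 a)//= big1 ?addr0// => b ba.
by apply: YY; rewrite eq_sym.
Qed.

Lemma tube_map_adapted : adapted eps f.
Proof.
have [sf ff] := tube_map_immersion; have [sf0 ff0] := tube_f0 td.
move=> c p i j u v ac dp ij /in_factorE -> /in_factorE ->.
set w := submxrow u i; set w' := submxrow v j.
have sfc := smooth_map_in sf ac.
have act := in_tail_charts ac; have dpt := in_tail_domains dp.
have um : induced_metric eps f (prod_chart c) p \in unitmx.
  apply: metric_unit => //; first exact: prod_good_chart.
    by move=> q; apply: Qspace_eform; exact: tube_map_Qspace.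
  by apply: ff => //; exact: atlas_prod.
suff H : (pd (c i) w (pd (c j) w' f) p <= jac f (prod_chart c) p)%MS.
  rewrite /sffQ /sff (_ : 'D_ _ _ _ = pd (c i) w (pd (c j) w' f) p).
    by rewrite nproj_sub// eform0l mulr0 scale0r subr0.
  symmetry; apply: etrans (pd_cmap hM _ _ ac dp) _.
  apply: (derivative_eq _ (open_ccod_prod hM ac) (ccod_prod_cmap dp)) => y cy /=.
  by symmetry; exact: pd_cinv.
(* Because I - A is invertible, ft has the same tangent space as the slice phi(f0(p_0)), which is
   contained in that of f. *)
have J_sub : (jac ft (prod_chart (tail_charts c)) (tail_pt p) <= jac f (prod_chart c) p)%MS.
  have H : (jac (section_of Phi (f0 (p ord0) - e1 + e1)) (prod_chart (tail_charts c)) (tail_pt p) <= jac f (prod_chart c) p)%MS.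
    rewrite subrK; apply/row_subP => k; rewrite rowE.
    have sxi := smooth_map_in (M := Mt) (smooth_section hMt sPhi (f0 (p ord0))) act.
    rewrite (jac_prod (M := Mt) hMt _ act sxi dpt); apply: summx_sub => a _.
    rewrite -[X in (X <= _)%MS]tube_map_pd -(factor_jac hM _ ac sfc dp).
    exact: submxMl.
  apply: submx_trans H; rewrite (section_jac (M := Mt) heps hMt pl ftQ sPhi nPhi parPhi _ (tube_phi_e1 td))//.
  have uB : 1%:M - shape_op eps ft (prod_chart (tail_charts c)) (tail_pt p)
      ((f0 (p ord0) - e1) *m Phi (tail_pt p)) \in unitmx.
    by apply: (tube_f0_Omega td) => //; exact: atlas_prod.
  by rewrite -{1}(mulKmx uB (jac ft _ _)) submxMl.
(* With p_0 varying only in f0, this derivative is the derivative along M_a of another parallel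
   section, namely phi of the derivative of f0 along v0; it is thus tangent to ft. *)
have mixed a v0 va : (pd (c ord0) v0 (pd (c (lift ord0 a)) va f) p <= jac f (prod_chart c) p)%MS.
  have df0 := smooth_differentiable (sf0 _ (ac ord0)) (ccod_cmap (dp ord0)).
  pose A := pd (M := Mt) (i := a) (c (lift ord0 a)) va Phi (tail_pt p).
  have -> : pd (c ord0) v0 (pd (c (lift ord0 a)) va f) p =
      'D_v0 (f0 \o cinv (c ord0)) (cmap (c ord0) (p ord0)) *m A.
    have e : (fun y => pd (c (lift ord0 a)) va f (dfwith p ord0 (cinv (c ord0) y))) =
        (fun y => (f0 \o cinv (c ord0)) y *m A).
      apply/funext => y; apply: etrans (tube_map_pd f0 Phi _ va _) _.
      rewrite tail_pt_dfwith0 dfwithin; exact: (section_pdE va _ hMt sPhi act dpt).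
    apply: etrans (derive_mulmxr A v0 df0).
    exact: (congr1 (fun g => 'D_v0 g (cmap (c ord0) (p ord0))) e).
  rewrite -(section_pdE va _ hMt sPhi act dpt).
  have [z ->] := section_pd (M := Mt) heps hMt pl ftQ sPhi nPhi parPhi ('D_v0 (f0 \o cinv (c ord0)) (cmap (c ord0) (p ord0))) va act dpt.
  rewrite -(factor_jac (M := Mt) hMt z act (smooth_map_in (smooth_ft pl) act) dpt).
  exact: submx_trans (submxMl _ _) J_sub.
move: ij w w'; case: (unliftP ord0 i) => [a ->|->]; case: (unliftP ord0 j) => [b ->|->] ij w w' //.
- have ab : a != b by apply: contraNneq ij => ->.
  suff -> : pd (c (lift ord0 a)) w (pd (c (lift ord0 b)) w' f) p = 0 by rewrite sub0mx.
  have ba : b != a by rewrite eq_sym.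
  apply: etrans (section_pd2 (M := Mt) heps hMt cMt pl ftQ sPhi nPhi parPhi (f0 (p ord0)) w' w ba act dpt).
  have e : (fun y => pd (c (lift ord0 b)) w' f (dfwith p (lift ord0 a) (cinv (c (lift ord0 a)) y))) =
      (fun y => pd (M := Mt) (i := b) (c (lift ord0 b)) w' (section_of Phi (f0 (p ord0)))
         (dfwith (tail_pt p) a (cinv (c (lift ord0 a)) y))).
    apply/funext => y; apply: etrans (tube_map_pd f0 Phi _ w' _) _.
    by rewrite tail_pt_dfwith dfwith_lift0.
  exact: (congr1 (fun g => 'D_w g (cmap (c (lift ord0 a)) (p (lift ord0 a)))) e).
- by rewrite (pdC hM _ _ ac sfc dp); exact: mixed.
Qed.

End Direct.

(** * Adapted immersions with polar metric *)

(* Pi y is the orthogonal projection onto the row space of b y. *)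
Lemma projection_constant (R : realType) (V : normedModType R) eps n N
    (b : V -> 'M[R]_(n, N)) (U : set V) x u :
  open U -> U x -> (forall y, U y -> b y *m gram eps N *m (b y)^T \in unitmx) ->
  differentiable b x ->
  let Pi y := gram eps N *m (b y)^T *m invmx (b y *m gram eps N *m (b y)^T) *m b y in
  differentiable Pi x /\ (('D_u b x <= b x)%MS -> 'D_u Pi x = 0).
Proof.
move=> oU Ux uG db Pi; set G := gram eps N in Pi uG *.
pose Gr y := b y *m G *m (b y)^T; pose K y := invmx (Gr y).
have dbG : differentiable (fun y => b y *m G) x.
  by apply: differentiable_mulmx => //; exact: differentiable_cst.
have dbT := differentiable_trmx db.
have dGr : differentiable Gr x by exact: differentiable_mulmx.
have dK : differentiable K x by exact: differentiable_invmx uG dGr.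
have dGb : differentiable (fun y => G *m (b y)^T) x.
  by apply: differentiable_mulmx => //; exact: differentiable_cst.
have dGbK : differentiable (fun y => G *m (b y)^T *m K y) x by exact: differentiable_mulmx.
split; first exact: differentiable_mulmx.
move=> /submxP[Z bZ].
have trG : G^T = G by exact: tr_gram.
have DGr : 'D_u Gr x = Z *m Gr x + Gr x *m Z^T.
  rewrite (derive_mulmx u dbG dbT) (derive_mulmxr G u db) (derive_trmx u db) bZ.
  by rewrite trmx_mul /Gr !mulmxA.
have DK : 'D_u K x = - (K x *m Z) - Z^T *m K x.
  have KG y : U y -> K y *m Gr y = 1%:M by move=> Uy; rewrite mulVmx//; exact: uG.
  have := derive_mulmx u dK dGr.
  rewrite (_ : 'D_u _ x = 0); last first.
    by apply: etrans (derivative_eq u oU Ux KG) _; exact: derive_cst.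
  have GK : Gr x *m K x = 1%:M by rewrite mulmxV//; exact: uG.
  have alg (D K' G' Z' W : 'M[R]_n) : G' *m K' = 1%:M -> K' *m G' = 1%:M ->
      0 = D *m G' + K' *m (Z' *m G' + G' *m W) -> D = - (K' *m Z') - W *m K'.
    move=> G'K' K'G' /(congr1 (fun A => A *m K')).
    rewrite mul0mx mulmxDr !mulmxDl -!mulmxA G'K' !mulmx1 (mulmxA K' G') K'G' mul1mx.
    by move/eqP; rewrite eq_sym addr_eq0 opprD => /eqP.
  by rewrite DGr; exact: alg GK (KG x Ux).
(* With D b = Z b, the derivative of G b^T K b is G b^T (Z^T K + D K + K Z) b, and the bracket
   vanishes by [DK]. *)
rewrite (derive_mulmx u dGbK db) (derive_mulmx u dGb dK) (derive_mulmxl G u dbT) (derive_trmx u db).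
rewrite DK bZ trmx_mul mulmxBr mulmxN !mulmxA addrCA subrr addr0 mulNmx.
by rewrite addNr.
Qed.

(** * Families and points assembled from index 0 and the remaining indices *)

Section OrdinalCons.
Variables (r : nat) (T : 'I_r.+1 -> Type) (x : T ord0) (y : forall a : 'I_r, T (lift ord0 a)).

(** A dependent cons. The transports along e disappear in the lemmas below since proofs of equality
    between ordinals are unique. *)
Definition ocons : forall i, T i := fun i =>
  match unliftP ord0 i with
  | UnliftSome j e => eq_rect_r T (y j) e
  | UnliftNone e => eq_rect_r T x e
  end.

Lemma ocons0 : ocons ord0 = x.
Proof.
rewrite /ocons; case: unliftP => [j e|e]; first by case/eqP: (neq_lift ord0 j).
by rewrite (eq_axiomK e).
Qed.

Lemma ocons_lift a : ocons (lift ord0 a) = y a.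
Proof.
rewrite /ocons; case: unliftP => [j e|e]; last by case/eqP: (neq_lift ord0 a); exact: esym e.
have ja := lift_inj e; subst j.
by rewrite (eq_axiomK e).
Qed.

Lemma ocons_ind (Q : forall i, T i -> Prop) :
  Q ord0 x -> (forall a, Q (lift ord0 a) (y a)) -> forall i, Q i (ocons i).
Proof.
move=> Q0 Q1 i; case: (unliftP ord0 i) => [a ->|->]; first by rewrite ocons_lift.
by rewrite ocons0.
Qed.

End OrdinalCons.

Section ConsPoint.
Variables (R : realType) (r : nat) (M : 'I_r.+1 -> premanifold R).
Hypothesis hM : forall i, is_manifold (M i).
Local Notation Mt := (fun a : 'I_r => M (lift ord0 a)).
Implicit Types (p : prodM M) (q : M ord0) (t : tailM M).

Definition consM q t : prodM M := @ocons r (fun i => M i : Type) q t.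

Lemma consM0 q t : consM q t ord0 = q. Proof. exact: ocons0. Qed.

Lemma consM_lift q t a : consM q t (lift ord0 a) = t a. Proof. exact: ocons_lift. Qed.

Lemma tail_consM q t : tail_pt (consM q t) = t.
Proof. by apply: functional_extensionality_dep => a; exact: consM_lift. Qed.

Lemma consM_eq p p' : p ord0 = p' ord0 -> tail_pt p = tail_pt p' -> p = p'.
Proof.
move=> e0 et; apply: functional_extensionality_dep => i.
case: (unliftP ord0 i) => [a ->|-> //].
exact: (congr1 (fun t : tailM M => t a) et).
Qed.

Lemma consM_tail p : consM (p ord0) (tail_pt p) = p.
Proof. by apply: consM_eq; rewrite ?consM0 ?tail_consM. Qed.

Lemma dfwith_consM0 q q' t : dfwith (consM q t) ord0 q' = consM q' t.
Proof.
apply: consM_eq; first by rewrite dfwithin consM0.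
by rewrite tail_pt_dfwith0 !tail_consM.
Qed.

Lemma dfwith_consM q t a (x : M (lift ord0 a)) :
  dfwith (consM q t) (lift ord0 a) x = consM q (dfwith (t : prodM Mt) a x).
Proof.
apply: consM_eq; first by rewrite dfwith_lift0 !consM0.
by rewrite tail_pt_dfwith !tail_consM.
Qed.

Lemma pd_consM m k (g : prodM M -> 'M[R]_(m, k)) q t a (c : mchart (M (lift ord0 a))) w :
  pd (M := Mt) (i := a) c w (fun t => g (consM q t)) t = pd (M := M) (i := lift ord0 a) c w g (consM q t).
Proof.
rewrite /pd consM_lift.
have e : (fun y => g (consM q (dfwith (t : prodM Mt) a (cinv c y)))) =
    (fun y => g (dfwith (consM q t) (lift ord0 a) (cinv c y))).
  by apply/funext => y; rewrite dfwith_consM.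
by rewrite e.
Qed.

Lemma smooth_consM m k (g : prodM M -> 'M[R]_(m, k)) q :
  smooth_map g -> smooth_map (fun t : tailM M => g (consM q t)).
Proof.
move=> sg; apply: (smooth_map_prod (M := Mt)) => ct act.
have hMt (a : 'I_r) : is_manifold (Mt a) by exact: hM.
have [c0 ac0 d0] := manifold_cover (hM ord0) q.
pose c := @ocons r (fun i => mchart (M i)) c0 ct.
have c0E : c ord0 = c0 by exact: ocons0.
have clE a : c (lift ord0 a) = ct a by exact: ocons_lift.
have ac : in_charts c.
  exact: (@ocons_ind r (fun i => mchart (M i)) c0 ct (fun i ci => atlas ci)).
(* Inserting the coordinates of q in front is an affine map of model spaces, with linear part L
   inserting 0. *)
pose A (x : 'rV[R]_(mdim (tailM M))) : 'rV[R]_(mdim (prodM M)) :=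
  \mxrow_i @ocons r (fun i => 'rV[R]_(mdim (M i))) (cmap c0 q) (fun a => submxrow x a) i.
pose L (x : 'rV[R]_(mdim (tailM M))) : 'rV[R]_(mdim (prodM M)) :=
  \mxrow_i @ocons r (fun i => 'rV[R]_(mdim (M i))) 0 (fun a => submxrow x a) i.
have AL : affine_with A L.
  move=> h v x; apply/mxrowP => i; rewrite submxrowD submxrowZ !mxrowK.
  case: (unliftP ord0 i) => [a ->|->]; last by rewrite !ocons0 scaler0 add0r.
  by rewrite !ocons_lift submxrowD submxrowZ.
have oct := open_ccod_prod (M := Mt) hMt act.
apply: (smooth_eq oct _ (smooth_affine AL (U := ccod (prod_chart ct)) _ (smooth_map_in sg ac))).
  move=> x cx; rewrite /=; congr g; apply: consM_eq.
    by rewrite consM0 /A mxrowK ocons0 c0E cinvK.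
  rewrite tail_consM; apply: functional_extensionality_dep => a.
  by rewrite /tail_pt /A mxrowK ocons_lift clE.
move=> x /(ccod_prod (M := Mt) hMt _ act) cx; apply/(ccod_prod hM _ ac) => i.
rewrite mxrowK; case: (unliftP ord0 i) => [a ->|->].
  by rewrite ocons_lift clE.
by rewrite ocons0 c0E; exact: ccod_cmap.
Qed.

End ConsPoint.

Section AdaptedPolar.
Variables (R : realType) (eps : R) (r N : nat) (M : 'I_r.+1 -> premanifold R).
Hypothesis heps : eps = 1 \/ eps = -1.
Hypothesis hM : forall i, is_manifold (M i).
Hypothesis cM : forall i, connected [set: M i].
Local Notation P := (prodM M).
Variable f : P -> 'rV[R]_N.
Hypothesis iF : immersion f.
Hypothesis fQ : forall p, eform eps (f p) (f p) = eps.
Hypothesis pol : polar (induced_metric eps f).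
Hypothesis ad : adapted eps f.
Implicit Types (c : forall i, mchart (M i)) (p : P).

Let sf : smooth_map f. Proof. by case: iF. Qed.

Lemma pd_metric c p i j u v : in_charts c -> in_domains c p ->
  eform eps (pd (c i) u f p) (pd (c j) v f p) =
  (factor_vec u *m induced_metric eps f (prod_chart c) p *m (factor_vec v)^T) 0 0.
Proof.
move=> ac dp; have sfc := smooth_map_in sf ac.
rewrite -(factor_jac hM u ac sfc dp) -(factor_jac hM v ac sfc dp).
exact: eform_mul.
Qed.

Lemma pd_orth c p (i j : 'I_r.+1) u v : i != j -> in_charts c -> in_domains c p ->
  eform eps (pd (c i) u f p) (pd (c j) v f p) = 0.
Proof.
move=> ij ac dp; rewrite pd_metric//; have [g0 [ga [_ _ ->//]]] := pol.
have z k : submxrow (factor_vec u) k = 0 \/ submxrow (factor_vec v) k = 0.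
  have [ik|ik] := eqVneq i k; last by left; exact: factor_vec_out.
  by right; apply: factor_vec_out; rewrite -ik eq_sym.
rewrite mxE summxE big1 => [|a _]; last first.
  by case: (z (lift ord0 a)) => ->; rewrite ?mul0mx ?trmx0 ?mulmx0 mxE.
by case: (z ord0) => ->; rewrite ?mul0mx ?trmx0 ?mulmx0 mxE addr0.
Qed.

(** The block of a polar metric on E_0 depends on p_0 alone and that on E_a on p_0 and p_a, so
    moving p_i leaves block j unchanged when i is neither j nor 0. *)
Lemma pd_metric_indep c p (i j : 'I_r.+1) (q : M i) u v : i != j -> i != ord0 ->
  in_charts c -> in_domains c p -> cdom (c i) q ->
  eform eps (pd (c j) u f (dfwith p i q)) (pd (c j) v f (dfwith p i q)) =
  eform eps (pd (c j) u f p) (pd (c j) v f p).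
Proof.
move=> ij i0 ac dp dq; have dpq := in_domains_dfwith dp dq.
rewrite (pd_metric u v ac dpq) (pd_metric u v ac dp); have [g0 [ga [_ _ polE]]] := pol.
apply: (congr1 (fun A : 'M[R]_1 => A 0 0)); apply: etrans (polE c _ _ _ ac dpq) _.
apply: etrans _ (esym (polE c p _ _ ac dp)).
have p0 : dfwith p i q ord0 = p ord0 by rewrite dfwithout.
rewrite p0; congr (_ + _); apply: eq_bigr => a _.
case: (eqVneq j (lift ord0 a)) => [ja|ja].
  by rewrite dfwithout// -ja.
by rewrite factor_vec_out// !mul0mx.
Qed.

(** The three products of a second derivative with a first one add up pairwise to derivatives of
    metric coefficients, which all vanish; hence each product is 0. The excluded case l = i, j = 0
    is the one where the metric on E_i varies with p_0. *)
Lemma koszul c p (i j l : 'I_r.+1) u v w : i != j -> i != ord0 -> (l != i) || (j != ord0) ->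
  in_charts c -> in_domains c p ->
  eform eps (pd (c i) u (pd (c j) v f) p) (pd (c l) w f p) = 0.
Proof.
move=> ij i0 lij ac dp; have sfc := smooth_map_in sf ac.
have S k z : smooth_in c (pd (c k) z f) by exact: smooth_in_pd.
have C k k' z z' : pd (c k) z (pd (c k') z' f) p = pd (c k') z' (pd (c k) z f) p.
  exact: pdC.
have E1 : eform eps (pd (c i) u (pd (c j) v f) p) (pd (c l) w f p) +
    eform eps (pd (c j) v f p) (pd (c i) u (pd (c l) w f) p) = 0.
  have [jl|jl] := eqVneq j l.
    subst l; apply: (pd_eform_const hM u ac (S j v) (S j w) dp) => q dq.
    exact: pd_metric_indep.
  apply: (pd_eform_const hM u ac (S j v) (S l w) dp) => q dq.
  by apply: pd_orth => //; exact: in_domains_dfwith.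
have E2 : eform eps (pd (c j) v (pd (c i) u f) p) (pd (c l) w f p) +
    eform eps (pd (c i) u f p) (pd (c j) v (pd (c l) w f) p) = 0.
  have [il|il] := eqVneq i l.
    subst l; rewrite eqxx /= in lij.
    apply: (pd_eform_const hM v ac (S i u) (S i w) dp) => q dq.
    by apply: pd_metric_indep => //; rewrite eq_sym.
  apply: (pd_eform_const hM v ac (S i u) (S l w) dp) => q dq.
  by apply: pd_orth => //; exact: in_domains_dfwith.
have E3 : eform eps (pd (c l) w (pd (c i) u f) p) (pd (c j) v f p) +
    eform eps (pd (c i) u f p) (pd (c l) w (pd (c j) v f) p) = 0.
  apply: (pd_eform_const hM w ac (S i u) (S j v) dp) => q dq.
  by apply: pd_orth => //; exact: in_domains_dfwith.
move: E1 E2 E3; rewrite (C j i v u) (C l i w u) (C l j w v).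
rewrite [eform _ (pd _ v f p) _]eformC.
have lin (a b d : R) : a + b = 0 -> a + d = 0 -> b + d = 0 -> a = 0 by lra.
exact: lin.
Qed.

Lemma position_pd c p i u : in_charts c -> in_domains c p ->
  eform eps (f p) (pd (c i) u f p) = 0.
Proof.
move=> ac dp; have sfc := smooth_map_in sf ac.
rewrite -(factor_jac hM u ac sfc dp); apply: eform_orth_sub (submxMl _ _).
exact: (position_normal (prod_good_chart hM ac)).
Qed.

Lemma mixed_tangent c p (i j : 'I_r.+1) u v : i != j -> in_charts c -> in_domains c p ->
  (pd (c i) u (pd (c j) v f) p <= jac f (prod_chart c) p)%MS.
Proof.
move=> ij ac dp; have sfc := smooth_map_in sf ac.
have um : induced_metric eps f (prod_chart c) p \in unitmx.
  by apply: metric_unit => //; [exact: prod_good_chart|case: iF => _; apply => //; exact: atlas_prod].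
set W := pd (c i) u _ p.
have := ad (c := c) (p := p) ac dp ij (in_factor_vec u) (in_factor_vec v).
rewrite /sffQ /sff (_ : 'D_ _ _ _ = W); last first.
  symmetry; apply: etrans (pd_cmap hM _ _ ac dp) _.
  apply: (derivative_eq _ (open_ccod_prod hM ac) (ccod_prod_cmap dp)) => y cy /=.
  by symmetry; exact: pd_cinv.
have Fn : f p *m gram eps N *m (jac f (prod_chart c) p)^T = 0.
  exact: (position_normal (prod_good_chart hM ac)).
rewrite (eform_nproj W Fn).
(* The second fundamental form in the quadric omits the component along f. Here that component
   vanishes: differentiating <D_j f, f> = 0 along i leaves - <D_j f, D_i f> = 0. *)
suff -> : eform eps W (f p) = 0 by rewrite mulr0 scale0r subr0; exact: nproj_eq0.
have Eq q : cdom (c i) q -> eform eps (pd (c j) v f (dfwith p i q)) (f (dfwith p i q)) = 0.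
  by move=> dq; rewrite eformC position_pd//; exact: in_domains_dfwith.
have := pd_eform_const hM u ac (smooth_in_pd hM v ac sfc) sfc dp Eq.
by rewrite [X in _ + X]pd_orth ?addr0// eq_sym.
Qed.

(** The vector is tangent, and [koszul] removes all its components except the one in E_i; for j > 0
    it removes this one as well. *)
Lemma mixed_pd c p (i j : 'I_r.+1) u v : i != j -> i != ord0 -> in_charts c -> in_domains c p ->
  exists2 z, pd (c i) u (pd (c j) v f) p = pd (c i) z f p & j != ord0 -> z = 0.
Proof.
move=> ij i0 ac dp; have sfc := smooth_map_in sf ac.
have /submxP[Z WZ] := mixed_tangent u v ij ac dp.
rewrite (jac_prod hM Z ac sfc dp) in WZ.
have Z0 l : (l != i) || (j != ord0) -> submxrow Z l = 0.
  move=> lij; apply: (pd_spacelike heps hM iF fQ ac dp).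
  apply: etrans _ (koszul u v (submxrow Z l) ij i0 lij ac dp).
  rewrite WZ eform_suml (bigD1 l)//= big1 ?addr0// => l' l'l.
  exact: pd_orth.
exists (submxrow Z i); last by move=> j0; rewrite Z0// j0 orbT.
rewrite WZ (bigD1 i)//= big1 ?addr0// => l li.
by rewrite Z0 ?li// pd_zero_vec.
Qed.

Lemma mixed_pd0 c p (i j : 'I_r.+1) u v : i != j -> i != ord0 -> j != ord0 ->
  in_charts c -> in_domains c p -> pd (c i) u (pd (c j) v f) p = 0.
Proof.
move=> ij i0 j0 ac dp; have [z -> ->//] := mixed_pd u v ij i0 ac dp.
by rewrite pd_zero_vec//; exact: smooth_map_in.
Qed.

Lemma pd_rowspace p (i : 'I_r.+1) (ci : mchart (M i)) q z : i != ord0 -> atlas ci -> cdom ci (p i) ->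
  exists z', pd ci z f (dfwith p ord0 q) = pd ci z' f p.
Proof.
move=> i0 ai di; have oi := open_ccod (hM i) ai.
have zi0 : ord0 != i by rewrite eq_sym.
(* The rows of [b q] frame the image of E_i at the point obtained from p by moving p_0 to q. *)
pose b q := jac (fun x => f (dfwith (dfwith p ord0 q) i x)) ci (p i).
have bE q' w : w *m b q' = pd ci w f (dfwith p ord0 q').
  rewrite (mul_jac (smooth_map_slice hM (dfwith p ord0 q') sf ai) w di).
  by rewrite /pd dfwithout.
have sb : forall c0 : mchart (M ord0), atlas c0 -> smooth_on (ccod c0) (b \o cinv c0).
  move=> c0 ac0; have oc0 := open_ccod (hM ord0) ac0.
  apply: smooth_rowP => // k.
  apply: (smooth_eq oc0 _ (smooth_slice_pd hM (delta_mx 0 k) sf _ ai di ac0 (b := ord0))) => //.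
  by move=> y _; rewrite /= rowE bE.
have db (c0 : mchart (M ord0)) x u : atlas c0 -> ccod c0 x ->
    ('D_u (b \o cinv c0) x <= (b \o cinv c0) x)%MS.
  move=> ac0 cx; have d0 := cdom_cinv (hM ord0) ac0 cx.
  set p' := dfwith p ord0 (cinv c0 x).
  have di' : cdom ci (p' i) by rewrite /p' dfwithout.
  have d0' : cdom c0 (p' ord0) by rewrite /p' dfwithin.
  have [c [ac dc ci_ c0_]] := exists_charts2 hM i0 ai di' ac0 d0'.
  apply/row_subP => k; rewrite rowE -derive_mulmxl; last first.
    exact: (smooth_differentiable (sb c0 ac0) cx).
  have -> : (fun y => delta_mx 0 k *m (b \o cinv c0) y) =
      (fun y => pd ci (delta_mx 0 k) f (dfwith p ord0 (cinv c0 y))).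
    by apply/funext => y; rewrite /= bE.
  rewrite (pd_slice hM _ _ _ ac0 cx); subst ci c0.
  rewrite (pdC hM _ _ ac (smooth_map_in sf ac) dc).
  have [z' -> _] := mixed_pd (delta_mx 0 k) u i0 i0 ac dc.
  by rewrite -bE submxMl.
have ub q' : b q' *m gram eps N *m (b q')^T \in unitmx.
  have [ss sr] := immersion_slice hM (dfwith p ord0 q') i iF.
  apply: (metric_unit heps (F := fun x => f (dfwith (dfwith p ord0 q') i x)) _ (ss ci ai)) => //.
    exact: manifold_good_chart.
  exact: sr.
pose Pi q := gram eps N *m (b q)^T *m invmx (b q *m gram eps N *m (b q)^T) *m b q.
have PiE : forall q1 q2, Pi q1 = Pi q2.
  apply: (constant_of_zero_derivative (hM ord0) (@cM ord0)) => c0 x ac0 cx.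
  have dbx := smooth_differentiable (sb c0 ac0) cx.
  have H u := projection_constant u (open_ccod (hM ord0) ac0) cx (fun y _ => ub (cinv c0 y)) dbx.
  by split=> [|u]; [have [] := H 0|have [_] := H u; apply; exact: db].
have bPi q' : b q' *m Pi q' = b q' by rewrite /Pi !mulmxA mulmxV ?mul1mx.
(* The frame at q is fixed by its own projection, which is also the projection at [p ord0]; its rows
   therefore lie in the row space there. *)
have bP : b q *m Pi (p ord0) = b q by rewrite (PiE _ q) bPi.
exists (z *m (b q *m (gram eps N *m (b (p ord0))^T *m invmx (b (p ord0) *m gram eps N *m (b (p ord0))^T)))).
have := bE (p ord0); rewrite dfwith_id => <-.
apply: etrans (esym (bE q z)) _; apply: etrans (congr1 (mulmx z) (esym bP)) _.
by rewrite /Pi; clearbody b; rewrite !mulmxA.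
Qed.

End AdaptedPolar.

(** * The tube over a leaf *)

Section TubeAssembly.
Variables (R : realType) (eps : R) (r N s : nat) (M : 'I_r.+1 -> premanifold R).
Hypothesis heps : eps = 1 \/ eps = -1.
Hypothesis hM : forall i, is_manifold (M i).
Local Notation Mt := (fun a : 'I_r => M (lift ord0 a)).
Variables (ft : tailM M -> 'rV[R]_N) (Phi : tailM M -> 'M[R]_(s, N))
  (e1 : 'rV[R]_s) (f0 : M ord0 -> 'rV[R]_s).
Hypothesis pl : product_like (M := Mt) eps ft.
Hypothesis ftQ : forall t, eform eps (ft t) (ft t) = eps.
Hypothesis sPhi : smooth_map Phi.
Hypothesis iPhi : forall t, Phi t *m gram eps N *m (Phi t)^T = gram eps s.
Hypothesis nPhi : forall (c : mchart (tailM M)) t, atlas c -> cdom c t ->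
  Phi t *m gram eps N *m (jac ft c t)^T = 0.
Hypothesis parPhi : forall (y : 'rV[R]_s) (c : mchart (tailM M)) t u, atlas c -> cdom c t ->
  ('D_u (fun x => y *m Phi (cinv c x)) (cmap c t) <= jac ft c t)%MS.

Let hMt (a : 'I_r) : is_manifold (Mt a). Proof. exact: hM. Qed.

Let tail_good (c : mchart (tailM M)) : atlas c -> good_chart c.
Proof. by move=> [ct act ->]; exact: (prod_good_chart (M := Mt) hMt). Qed.

Let tail_unit (c : mchart (tailM M)) t : atlas c -> cdom c t ->
  jac ft c t *m gram eps N *m (jac ft c t)^T \in unitmx.
Proof.
move=> ac dt; have [[sft fft] _ _] := pl.
exact: (metric_unit heps (tail_good ac) (sft c ac) ftQ dt (fft c t ac dt)).
Qed.

Let par_nconn (y : 'rV[R]_s) (c : mchart (tailM M)) t u : atlas c -> cdom c t ->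
  nconn eps ft c (fun x => y *m Phi (cinv c x)) u (cmap c t) = 0.
Proof.
move=> ac dt; apply: nproj_sub; first exact: tail_unit.
exact: parPhi.
Qed.

(** The derivative of y phi consists of (D y) phi, which is normal, and of y (D phi), which is
    tangent. In the frame phi the normal connection thus is plain differentiation of coordinates,
    and flatness becomes the symmetry of second derivatives. *)
Lemma nconn_section (c : mchart (tailM M)) V (xi : 'rV[R]_(mdim (tailM M)) -> 'rV[R]_N)
    (y : 'rV[R]_(mdim (tailM M)) -> 'rV[R]_s) :
  atlas c -> open V -> V `<=` ccod c -> smooth_on V y ->
  (forall x, V x -> xi x = y x *m Phi (cinv c x)) ->
  forall x u, V x -> nconn eps ft c xi u x = 'D_u y x *m Phi (cinv c x).
Proof.
move=> ac oV Vc sy xiE x u Vx; have cx := Vc x Vx; have gc := tail_good ac.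
have dx := good_cdom gc cx; have xE := good_cmapK gc cx.
have dy := smooth_differentiable sy Vx.
have dPhi := smooth_differentiable (sPhi ac) cx.
rewrite /nconn (derivative_eq u oV Vx xiE) (derive_mulmx u dy dPhi) nprojD /=.
have um : 'J (ft \o cinv c) x *m gram eps N *m ('J (ft \o cinv c) x)^T \in unitmx.
  by have := tail_unit ac dx; rewrite /jac xE.
rewrite [X in _ + X](nproj_sub um) ?addr0; last first.
  have := parPhi (y x) u ac dx; rewrite /jac xE; congr (_ <= _)%MS.
  exact: derive_mulmxl.
apply: nproj_orth; have := nPhi ac dx; rewrite /jac xE => h.
by rewrite -!mulmxA (mulmxA (Phi _)) h mulmx0.
Qed.

Lemma section_coordinates (c : mchart (tailM M)) V (xi : 'rV[R]_(mdim (tailM M)) -> 'rV[R]_N) :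
  atlas c -> local_section (fun t => <<Phi t>>%MS) c V xi ->
  exists2 y, smooth_on V y & forall x, V x -> xi x = y x *m Phi (cinv c x).
Proof.
move=> ac [oV Vc sxi xiE].
exists (fun x => xi x *m gram eps N *m (Phi (cinv c x))^T *m gram eps s).
  apply: smooth_mulmxr => //; apply: smooth_mulmx => //; first exact: smooth_mulmxr.
  by apply: smooth_trmx => //; exact: smooth_sub Vc (sPhi ac).
move=> x Vx; have := xiE x Vx; rewrite genmxE => /submxP[z ->].
rewrite -!mulmxA (mulmxA (gram eps N)) (mulmxA (Phi _)) (mulmxA (Phi _ )) iPhi.
by rewrite !mulmxA -(mulmxA z) gram_sq// mulmx1.
Qed.

Lemma assemble_tube : extrinsic_product eps ft -> Qspace eps e1 ->
  (forall t, e1 *m Phi t = ft t) -> immersion f0 -> (forall q, Qspace eps (f0 q)) ->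
  (forall q, immersion (fun t => f0 q *m Phi t)) ->
  tube_data eps ft (fun t => <<Phi t>>%MS) Phi e1 f0.
Proof.
move=> ex e1Q e1E if0 f0Q imm.
refine (TubeData ex _ _ _ _ _ e1Q e1E if0 _ f0Q).
- split=> [c t ac dt|c t ac dt].
    have /submxP[X ->] : (<<Phi t>> <= Phi t)%MS by rewrite genmxE.
    by rewrite -!mulmxA (mulmxA (Phi t)) nPhi ?mulmx0.
  have [oc K] := tail_good ac.
  exists (ccod c), (Phi \o cinv c); split; [exact: oc|exact: ccod_cmap|by []|exact: (sPhi ac)|].
  move=> x cx; split; first exact: (orthonormal_row_free heps (iPhi _)).
  by apply/eqmxP/eqmx_sym; exact: genmxE.
- move=> c V xi ac ls x u Vx; have [y sy xiE] := section_coordinates ac ls.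
  have [oV Vc _ _] := ls.
  by rewrite (nconn_section ac oV Vc sy xiE u Vx) genmxE submxMl.
- move=> c V xi ac ls x u v Vx; have [y sy xiE] := section_coordinates ac ls.
  have [oV Vc _ _] := ls.
  have E w z : V z -> nconn eps ft c xi w z = 'D_w y z *m Phi (cinv c z).
    by move=> Vz; exact: (nconn_section ac oV Vc sy xiE w Vz).
  apply: etrans (nconn_section ac oV Vc (smooth_derive v sy) (E v) u Vx) _.
  apply: etrans _ (esym (nconn_section ac oV Vc (smooth_derive u sy) (E u) v Vx)).
  by apply: (congr1 (mulmx^~ _)); exact: (derivative_symmetry_mx _ _ oV Vx sy).
- by move=> t; rewrite genmxE -e1E submxMl.
- split; [exact: sPhi|by move=> t; apply/eqmxP/eqmx_sym; exact: genmxE| |].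
    by move=> t y z; rewrite eform_mul iPhi.
  by move=> y c t u ac dt; exact: par_nconn.
(* Membership in Omega: by [section_jac] the Jacobian of the immersion phi(f0(q)) is I - A times
   that of ft, so I - A has trivial kernel. *)
- move=> q c t ac dt; have [ct act cE] := ac; subst c.
  have := section_jac (M := Mt) heps hMt pl ftQ sPhi nPhi par_nconn (f0 q - e1) e1E act dt.
  rewrite subrK => sj; rewrite -row_free_unit; apply/inj_row_free => u u0.
  have [_ fi] := imm q; have fr := fi _ t (atlas_prod act) dt.
  apply: (row_free_inj fr); rewrite mul0mx; apply: etrans (congr1 (mulmx u) sj) _.
  by rewrite mulmxA u0 mul0mx.
Qed.

End TubeAssembly.

(** * Leaves of an adapted immersion with polar metric *)

Section TubeConstruction.
Variables (R : realType) (eps : R) (r N : nat) (M : 'I_r.+1 -> premanifold R).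
Hypothesis heps : eps = 1 \/ eps = -1.
Hypothesis hM : forall i, is_manifold (M i).
Hypothesis cM : forall i, connected [set: M i].
Local Notation P := (prodM M).
Local Notation Mt := (fun a : 'I_r => M (lift ord0 a)).
Variable f : P -> 'rV[R]_N.
Hypothesis iF : immersion f.
Hypothesis fQs : forall p, Qspace eps (f p).
Hypothesis pol : polar (induced_metric eps f).
Hypothesis ad : adapted eps f.
Variables (q0 : M ord0) (o : tailM M).

Let fQ p : eform eps (f p) (f p) = eps. Proof. exact: Qspace_eform. Qed.
Let hMt (a : 'I_r) : is_manifold (Mt a). Proof. exact: hM. Qed.
Let cMt (a : 'I_r) : connected [set: Mt a]. Proof. exact: cM. Qed.
Let sf : smooth_map f. Proof. by case: iF. Qed.

Definition leaf q (t : tailM M) : 'rV[R]_N := f (consM q t).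

Lemma smooth_leaf q : smooth_map (leaf q).
Proof. exact: smooth_consM. Qed.

Lemma exists_cons_charts q (t : tailM M) (ct : forall a : 'I_r, mchart (Mt a)) :
  in_charts ct -> in_domains (M := Mt) ct t ->
  exists c : forall i, mchart (M i),
    [/\ in_charts c, in_domains c (consM q t) & tail_charts c = ct].
Proof.
move=> act dt; have [c0 ac0 d0] := manifold_cover (hM ord0) q.
exists (@ocons r (fun i => mchart (M i)) c0 ct); split.
- exact: (@ocons_ind r (fun i => mchart (M i)) c0 ct (fun i ci => atlas ci)).
- move=> i; case: (unliftP ord0 i) => [a ->|->].
    by rewrite ocons_lift consM_lift.
  by rewrite ocons0 consM0.
- by apply: functional_extensionality_dep => a; exact: ocons_lift.
Qed.

Lemma leaf_pd q (t : tailM M) a (c : mchart (M (lift ord0 a))) w :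
  pd (M := Mt) (i := a) c w (leaf q) t = pd (M := M) (i := lift ord0 a) c w f (consM q t).
Proof. exact: pd_consM. Qed.

Lemma leaf_tangent q q' (t : tailM M) a (c : mchart (M (lift ord0 a))) w :
  atlas c -> cdom c (t a) ->
  exists z, pd (M := Mt) (i := a) c w (leaf q) t = pd (M := Mt) (i := a) c z (leaf q') t.
Proof.
move=> ac dt; have di : cdom c (consM q' t (lift ord0 a)) by rewrite consM_lift.
have [|z] := pd_rowspace heps hM cM iF fQ pol ad q w _ ac di; first by [].
by rewrite dfwith_consM0 => E; exists z; rewrite !leaf_pd.
Qed.

Lemma leaf_immersion q : immersion (leaf q).
Proof.
split; first exact: smooth_leaf.
move=> c' t [ct act ->] dt; apply/inj_row_free => u.
rewrite (jac_prod (M := Mt) hMt u act (smooth_map_in (smooth_leaf q) act) dt).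
have [c [ac dc cE]] := exists_cons_charts q act dt; subst ct => u0.
have [_ ff] := iF; have fr := ff _ _ (atlas_prod ac) dc.
pose v := \sum_(a < r) factor_vec (M := M) (submxrow u a : 'rV_(mdim (M (lift ord0 a)))).
have v0 : v = 0.
  apply: (row_free_inj fr); rewrite mul0mx /v mulmx_suml; apply: etrans _ u0.
  apply: eq_bigr => a _; rewrite leaf_pd.
  exact: (factor_jac hM (submxrow u a) ac (smooth_map_in sf ac) dc).
apply/mxrowP => a; rewrite submxrow0.
have := congr1 (fun A => submxrow A (lift ord0 a)) v0.
rewrite /v submxrow_sum submxrow0 (bigD1 a)//= factor_vecK big1 ?addr0// => b ba.
by apply: factor_vec_out; apply: contraNneq ba => /lift_inj ->.
Qed.

Lemma leaf_product_like q : product_like (M := Mt) eps (leaf q).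
Proof.
split; first exact: leaf_immersion.
- move=> a b ca cb w w' t ab aa da bb db.
  have e : pd (M := Mt) (i := b) cb w' (leaf q) = (fun t => pd (M := M) (i := lift ord0 b) cb w' f (consM q t)).
    by apply/funext => x; exact: leaf_pd.
  rewrite e; apply: etrans (pd_consM _ _ _ _ _) _.
  have ab' : lift ord0 a != lift ord0 b by apply: contraNneq ab => /lift_inj ->.
  have da' : cdom ca (consM q t (lift ord0 a)) by rewrite consM_lift.
  have db' : cdom cb (consM q t (lift ord0 b)) by rewrite consM_lift.
  have [c [ac dc ca_ cb_]] := exists_charts2 hM ab' aa da' bb db'; subst ca cb.
  exact: (mixed_pd0 heps hM iF fQ pol ad).
- move=> a b ca cb w w' t ab aa da bb db; rewrite !leaf_pd.
  have ab' : lift ord0 a != lift ord0 b by apply: contraNneq ab => /lift_inj ->.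
  have da' : cdom ca (consM q t (lift ord0 a)) by rewrite consM_lift.
  have db' : cdom cb (consM q t (lift ord0 b)) by rewrite consM_lift.
  have [c [ac dc ca_ cb_]] := exists_charts2 hM ab' aa da' bb db'; subst ca cb.
  exact: (pd_orth hM iF pol).
Qed.

(** The two leaves have the same tangent space at t by [leaf_tangent], and a leaf is normal to its
    own. *)
Lemma leaf_position q q' (t : tailM M) a (c : mchart (M (lift ord0 a))) w :
  atlas c -> cdom c (t a) ->
  eform eps (leaf q t) (pd (M := Mt) (i := a) c w (leaf q') t) = 0.
Proof.
move=> ac dt; have [z ->] := leaf_tangent q' q w ac dt; rewrite leaf_pd.
have di : cdom c (consM q t (lift ord0 a)) by rewrite consM_lift.
have [c' [ac' dc' cE]] := exists_charts1 hM ac di; subst c.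
exact: (position_pd hM iF fQ).
Qed.

Lemma leaf_normal q q' (c : mchart (tailM M)) t : atlas c -> cdom c t ->
  leaf q t *m gram eps N *m (jac (leaf q') c t)^T = 0.
Proof.
move=> [ct act ->] dt; apply/matrixP => i j; rewrite ord1 mul_gram_tr [RHS]mxE rowE.
rewrite (jac_prod (M := Mt) hMt _ act (smooth_map_in (smooth_leaf q') act) dt).
by rewrite eform_sumr big1// => a _; apply: leaf_position.
Qed.

Lemma leaf_derive_sub q q' (c : mchart (tailM M)) t u : atlas c -> cdom c t ->
  ('D_u (leaf q \o cinv c) (cmap c t) <= jac (leaf q') c t)%MS.
Proof.
move=> [ct act ->] dt; have sl := smooth_map_in (smooth_leaf q) act.
rewrite (derive_prod (M := Mt) hMt u act sl dt); apply: summx_sub => a _.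
have [z ->] := leaf_tangent q q' (submxrow u a) (act a) (dt a).
have sl' := smooth_map_in (smooth_leaf q') act.
by rewrite -(factor_jac (M := Mt) hMt z act sl' dt) submxMl.
Qed.

(** Both terms of the derivative of this product vanish by [leaf_position], for distinct leaves just
    as for a single one. *)
Lemma leaf_inner_const q q' t t' : eform eps (leaf q t) (leaf q' t) = eform eps (leaf q t') (leaf q' t').
Proof.
pose F (t : prodM Mt) : 'M[R]_1 := leaf q t *m gram eps N *m (leaf q' t)^T.
suff H : forall t t', F t = F t' by exact: (congr1 (fun A : 'M[R]_1 => A 0 0) (H t t')).
have sF : smooth_map F.
  apply: smooth_map_prod => c ac; have oc := open_ccod_prod hMt ac.
  apply: smooth_mulmx => //; first apply: smooth_mulmxr => //.
    exact: (smooth_map_in (smooth_leaf q) ac).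
  by apply: smooth_trmx => //; exact: (smooth_map_in (smooth_leaf q') ac).
apply: constant_prod => p a x.
refine (@constant_slice R r Mt hMt 1 1 p a F (@cMt a) _ _ x).
  by move=> ca aa; exact: (smooth_map_slice hMt p sF aa).
move=> ca x' w aa da; set t0 := dfwith p a x'.
have dt0 : cdom ca (t0 a) by rewrite /t0 dfwithin.
have [c [ac dc cE]] := exists_charts1 hMt aa dt0; subst ca.
have d1 := differentiable_slice hMt a ac (smooth_map_in (smooth_leaf q) ac) dc.
have d2 := differentiable_slice hMt a ac (smooth_map_in (smooth_leaf q') ac) dc.
have dG : differentiable (fun y => leaf q (dfwith t0 a (cinv (c a) y)) *m gram eps N) (cmap (c a) (t0 a)).
  by apply: differentiable_mulmx => //; exact: differentiable_cst.
apply: etrans (derive_mulmx w dG (differentiable_trmx d2)) _.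
rewrite (derive_mulmxr _ w d1) (derive_trmx w d2).
have e : dfwith t0 a (cinv (c a) (cmap (c a) (t0 a))) = t0.
  by rewrite (cinvK (hMt a) (ac a) (dc a)) dfwith_id.
rewrite e; apply/matrixP => i j; rewrite !ord1 [LHS]mxE [RHS]mxE.
rewrite -[X in X + _]/(eform eps (pd (c a) w (leaf q) t0) (leaf q' t0)).
rewrite -[X in _ + X]/(eform eps (leaf q t0) (pd (c a) w (leaf q') t0)).
by rewrite eformC !leaf_position ?addr0//; exact: ac.
Qed.

End TubeConstruction.

(** Smoothness passes from g to its linear image h; injectivity of the differential passes to h
    because g factors through h. *)
Lemma factor_immersion (R : realType) (M : premanifold R) m n (h : M -> 'rV[R]_m)
    (g : M -> 'rV[R]_n) (A : 'M[R]_(n, m)) (F : 'rV[R]_m -> 'rV[R]_n) :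
  is_manifold M -> immersion g -> (forall q, h q = g q *m A) ->
  (forall y, differentiable F y) -> (forall q, g q = F (h q)) -> immersion h.
Proof.
move=> hM [sg fg] hE dF gE.
have sh : smooth_map h.
  move=> c ac; apply: (smooth_eq (open_ccod hM ac) _ (smooth_mulmxr A (open_ccod hM ac) (sg c ac))).
  by move=> x _; rewrite /= hE.
split=> // c p ac dp; apply/inj_row_free => u u0.
apply: (row_free_inj (fg c p ac dp)); rewrite mul0mx.
have dg := smooth_differentiable (sg c ac) (ccod_cmap dp).
have dh := smooth_differentiable (sh c ac) (ccod_cmap dp).
rewrite /jac jacobianE// in u0; rewrite /jac jacobianE//.
have -> : g \o cinv c = F \o (h \o cinv c) by apply/funext => x; rewrite /= gE.
rewrite deriveE; last exact: differentiable_comp.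
rewrite (diff_comp dh (dF _)) deriveE// in u0 *; rewrite /= u0; exact: linear0.
Qed.

(** In a Lorentzian orthonormal frame the coordinate of index 0 is minus the product with the first
    frame vector, here a positive multiple of t. *)
Lemma first_coordinate_gt0 (R : realType) (e e' : R) n s (J : 'M[R]_(s, n)) (x t : 'rV[R]_n)
    (i : 'I_s) al : e = -1 -> e' = -1 -> i = 0%N :> nat -> 0 < al -> row i J = al *: t ->
  eform e x t < 0 -> 0 < (x *m (gram e n *m J^T *m gram e' s)) 0 i.
Proof.
move=> em1 e'm1 i0 al0 rJ xt; rewrite !mulmxA [gram e' s]/gram mul_mx_diag mxE mul_gram_tr rJ eformZr.
by rewrite mxE i0 eqxx e'm1 mulrN1 -mulrN pmulr_rgt0// oppr_gt0.
Qed.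

(** * The parallel frame spanned by the leaves *)

Section LeafFrame.
Variables (R : realType) (eps : R) (r N : nat) (M : 'I_r.+1 -> premanifold R).
Hypothesis heps : eps = 1 \/ eps = -1.
Hypothesis hM : forall i, is_manifold (M i).
Hypothesis cM : forall i, connected [set: M i].
Local Notation P := (prodM M).
Local Notation Mt := (fun a : 'I_r => M (lift ord0 a)).
Variable f : P -> 'rV[R]_N.
Hypothesis iF : immersion f.
Hypothesis fQs : forall p, Qspace eps (f p).
Hypothesis pol : polar (induced_metric eps f).
Hypothesis ad : adapted eps f.
Variables (q0 : M ord0) (o : tailM M).

Let leafC := leaf_inner_const heps hM cM iF fQs pol ad.
Let leafQ q t : eform eps (leaf f q t) (leaf f q t) = eps.
Proof. by apply: Qspace_eform; exact: fQs. Qed.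
Let hMt (a : 'I_r) : is_manifold (Mt a). Proof. exact: hM. Qed.
Let hMtail (c : mchart (tailM M)) : atlas c -> open (ccod c).
Proof. by move=> [ct act ->]; exact: (open_ccod_prod (M := Mt) hMt). Qed.

Variables (k : nat) (qs : 'I_k -> M ord0).
Hypothesis span_qs : forall q, (leaf f q o <= \matrix_i leaf f (qs i) o)%MS.
Variables (s : nat) (J : 'M[R]_(s, N)) (C : 'M[R]_(s, k)).
Hypothesis JJ : J *m gram eps N *m J^T = gram eps s.
Hypothesis JE : J = C *m \matrix_i leaf f (qs i) o.
Hypothesis EJ : (\matrix_i leaf f (qs i) o <= J)%MS.
Hypothesis Jt : eps = -1 -> forall i : 'I_s, i = 0%N :> nat ->
  exists2 a, 0 < a & row i J = a *: leaf f q0 o.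

Let A (t : tailM M) : 'M[R]_(k, N) := \matrix_i leaf f (qs i) t.
Definition leaf_frame (t : tailM M) : 'M[R]_(s, N) := C *m \matrix_i leaf f (qs i) t.
(** The factor on the right is a right inverse of the orthonormal J, so these are the coordinates in
    J of the leaf at the single point o. *)
Definition leaf_coord (q : M ord0) : 'rV[R]_s :=
  leaf f q o *m (gram eps N *m J^T *m gram eps s).
Local Notation Phi := leaf_frame.
Local Notation y := leaf_coord.

Let sA (c : mchart (tailM M)) : atlas c -> smooth_on (ccod c) (A \o cinv c).
Proof.
move=> ac; apply: smooth_rowP; first exact: hMtail.
move=> i; have -> : (fun x => row i ((A \o cinv c) x)) = leaf f (qs i) \o cinv c.
  by apply/funext => x; rewrite /= rowK.
by have := smooth_leaf hM iF (qs i); apply.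
Qed.

Lemma leaf_frame_smooth : smooth_map Phi.
Proof. by move=> c ac; apply: smooth_mulmxl; [exact: hMtail|exact: sA]. Qed.

Lemma leaf_frame_isometry t : Phi t *m gram eps N *m (Phi t)^T = gram eps s.
Proof.
rewrite -JJ JE /Phi !trmx_mul !mulmxA; congr (_ *m _).
rewrite -!mulmxA; congr (_ *m _); rewrite !mulmxA.
by apply/matrixP => i j; rewrite !mul_gram_trmx !rowK; exact: leafC.
Qed.

Lemma leaf_frame_normal (c : mchart (tailM M)) t : atlas c -> cdom c t ->
  Phi t *m gram eps N *m (jac (leaf f q0) c t)^T = 0.
Proof.
move=> ac dt; rewrite /Phi -!mulmxA [X in C *m X](_ : _ = 0) ?mulmx0// mulmxA.
apply/row_matrixP => i; rewrite !row_mul rowK row0.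
exact: (leaf_normal heps hM cM iF fQs pol ad).
Qed.

Lemma leaf_frame_parallel (z : 'rV[R]_s) (c : mchart (tailM M)) t u : atlas c -> cdom c t ->
  ('D_u (fun x => z *m Phi (cinv c x)) (cmap c t) <= jac (leaf f q0) c t)%MS.
Proof.
move=> ac dt; have dA := smooth_differentiable (sA ac) (ccod_cmap dt).
have -> : (fun x => z *m Phi (cinv c x)) = (fun x => z *m C *m (A \o cinv c) x).
  by apply/funext => x; rewrite /Phi mulmxA.
rewrite (derive_mulmxl _ u dA); apply: submx_trans (submxMl _ _) _.
apply/row_subP => i; rewrite rowE -(derive_mulmxl _ u dA).
have -> : (fun x => delta_mx 0 i *m (A \o cinv c) x) = leaf f (qs i) \o cinv c.
  by apply/funext => x; rewrite -rowE rowK.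
exact: (leaf_derive_sub heps hM cM iF fQs pol ad).
Qed.

Let yJ q : y q *m J = leaf f q o.
Proof.
have /submxP[z zE] : (leaf f q o <= J)%MS by exact: submx_trans (span_qs q) EJ.
rewrite /y zE -!mulmxA (mulmxA J) (mulmxA (J *m _)) JJ (mulmxA (gram eps s)).
by rewrite gram_sq// mul1mx.
Qed.

Lemma leaf_coordE q t : y q *m Phi t = leaf f q t.
Proof.
(* The difference eta vanishes at o and has constant products with the leaves, so
   it is null and orthogonal to the leaf of q0, a vector of square eps. *)
pose eta t := leaf f q t - y q *m Phi t.
have etaE t' : eta t' = leaf f q t' - \sum_i (y q *m C) 0 i *: leaf f (qs i) t'.
  rewrite /eta /Phi mulmxA mulmx_sum_row; congr (_ - _).
  by apply: eq_bigr => i _; rewrite rowK.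
have eta_leaf q' : eform eps (eta t) (leaf f q' t) = 0.
  have <- : eform eps (eta o) (leaf f q' o) = 0.
    by rewrite /eta /Phi -JE yJ subrr eform0l.
  rewrite !etaE !eformBl !eform_suml (leafC q q' t o); congr (_ - _).
  by apply: eq_bigr => i _; rewrite !eformZl (leafC _ _ t o).
have eta_eta : eform eps (eta t) (eta t) = 0.
  rewrite [X in eform _ _ X]etaE eformBr eta_leaf eform_sumr big1 ?subr0// => i _.
  by rewrite eformZr eta_leaf mulr0.
apply/esym/eqP; rewrite -subr_eq0; apply/negPn/negP => eta0.
have := complement_pos (t := leaf f q0 t) heps _ _ eta0.
by rewrite leafQ eformC eta_leaf eta_eta eps_sq// ltr01 ltxx => /(_ isT erefl).
Qed.

Lemma leaf_coord_Q q : Qspace eps (y q).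
Proof.
split.
  have -> : eform eps (y q) (y q) = eform eps (y q *m J) (y q *m J) by rewrite eform_mul JJ.
  by rewrite yJ leafQ expr1n mulr1.
move=> em1 i i0; have [a a0 ra] := Jt em1 i0.
apply: (first_coordinate_gt0 em1 em1 i0 a0 ra).
have ff q' : future (leaf f q' o) by have [_] := fQs (consM q' o); apply.
by rewrite em1; apply: future_timelike => //; rewrite -em1 leafQ em1 ltrN10.
Qed.

Lemma leaf_coord_immersion : immersion y.
Proof.
apply: (factor_immersion (F := mulmx^~ J) (hM ord0) (immersion_slice hM (consM q0 o) ord0 iF)).
- by move=> q; rewrite dfwith_consM0.
- by move=> z; apply: differentiable_mulmx; [exact: ex_diff|exact: differentiable_cst].
- by move=> q; rewrite dfwith_consM0; exact: (esym (yJ q)).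
Qed.

Lemma leaf_tube_data : extrinsic_product (M := Mt) eps (leaf f q0) ->
  tube_data eps (leaf f q0) (fun t => <<Phi t>>%MS) Phi (y q0) y /\
  forall p, f p = tube_map Phi y p.
Proof.
move=> ex; split; last by move=> p; rewrite /tube_map leaf_coordE /leaf consM_tail.
refine (assemble_tube heps hM (leaf_product_like heps hM iF fQs pol ad q0)
  (leafQ q0) leaf_frame_smooth leaf_frame_isometry leaf_frame_normal
  leaf_frame_parallel ex (leaf_coord_Q q0) (leaf_coordE q0) leaf_coord_immersion
  leaf_coord_Q _).
move=> q; have -> : (fun t => y q *m Phi t) = leaf f q by apply/funext => t; exact: leaf_coordE.
  exact: (leaf_immersion hM iF).
Qed.

End LeafFrame.

Lemma exists_tube_data (R : realType) (eps : R) r N (M : 'I_r.+1 -> premanifold R)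
    (f : prodM M -> 'rV[R]_N) (q0 : M ord0) :
  eps = 1 \/ eps = -1 -> (forall i, is_manifold (M i)) ->
  (forall i, connected [set: M i]) -> immersion f -> (forall p, Qspace eps (f p)) ->
  polar (induced_metric eps f) -> adapted eps f -> tailM M ->
  extrinsic_product (M := fun a : 'I_r => M (lift ord0 a)) eps (leaf f q0) ->
  exists s (ft : tailM M -> 'rV[R]_N) (E : tailM M -> 'M[R]_N)
    (Phi : tailM M -> 'M[R]_(s, N)) (e1 : 'rV[R]_s) (f0 : M ord0 -> 'rV[R]_s),
    tube_data eps ft E Phi e1 f0 /\ forall p, f p = tube_map Phi f0 p.
Proof.
move=> heps hM cM iF fQs pol ad o ex.
have [k [X [PX _ sX]]] := finite_span [set x | exists q, x = leaf f q o].
have [qs qsE] := choice PX.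
have XE : \matrix_i X i = \matrix_i leaf f (qs i) o.
  by apply/row_matrixP => i; rewrite !rowK.
have span_qs q : (leaf f q o <= \matrix_i leaf f (qs i) o)%MS.
  by rewrite -XE; apply: sX; exists q.
have [|s [J [JJ JX Jt]]] := quadric_basis heps (A := \matrix_i leaf f (qs i) o) (t := leaf f q0 o).
  move=> em1; split=> //; have := Qspace_eform (fQs (consM q0 o)).
  by rewrite /leaf => ->; rewrite em1 ltrN10.
have /submxP[C JE] : (J <= \matrix_i leaf f (qs i) o)%MS by rewrite JX.
have EJ : (\matrix_i leaf f (qs i) o <= J)%MS by rewrite JX.
exists s; do 5!eexists; exact: (leaf_tube_data heps hM cM iF fQs pol ad span_qs JJ JE EJ Jt ex).
Qed.

(** * Recognition of extrinsic products *)

Section OrthogonalBases.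
Variables (R : realType) (eps : R) (r N : nat).
Hypothesis heps : eps = 1 \/ eps = -1.
Implicit Types (a b : 'I_r) (x y : 'rV[R]_N).

(** The second property expresses minimality: linear conditions on the values of phi pass to V. A
    square V gives all members of a family the same type. *)
Lemma spanning_mx (T : Type) (phi : T -> 'rV[R]_N) : exists V : 'M[R]_N,
  (forall q, (phi q <= V)%MS) /\
  forall n (A : 'M[R]_(N, n)), (forall q, phi q *m A = 0) -> V *m A = 0.
Proof.
have [k [X [PX _ sX]]] := finite_span [set x | exists q, x = phi q].
exists <<\matrix_i X i>>%MS; split=> [q|n A phiA].
  by rewrite genmxE; apply: sX; exists q.
apply/sub_kermxP; rewrite genmxE; apply/row_subP => i; rewrite rowK.
by have [q ->] := PX i; apply/sub_kermxP.
Qed.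

Lemma spanning_family (T : 'I_r -> Type) (phi : forall a, T a -> 'rV[R]_N) :
  (forall a b q q', a != b -> eform eps (phi a q) (phi b q') = 0) ->
  exists V : 'I_r -> 'M[R]_N, (forall a q, (phi a q <= V a)%MS) /\
    forall a b, a != b -> V a *m gram eps N *m (V b)^T = 0.
Proof.
move=> ophi; have /choice[V HV] := fun a => spanning_mx (phi a).
exists V; split=> [a q|a b ab]; first by have [+ _] := HV a; apply.
rewrite -mulmxA; have [_] := HV a; apply=> q; rewrite mulmxA -tr_form -mulmxA.
have [_ ->] := HV b; first exact: trmx0.
move=> q'; rewrite mulmxA [LHS]mx11_scalar -[X in X%:M]/(eform eps _ _) ophi ?scalemx0//.
  by apply/matrixP => i j; rewrite !mxE mul0rn.
by rewrite eq_sym.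
Qed.

Section Decomposition.
Variables (sig : 'I_r -> R) (m : 'I_r -> nat) (J : forall a, 'M[R]_(m a, N)).
Arguments J : clear implicits.
Hypothesis hsig : forall a, sig a = 1 \/ sig a = -1.
Hypothesis JJ : forall a, J a *m gram eps N *m (J a)^T = gram (sig a) (m a).
Hypothesis JJ0 : forall a b, a != b -> J a *m gram eps N *m (J b)^T = 0.

(** Coordinates, in the frame [J a], of the orthogonal projection onto its row space. *)
Definition component a : 'M[R]_(N, m a) := gram eps N *m (J a)^T *m gram (sig a) (m a).

Lemma component_self a n (z : 'M[R]_(n, m a)) : z *m J a *m component a = z.
Proof.
by rewrite /component !mulmxA -(mulmxA z) -(mulmxA z) JJ -mulmxA gram_sq// mulmx1.
Qed.

Lemma component_other a b n (z : 'M[R]_(n, m a)) : a != b -> z *m J a *m component b = 0.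
Proof.
by move=> ab; rewrite /component !mulmxA -(mulmxA z) -(mulmxA z) JJ0// mulmx0 mul0mx.
Qed.

Variable b : 'I_r.
Hypothesis Jb : forall x, (forall a, a != b -> x *m gram eps N *m (J a)^T = 0) -> (x <= J b)%MS.

(** The remainder z has no component in any block. Being orthogonal to all blocks other than b it
    lies in block b by [Jb], and there it equals its own component. *)
Lemma component_sum x : x = \sum_a x *m component a *m J a.
Proof.
pose z := x - \sum_a x *m component a *m J a.
have zc a : z *m component a = 0.
  rewrite /z mulmxBl mulmx_suml (bigD1 a)//= component_self big1 ?addr0 ?subrr//.
  by move=> a' aa'; rewrite component_other.
have /submxP[w wE] : (z <= J b)%MS.
  apply: Jb => a _; have := zc a; rewrite /component !mulmxA => zJ.
  by rewrite -[LHS]mulmx1 -(gram_sq (hsig a)) mulmxA zJ mul0mx.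
apply/eqP; rewrite -subr_eq0 -/z wE; have := zc b.
by rewrite wE component_self => ->; rewrite mul0mx.
Qed.

Lemma component_form x : eform eps x x = \sum_a eform (sig a) (x *m component a) (x *m component a).
Proof.
rewrite {1}(component_sum x) eform_suml; apply: eq_bigr => a _.
rewrite {2}(component_sum x) eform_sumr (bigD1 a)//= big1 ?addr0 => [|b' bb'].
  by rewrite eform_mul JJ.
by rewrite eform_mul JJ0 1?eq_sym// mulmx0 mul0mx mxE.
Qed.

Lemma component_decomp : orth_decomp eps sig J.
Proof.
split=> //; pose B : 'M[R]_(\sum_a m a, N) := \mxcol_a J a.
have fB : row_free B.
  apply/inj_row_free => u uB; apply/mxrowP => a; rewrite submxrow0.
  have uE : u *m B = \sum_a' submxrow u a' *m J a' by rewrite -mul_mxrow_mxcol submxrowK.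
  rewrite -[LHS]component_self; have := congr1 (mulmx^~ (component a)) uB.
  rewrite uE /= mulmx_suml mul0mx (bigD1 a)//= big1 ?addr0// => a' aa'.
  exact: component_other.
have full : row_full B.
  rewrite -sub1mx; apply/row_subP => i; rewrite (component_sum (row i 1%:M)).
  have -> : \sum_a row i 1%:M *m component a *m J a = (\mxrow_a (row i 1%:M *m component a)) *m B.
    by rewrite mul_mxrow_mxcol.
  exact: submxMl.
by rewrite -(eqP fB) (eqP full).
Qed.

End Decomposition.

(** For a <> b an orthonormal basis of [V a] serves. [J b] spans the whole complement of these, so
    that the blocks exhaust the space, and it carries the sign eps. Its first vector is aligned with
    the projection t of c onto that complement, for the time orientation. *)
Lemma adapted_bases (V : 'I_r -> 'M[R]_N) b (c : 'rV[R]_N) :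
  (forall a, a != b -> posdef eps (V a)) ->
  (forall a a', a != a' -> V a *m gram eps N *m (V a')^T = 0) ->
  (eps = -1 -> eform eps c c < 0) ->
  exists m (J : forall a, 'M[R]_(m a, N)),
    [/\ (forall a, J a *m gram eps N *m (J a)^T = gram (if a == b then eps else 1) (m a)),
        (forall a a', a != a' -> J a *m gram eps N *m (J a')^T = 0),
        (forall a, (V a <= J a)%MS),
        (forall x, (forall a, a != b -> x *m gram eps N *m (J a)^T = 0) -> (x <= J b)%MS) &
        eps = -1 -> forall i : 'I_(m b), i = 0%N :> nat -> exists2 al, 0 < al &
          row i (J b) = al *: (c - \sum_(a | a != b) c *m gram eps N *m (J a)^T *m J a)].
Proof.
move=> pV oV cc.
have [JV JVP] : exists J : 'I_r -> {n & 'M[R]_(n, N)}, forall a, a != b ->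
    orthonormal_mx eps (tagged (J a)) 1 /\ (tagged (J a) :=: V a)%MS.
  suff /choice[J HJ] : forall a, exists J : {n & 'M[R]_(n, N)}, a != b ->
      orthonormal_mx eps (tagged J) 1 /\ (tagged J :=: V a)%MS by exists J.
  move=> a.
  have [|ab] := eqVneq a b; first by exists (existT _ 0%N (0 : 'M[R]_(0, N))).
  by have [n [J HJ]] := orthonormal_basis (pV a ab); exists (existT _ n J).
pose t := c - \sum_(a | a != b) c *m gram eps N *m (tagged (JV a))^T *m tagged (JV a).
have oJ a a' : a != b -> a' != b -> a != a' ->
    tagged (JV a) *m gram eps N *m (tagged (JV a'))^T = 0.
  move=> ab ab' aa'; have [_ /eqmxP/andP[Ja _]] := JVP a ab.
  have [_ /eqmxP/andP[Ja' _]] := JVP a' ab'.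
  have [X ->] := submxP Ja; have [X' ->] := submxP Ja'.
  by rewrite trmx_mul !mulmxA -(mulmxA X) -(mulmxA X) oV// mulmx0 mul0mx.
have assoc n1 n2 n3 (z : 'M[R]_(n1, n2)) (T : 'M[R]_(n2, N)) (T' : 'M[R]_(n3, N)) :
    z *m T *m gram eps N *m T'^T = z *m (T *m gram eps N *m T'^T) by rewrite !mulmxA.
have tJ a : a != b -> t *m gram eps N *m (tagged (JV a))^T = 0.
  move=> ab; rewrite /t mulmxBl mulmxBl mulmx_suml mulmx_suml (bigD1 a)//= big1.
    have [+ _] := JVP a ab; rewrite /orthonormal_mx gram1 => JJ.
    by rewrite addr0 assoc JJ mulmx1 subrr.
  by move=> a' /andP[ab' aa']; rewrite assoc oJ// mulmx0.
pose U : 'M[R]_N := (\bigcap_(a | a != b) kermx (gram eps N *m (tagged (JV a))^T))%MS.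
have UP x : reflect (forall a, a != b -> x *m gram eps N *m (tagged (JV a))^T = 0) (x <= U)%MS.
  apply: (iffP sub_bigcapmxP) => H a ab; have := H a ab; last by rewrite -mulmxA => /sub_kermxP.
  by move=> /sub_kermxP; rewrite mulmxA.
have [|k [Jb [JbJb JbU Jbt]]] := quadric_basis heps (A := U) (t := t).
  move=> em1; split; first exact/UP.
  (* Subtracting spacelike components only lowers the square: <t,t> = <c,t> <= <c,c> < 0. *)
  have -> : eform eps t t = eform eps c t.
    rewrite {1}/t eformBl eform_suml big1 ?subr0// => a ab.
    by rewrite eformC eform_mulr tJ// mul0mx mxE.
  rewrite /t eformBr eform_sumr; apply: le_lt_trans (cc em1).
  rewrite gerBl; apply: sumr_ge0 => a ab; rewrite eform_mulr.
  by have := eform1_ge0 (c *m gram eps N *m (tagged (JV a))^T); rewrite /eform gram1 mulmx1.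
pose J a := if a == b then existT (fun n => 'M[R]_(n, N)) k Jb else JV a.
have Jab a : a != b -> J a = JV a by rewrite /J => /negPf ->.
have JbE : J b = existT _ k Jb by rewrite /J eqxx.
exists (fun a => tag (J a)), (fun a => tagged (J a)).
have sumE : \sum_(a | a != b) c *m gram eps N *m (tagged (J a))^T *m tagged (J a) =
    \sum_(a | a != b) c *m gram eps N *m (tagged (JV a))^T *m tagged (JV a).
  by apply: eq_bigr => a ab; rewrite Jab.
have JbO a : a != b -> Jb *m gram eps N *m (tagged (JV a))^T = 0.
  move=> ab; apply/row_matrixP => i; rewrite !row_mul row0.
  by apply/UP: ab; rewrite -JbU row_sub.
split.
- move=> a; have [->|ab] := eqVneq a b; first by rewrite JbE.
  by rewrite Jab//; have [+ _] := JVP a ab.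
- move=> a a'; have [->|ab] := eqVneq a b.
    by rewrite eq_sym => ab'; rewrite JbE Jab//=; exact: JbO.
  rewrite Jab//; have [->|ab'] := eqVneq a' b; last by rewrite Jab//; exact: oJ.
  by move=> _; rewrite JbE /= -tr_form JbO// trmx0.
- move=> a; have [->|ab] := eqVneq a b; last by rewrite Jab//; have [_ ->] := JVP a ab.
  rewrite JbE /= JbU; apply/row_subP => i; apply/UP => a' ab.
  have [_ /eqmxP/andP[Ja _]] := JVP a' ab; have [X ->] := submxP Ja.
  by rewrite -!row_mul trmx_mul !mulmxA oV 1?eq_sym// mul0mx row0.
- move=> x xJ; rewrite JbE /= JbU; apply/UP => a ab; have := xJ a ab.
  by rewrite Jab.
- by rewrite sumE -/t JbE /=; exact: Jbt.
Qed.

End OrthogonalBases.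

(** * Separation of variables *)

Section SeparatedForm.
Variables (R : realType) (eps : R) (r N : nat) (M : 'I_r -> premanifold R).
Hypothesis heps : eps = 1 \/ eps = -1.
Hypothesis hM : forall i, is_manifold (M i).
Hypothesis cM : forall i, connected [set: M i].
Local Notation P := (prodM M).
Variable ft : P -> 'rV[R]_N.
Hypothesis pl : product_like eps ft.
Hypothesis ftQ : forall p, eform eps (ft p) (ft p) = eps.
Variable o : P.

Definition increment a (q : M a) : 'rV[R]_N := ft (dfwith o a q) - ft o.
Arguments increment : clear implicits.

Let ift : immersion ft. Proof. by case: pl. Qed.

Let smooth_increment a : smooth_map (increment a).
Proof.
move=> c ac; apply: smoothD; [exact: open_ccod| |exact: smooth_cst].
by have [+ _] := immersion_slice hM o a ift; apply.
Qed.

Let increment_base a : increment a (o a) = 0.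
Proof. by rewrite /increment dfwith_id subrr. Qed.

(** As mixed derivatives vanish, the derivative of ft along M_a depends on p_a only and may be
    computed on the slice through o, where it is that of the increment. Both sides therefore have
    the same partial derivatives, and they agree at o. *)
Lemma separated_sum (p : P) : ft p = ft o + \sum_a increment a (p a).
Proof.
have [[sf _] mix _] := pl.
pose g (p : P) := ft o + \sum_a increment a (p a).
have sg : smooth_map g := sum_form_smooth hM (fun p => erefl (g p)) smooth_increment.
pose F (p : P) := ft p + g p *m (-1)%:M.
have FE p' : F p' = ft p' - g p' by rewrite /F mul_mx_scalar scaleN1r.
have sF : smooth_map F.
  apply: smooth_map_prod => c ac; have oc := open_ccod_prod hM ac.
  apply: (smoothD oc); first exact: (smooth_map_in sf ac).
  by apply: (smooth_mulmxr _ oc); exact: (smooth_map_in sg ac).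
suff /(_ p o) : forall p p', F p = F p'.
  rewrite !FE [g o]/g big1 => [|a _]; last exact: increment_base.
  by rewrite addr0 subrr => /eqP; rewrite subr_eq0 => /eqP.
apply: constant_prod => p' a q.
apply: (constant_slice hM (@cM a)) => [ca aa|ca q' w aa da].
  exact: (smooth_map_slice hM p' sF aa).
set t := dfwith p' a q'; have dt : cdom ca (t a) by rewrite /t dfwithin.
have [c [ac dc cE]] := exists_charts1 hM aa dt; subst ca.
have d1 := differentiable_slice hM a ac (smooth_map_in sf ac) dc.
have d2 := differentiable_slice hM a ac (smooth_map_in sg ac) dc.
have d3 : differentiable (fun y => g (dfwith t a (cinv (c a) y)) *m (-1)%:M) (cmap (c a) (t a)).
  by apply: differentiable_mulmx => //; exact: differentiable_cst.
apply: etrans (derive_pointwiseD w d1 d3 (fun y => erefl)) _.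
rewrite (derive_mulmxr _ w d2) mul_mx_scalar scaleN1r; apply/eqP; rewrite subr_eq0; apply/eqP.
apply: etrans (pd_indep_all (w := w) hM cM o sf (ac a) _ (dc a)) _.
  by move=> b cb w' x ab bb xa xb; apply: (mix b a cb (c a) w' w x _ bb xb (ac a) xa); rewrite eq_sym.
apply/esym; apply: etrans (sum_form_pd (fun p => erefl (g p)) smooth_increment w (ac a) (dc a)) _.
have di : in_domains c (dfwith t a (t a)) by rewrite dfwith_id.
have dio : cdom (c a) (dfwith o a (t a) a) by rewrite dfwithin; exact: dc.
have [c' [ac' dc' cE']] := exists_charts1 hM (ac a) dio.
have d4 := differentiable_slice hM a ac' (smooth_map_in sf ac') dc'.
rewrite cE' dfwithin in d4.
rewrite /pd dfwithin; apply: etrans (derive_pointwiseD w d4 (differentiable_cst (- ft o) _) _) _.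
  by move=> y; rewrite /= /increment dfwith_idem.
by rewrite (_ : 'D_w (fun=> - ft o) _ = 0) ?addr0//; exact: derive_cst.
Qed.

Lemma separated_orth a b (q : M a) (q' : M b) : a != b ->
  eform eps (increment a q) (increment b q') = 0.
Proof.
(* Compare the squares of ft at the four points with coordinates q or o a in M_a
   and q' or o b in M_b. *)
move=> ab; pose p := dfwith (dfwith o a q) b q'.
have pE : ft p = ft o + (increment a q + increment b q').
  rewrite separated_sum (bigD1 b)//= (bigD1 a)//= {1 2}/p dfwithin dfwithout 1?eq_sym// dfwithin.
  rewrite big1 ?addr0 1?(addrC (increment b q'))// => i /andP[ib ia].
  by rewrite /p !dfwithout 1?eq_sym// increment_base.
have aE : ft (dfwith o a q) = ft o + increment a q by rewrite /increment subrKC.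
have bE : ft (dfwith o b q') = ft o + increment b q' by rewrite /increment subrKC.
have := ftQ p; have := ftQ (dfwith o a q); have := ftQ (dfwith o b q'); have := ftQ o.
rewrite pE aE bE; move: (ft o) (increment a q) (increment b q') => z x y.
rewrite !(eformDl, eformDr) [eform eps x z]eformC [eform eps y z]eformC [eform eps y x]eformC.
lra.
Qed.

Lemma separated_slice_immersion a : immersion (fun q : M a => ft o + increment a q).
Proof.
have -> : (fun q => ft o + increment a q) = (fun q => ft (dfwith o a q)).
  by apply/funext => q; rewrite /increment subrKC.
exact: immersion_slice.
Qed.

End SeparatedForm.

Lemma constant_not_immersion (R : realType) (M : premanifold R) n (h : M -> 'rV[R]_n) :
  is_manifold M -> (0 < mdim M)%N -> immersion h -> ~ forall q, h q = 0.
Proof.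
move=> hM; have [_ _ [q _] _] := hM; have [c ac dq] := manifold_cover hM q.
case=> [] /[!(lt0n)] m0 [sh fh] h0; have := fh c q ac dq.
have -> : jac h c q = 0.
  apply/row_matrixP => i; rewrite row0 rowE /jac jacobianE; last first.
    exact: (smooth_differentiable (sh c ac) (ccod_cmap dq)).
  have -> : h \o cinv c = fun=> 0 by apply/funext => x; exact: h0.
  exact: derive_cst.
by rewrite /row_free mxrank0 eq_sym (negPf m0).
Qed.

(** * Products of quadrics *)

Section QuadricCase.
Variables (R : realType) (eps : R) (r N : nat) (M : 'I_r -> premanifold R).
Hypothesis heps : eps = 1 \/ eps = -1.
Hypothesis hM : forall a, is_manifold (M a).
Hypothesis hdim : forall a, (0 < mdim (M a))%N.
Variables (ft : prodM M -> 'rV[R]_N) (c : 'rV[R]_N) (psi : forall a, M a -> 'rV[R]_N).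
Arguments psi : clear implicits.
Hypothesis ftE : forall p, ft p = c + \sum_a psi a (p a).
Hypothesis ipsi : forall a, immersion (fun q => c + psi a q).
Hypothesis psiQ : forall a q, Qspace eps (c + psi a q).
Hypothesis cQ : Qspace eps c.

(** Moving one point q in M_a changes only the component of c + psi a in block a. The total square
    being constant, [h a] has constant square [n a], and the sign of [n a] decides whether a radius
    exists. *)
Lemma quadric_case b (V : 'I_r -> 'M[R]_N) : (forall a q, (psi a q <= V a)%MS) ->
  (forall a a', a != a' -> V a *m gram eps N *m (V a')^T = 0) ->
  (forall a, a != b -> posdef eps (V a)) ->
  product_in_quadrics eps (fun a => if a == b then eps else 1) ft.
Proof.
move=> psiV oV pV.
have [em1|m [J [JJ JJ0 VJ Jb Jt]]] := adapted_bases heps pV oV (c := c).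
  by rewrite (Qspace_eform cQ) em1 ltrN10.
pose sig a := if a == b then eps else 1.
have hsig a : sig a = 1 \/ sig a = -1 by rewrite /sig; case: ifP => _; [|left].
have sigb a : a != b -> sig a = 1 by rewrite /sig => /negPf ->.
have sigN a : sig a = -1 -> a = b.
  move=> s1; apply/eqP/negPn/negP => /sigb; rewrite s1 => /eqP.
  by rewrite eq_sym -subr_eq0 opprK (pnatr_eq0 R 2).
have csum := component_sum hsig JJ JJ0 Jb; have cform := component_form hsig JJ JJ0 Jb.
pose Q a := component eps sig J a.
pose g a q := c + psi a q; pose h a q := g a q *m Q a.
have psiQ0 a a' q : a != a' -> psi a q *m Q a' = 0.
  move=> aa'; have /submxP[z ->] := submx_trans (psiV a q) (VJ a).
  exact: (component_other sig JJ0 z aa').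
have gQ a a' q : a != a' -> g a q *m Q a' = c *m Q a'.
  by move=> aa'; rewrite /g mulmxDl psiQ0// addr0.
have hE p a : ft p *m Q a = h a (p a).
  rewrite ftE mulmxDl mulmx_suml (bigD1 a)//= big1 ?addr0 -?mulmxDl// => a' aa'.
  exact: psiQ0.
pose n a := eform (sig a) (c *m Q a) (c *m Q a).
have hn a q : eform (sig a) (h a q) (h a q) = n a.
  have : \sum_a' eform (sig a') (g a q *m Q a') (g a q *m Q a') = \sum_a' n a'.
    apply: etrans (esym (cform (g a q))) _; apply: etrans _ (cform c).
    by rewrite (Qspace_eform (psiQ q)) (Qspace_eform cQ).
  rewrite (bigD1 a)//= [RHS](bigD1 a)//= (eq_bigr n) => [/addIr//|a' aa'].
  by rewrite gQ// eq_sym.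
have sumn : \sum_a n a = eps by rewrite -[RHS](Qspace_eform cQ) cform.
have hg a q : g a q = \sum_(a' | a' != a) c *m Q a' *m J a' + h a q *m J a.
  rewrite [LHS]csum (bigD1 a)//= addrC; congr (_ + _); apply: eq_bigr => a' aa'.
  by rewrite gQ// eq_sym.
have ih a : immersion (h a).
  apply: (factor_immersion (A := Q a) (hM a) (ipsi a)
    (F := fun y => \sum_(a' | a' != a) c *m Q a' *m J a' + y *m J a)) => [q|y|q].
  - by [].
  - apply: differentiableD; first exact: differentiable_cst.
    by apply: differentiable_mulmx; [exact: ex_diff|exact: differentiable_cst].
  - exact: hg.
have form0 n0 e (x : 'rV[R]_n0) : e = 1 -> 0 <= eform e x x /\ (eform e x x = 0 -> x = 0).
  move=> ->; split; first exact: eform1_ge0.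
  by move=> x0; apply/eqP/negPn/negP => /eform1_gt0; rewrite x0 ltxx.
have npos1 a : sig a = 1 -> 0 < n a.
  move=> s1; have [n0 _] := form0 _ _ (c *m Q a) s1.
  rewrite lt_def [X in _ && X]n0 andbT; apply/negP => /eqP na0.
  (* In a positive definite block [n a] = 0 would make [h a] vanish identically. *)
  apply: (constant_not_immersion (hM a) (hdim a) (ih a)) => q.
  have [_] := form0 _ _ (h a q) s1; apply; exact: (etrans (hn a q) na0).
have npos a : 0 < sig a * n a.
  (* The remaining case is the Lorentzian block: all the [n i] add up to -1 and the others are
     nonnegative, so this one is negative. *)
  have [s1|s1] := hsig a; first by rewrite s1 mul1r npos1.
  have ab := sigN a s1.
  have em1 : eps = -1 by rewrite -s1 ab /sig eqxx.
  have := sumn; rewrite (bigD1 a)//= em1 s1 mulN1r oppr_gt0.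
  have : 0 <= \sum_(i | i != a) n i.
    by apply: sumr_ge0 => i ia; apply/ltW/npos1/sigb; rewrite -ab.
  by move: (n a) => x; lra.
have sigsq a : sig a * sig a = 1 by exact: eps_sq.
have radE a : sig a * Num.sqrt (sig a * n a) ^+ 2 = n a.
  by rewrite sqr_sqrtr ?ltW// mulrA sigsq mul1r.
exists m, J, (fun a => Num.sqrt (sig a * n a)), h; split.
- exact: (component_decomp hsig JJ JJ0 Jb).
- by move=> a; rewrite sqrtr_gt0.
- move=> a; split; first exact: ih.
  move=> q; split; first by rewrite -/(sig a) radE; exact: hn.
  rewrite -/(sig a) => s1 i i0.
  have ab := sigN a s1.
  subst a; have em1 : eps = -1 by rewrite -s1 /sig eqxx.
  have [al al0 rJ] := Jt em1 i i0.
  apply: (first_coordinate_gt0 em1 s1 i0 al0 rJ).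
  (* The product of c + psi b q with c is negative since both are future timelike. The subtracted
     terms are squares: outside block b the components of c + psi b q are those of c. *)
  rewrite eformBr eform_sumr subr_lt0; apply: (@lt_le_trans _ _ 0).
    have [_ fc] := cQ; have [_ fg] := psiQ q.
    rewrite em1; apply: future_timelike => //; rewrite -?em1; [| |exact: fg|exact: fc].
      by rewrite (Qspace_eform (psiQ q)) em1 ltrN10.
    by rewrite (Qspace_eform cQ) em1 ltrN10.
  apply: sumr_ge0 => a ab; rewrite eform_mulr.
  have -> : g b q *m gram eps N *m (J a)^T = c *m gram eps N *m (J a)^T.
    have := gQ b a q; rewrite /Q /component sigb// gram1 mulmx1 !mulmxA; apply.
    by rewrite eq_sym.
  by have := eform1_ge0 (c *m gram eps N *m (J a)^T); rewrite /eform gram1 mulmx1.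
- by rewrite -[RHS]sumn; apply: eq_bigr => a _; exact: radE.
- move=> p; rewrite [LHS]csum; apply: eq_bigr => a _; congr (_ *m _); exact: hE.
Qed.

End QuadricCase.

(** * Products in a horosphere *)

Section HorosphereCase.
Variables (R : realType) (r N : nat) (M : 'I_r -> premanifold R).
Hypothesis hr : (0 < r)%N.
Hypothesis hM : forall a, is_manifold (M a).
Variables (ft : prodM M -> 'rV[R]_N) (c : 'rV[R]_N) (psi : forall a, M a -> 'rV[R]_N).
Arguments psi : clear implicits.
Hypothesis ftE : forall p, ft p = c + \sum_a psi a (p a).
Hypothesis ftQ : forall p, eform (-1) (ft p) (ft p) = -1.
Hypothesis ipsi : forall a, immersion (fun q => c + psi a q).
Hypothesis psiQ : forall a q, eform (-1) (c + psi a q) (c + psi a q) = -1.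
Hypothesis opsi : forall a b q q', a != b -> eform (-1) (psi a q) (psi b q') = 0.
Hypothesis cQ : Qspace (-1) c.
Variable w : 'rV[R]_N.
Hypothesis ww : eform (-1) w w = 0.
Hypothesis cw : eform (-1) c w = 1.
Hypothesis psiw : forall a q, eform (-1) (psi a q) w = 0.

Local Notation G := (gram (-1) N).
(** The coefficient 1/2 makes v null: <v,v> = <c,c> + <c,w> = -1 + 1. It also makes c the image of
    the origin under [horosphere_map]. *)
Variable v : 'rV[R]_N.
Hypothesis vE : v = c + 2^-1 *: w.

Let cc : eform (-1) c c = -1. Proof. exact: Qspace_eform. Qed.

Let vw : eform (-1) v w = 1.
Proof. by rewrite vE eformDl eformZl ww cw mulr0 addr0. Qed.

Let vv : eform (-1) v v = 0.
Proof.
rewrite {1}vE eformDl eformZl [eform _ w v]eformC vw vE eformDr eformZr cc cw.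
by lra.
Qed.

(** C is an orthonormal basis of the complement of c and w. This complement is positive definite
    because c is timelike, and of dimension N - 2 because c and w are independent. *)
Lemma null_frame : exists k (C : 'M[R]_(k, N)), [/\ k.+2 = N, C *m G *m C^T = 1%:M,
  C *m G *m w^T = 0, C *m G *m c^T = 0 &
  forall x, eform (-1) x c = 0 -> eform (-1) x w = 0 -> (x <= C)%MS].
Proof.
pose B : 'M[R]_(1 + 1, N) := col_mx c w.
have fB : row_free B.
  apply/inj_row_free => u; rewrite -[u]hsubmxK mul_row_col.
  rewrite [lsubmx u]mx11_scalar [rsubmx u]mx11_scalar !mul_scalar_mx.
  move: (lsubmx u 0 0) (rsubmx u 0 0) => a b ab.
  have a0 : a = 0.
    by have := congr1 (fun x => eform (-1) x w) ab; rewrite eformDl !eformZl ww cw eform0l; lra.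
  have b0 : b = 0.
    have := congr1 (fun x => eform (-1) x c) ab; rewrite a0 eformDl !eformZl eform0l.
    by rewrite [eform _ w c]eformC cw; lra.
  by rewrite a0 b0 raddf0 row_mx0.
pose A := kermx (G *m B^T).
have AP x : (x <= A)%MS <-> eform (-1) x c = 0 /\ eform (-1) x w = 0.
  have E : x *m (G *m B^T) = row_mx (eform (-1) x c)%:M (eform (-1) x w)%:M.
    by rewrite tr_col_mx !mul_mx_row !mulmxA; congr row_mx; exact: mx11_scalar.
  split=> [/sub_kermxP|[xc xw]]; last by apply/sub_kermxP; rewrite E xc xw !raddf0 row_mx0.
  rewrite E -row_mx0 => /eq_row_mx[xc xw].
  by split; [have := congr1 (fun X : 'M[R]_1 => X 0 0) xc|have := congr1 (fun X : 'M[R]_1 => X 0 0) xw]; rewrite !mxE.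
have pA : posdef (-1) A.
  by move=> x /AP[xc _] x0; apply: (timelike_orth (t := c)); rewrite ?cc ?ltrN10// eformC.
have [k [C [CC CA]]] := orthonormal_basis pA.
have kE : k = (N - 2)%N.
  have -> : k = \rank C by apply/esym/eqP; exact: (orthonormal_row_free (or_introl erefl) CC).
  have fG : row_free (G : 'M[R]_N).
    by apply/row_freeP; exists G; apply: gram_sq; right.
  rewrite CA mxrank_ker -mxrank_tr trmx_mul trmxK tr_gram mxrankMfree//.
  by rewrite (eqP fB).
have N2 : (2 <= N)%N by have := rank_leq_col B; rewrite (eqP fB).
have rC i : eform (-1) (row i C) c = 0 /\ eform (-1) (row i C) w = 0.
  by apply/AP; rewrite -CA row_sub.
exists k, C; split.
- by rewrite kE -addn2 subnK.
- by rewrite CC gram1.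
- by apply/matrixP => i j; rewrite mul_gram_trmx mxE row_id; have [] := rC i.
- by apply/matrixP => i j; rewrite mul_gram_trmx mxE row_id; have [] := rC i.
- by move=> x xc xw; rewrite CA; apply/AP.
Qed.

Variables (k : nat) (C : 'M[R]_(k, N)).
Hypothesis kN : k.+2 = N.
Hypothesis CC : C *m G *m C^T = 1%:M.
Hypothesis Cw : C *m G *m w^T = 0.
Hypothesis Cc : C *m G *m c^T = 0.
Hypothesis CP : forall x, eform (-1) x c = 0 -> eform (-1) x w = 0 -> (x <= C)%MS.

Let wC : w *m G *m C^T = 0. Proof. by rewrite -tr_form Cw trmx0. Qed.
Let cC : c *m G *m C^T = 0. Proof. by rewrite -tr_form Cc trmx0. Qed.
Let vC : v *m G *m C^T = 0.
Proof. by rewrite vE !mulmxDl -!scalemxAl cC wC scaler0 addr0. Qed.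
Let wCE (z : 'rV[R]_k) : eform (-1) (z *m C) w = 0.
Proof. by rewrite eformC eform_mulr wC mul0mx mxE. Qed.
Let cCE (z : 'rV[R]_k) : eform (-1) (z *m C) c = 0.
Proof. by rewrite eformC eform_mulr cC mul0mx mxE. Qed.
Let vCE (z : 'rV[R]_k) : eform (-1) (z *m C) v = 0.
Proof. by rewrite eformC eform_mulr vC mul0mx mxE. Qed.
Let CCE n (z : 'M[R]_(n, k)) : z *m C *m G *m C^T = z.
Proof. by rewrite -!mulmxA (mulmxA C) CC mulmx1. Qed.

(** Since v and w are null with product 1, the coefficient of v is the product with w and
    conversely. The remainder is orthogonal to w and v, hence to c, and so lies in the span of C,
    where its coordinates are 0. *)
Lemma null_frame_expansion x :
  x = eform (-1) x w *: v + eform (-1) x v *: w + x *m G *m C^T *m C.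
Proof.
pose z := x - (eform (-1) x w *: v + eform (-1) x v *: w + x *m G *m C^T *m C).
have zw : eform (-1) z w = 0.
  by rewrite /z eformBl !eformDl !eformZl vw ww wCE; lra.
have zv : eform (-1) z v = 0.
  by rewrite /z eformBl !eformDl !eformZl vv vCE [eform _ w v]eformC vw; lra.
have zc : eform (-1) z c = 0.
  by have := zv; rewrite vE eformDr eformZr zw; lra.
have /submxP[y yE] := CP zc zw.
have y0 : y = 0.
  rewrite -[y]CCE -yE /z !mulmxBl !mulmxDl -!scalemxAl vC wC CCE.
  by rewrite !scaler0 !add0r subrr.
by apply/eqP; rewrite -subr_eq0 -/z yE y0 mul0mx.
Qed.

Definition horosphere_map (y : 'rV[R]_k) : 'rV[R]_N :=
  v + y *m C - ((1 + eform 1 y y) / 2) *: w.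
Local Notation j := horosphere_map.

(** With <x,w> = 1 and y the coordinates of x in C, the expansion gives <x,x> = 2 <x,v> + |y|^2.
    Equating this to -1 yields the coefficient - (1 + |y|^2) / 2 of w. *)
Lemma horosphere_mapE x : eform (-1) x w = 1 -> eform (-1) x x = -1 ->
  x = j (x *m G *m C^T).
Proof.
move=> xw xx; rewrite {1}(null_frame_expansion x) xw scale1r /j addrAC.
congr (_ + _); rewrite -scaleNr; congr (_ *: _).
have := xx; rewrite {2}(null_frame_expansion x) xw !eformDr !eformZr xw eform_mulr.
have -> : (x *m G *m C^T *m (x *m G *m C^T)^T) 0 0 = eform 1 (x *m G *m C^T) (x *m G *m C^T).
  by rewrite [RHS]/eform gram1 mulmx1.
by move: (eform _ _ _) (eform _ _ _) => s t; lra.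
Qed.

Lemma horosphere_map_Q y : Qspace (-1) (j y).
Proof.
have jw : eform (-1) (j y) w = 1.
  by rewrite /j eformBl eformDl eformZl vw ww wCE; lra.
have jv : eform (-1) (j y) v = - ((1 + eform 1 y y) / 2).
  by rewrite /j eformBl eformDl eformZl vv [eform _ w v]eformC vw vCE; lra.
have jC : eform (-1) (j y) (y *m C) = eform 1 y y.
  have jG : j y *m G *m C^T = y.
    by rewrite /j !mulmxBl !mulmxDl -!scalemxAl vC wC CCE scaler0 subr0 add0r.
  by rewrite eform_mulr jG [RHS]/eform gram1 mulmx1.
have jj : eform (-1) (j y) (j y) = -1.
  by rewrite [X in eform _ _ X]/j eformBr eformDr eformZr jw jv jC; lra.
split; first by rewrite jj expr1n mulr1.
move=> _; have [_ fc] := cQ.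
apply: (timelike_future (x := c)); rewrite ?cc ?jj ?ltrN10//; first exact: fc.
(* The product of c with the image of y is -1 - |y|^2 / 2, so both lie on the same sheet. *)
rewrite /j eformBr eformDr eformZr cw [eform _ c (y *m C)]eformC cCE vE eformDr eformZr cc cw.
by have := eform1_ge0 y; lra.
Qed.

Lemma horosphere_map_inclusion : horosphere_inclusion j.
Proof.
exists C, v, w; split=> //; last exact: horosphere_map_Q.
by split=> //; rewrite -tr_form vC trmx0.
Qed.

Lemma horosphere_case : product_in_horosphere ft.
Proof.
pose phi a q : 'rV[R]_k := psi a q *m G *m C^T.
have phiC a q : phi a q *m C = psi a q - eform (-1) (psi a q) v *: w.
  by apply/esym/eqP; rewrite subr_eq addrC {1}(null_frame_expansion (psi a q)) psiw scale0r add0r.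
have ophi a b q q' : a != b -> eform 1 (phi a q) (phi b q') = 0.
  move=> ab; have -> : eform 1 (phi a q) (phi b q') = eform (-1) (psi a q) (phi b q' *m C).
    by rewrite eform_mulr [LHS]/eform gram1 mulmx1.
  by rewrite phiC eformBr eformZr psiw opsi// mulr0 subr0.
have [V [phiV oV]] := spanning_family ophi.
(* Any index may absorb the part of R^k outside the span of the maps phi. The form is Euclidean
   here, so the vector c = 0 that would fix a time orientation is a dummy. *)
pose b := Ordinal hr.
have [|||m [K [KK KK0 VK Kb _]]] := adapted_bases (or_introl erefl) (V := V) (b := b) (c := 0).
- by move=> a _ x _ x0; exact: eform1_gt0.
- exact: oV.
- by move=> /eqP; rewrite -subr_eq0 opprK (pnatr_eq0 R 2).
have {}KK a : K a *m gram 1 k *m (K a)^T = gram 1 (m a) by rewrite KK if_same.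
have hs1 (a : 'I_r) : (fun=> 1 : R) a = 1 \/ (fun=> 1 : R) a = -1 by left.
pose h a q := phi a q *m component 1 (fun=> 1) K a.
have hK a q : h a q *m K a = phi a q.
  have /submxP[z zE] := submx_trans (phiV a q) (VK a).
  by rewrite /h zE (component_self hs1 KK).
have psiG a q : (c + psi a q) *m G *m C^T = phi a q by rewrite !mulmxDl cC add0r.
exists k, j, m, K, h; split.
- exact: kN.
- exact: horosphere_map_inclusion.
- exact: (component_decomp hs1 KK KK0 Kb).
- move=> a; apply: (factor_immersion (A := G *m C^T *m component 1 (fun=> 1) K a)
    (F := fun y => j (y *m K a)) (hM a) (ipsi a)) => [q|y|q].
  + by rewrite /h -psiG !mulmxA.
  (* The quadratic term is rewritten as a matrix product, to which the product rule applies. *)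
  + have -> : (fun y => j (y *m K a)) = (fun y => v - 2^-1 *: w + y *m (K a *m C) +
        (y *m K a *m gram 1 k) *m (y *m K a)^T *m (- 2^-1 *: w)).
      apply/funext => z; rewrite /j [X in X *m (_ *: w)]mx11_scalar mul_scalar_mx.
      rewrite -[X in X *: (_ *: w)]/(eform 1 (z *m K a) (z *m K a)) scalerA mulmxA.
      rewrite mulrN scaleNr [v - _ + _]addrAC -[RHS]addrA -opprD -scalerDl.
      by congr (_ - _ *: _); field.
    have dK : differentiable (fun y : 'rV[R]_(m a) => y *m K a) y.
      by apply: differentiable_mulmx; [exact: ex_diff|exact: differentiable_cst].
    apply: differentiableD.
      apply: differentiableD; first exact: differentiable_cst.
      by apply: differentiable_mulmx; [exact: ex_diff|exact: differentiable_cst].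
    apply: differentiable_mulmx; last exact: differentiable_cst.
    apply: differentiable_mulmx; last exact: differentiable_trmx.
    by apply: differentiable_mulmx; [exact: dK|exact: differentiable_cst].
  + rewrite hK -psiG; apply: horosphere_mapE; last exact: psiQ.
    by rewrite eformDl cw psiw addr0.
- move=> p; rewrite (eq_bigr (fun a => phi a (p a))) => [|a _]; last exact: hK.
  rewrite {1}(horosphere_mapE (x := ft p)) ?ftQ//.
    by rewrite {1}ftE !mulmxDl cC add0r !mulmx_suml.
  by rewrite ftE eformDl cw eform_suml big1 ?addr0.
Qed.

End HorosphereCase.

Lemma product_like_extrinsic (R : realType) (eps : R) r N (M : 'I_r -> premanifold R)
    (ft : prodM M -> 'rV[R]_N) (o : prodM M) :
  eps = 1 \/ eps = -1 -> (0 < r)%N -> (forall a, is_manifold (M a)) ->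
  (forall a, connected [set: M a]) -> (forall a, (0 < mdim (M a))%N) ->
  product_like eps ft -> (forall p, Qspace eps (ft p)) -> extrinsic_product eps ft.
Proof.
move=> heps hr hM cM hdim pl ftQ; split=> //.
have ftq p : eform eps (ft p) (ft p) = eps by exact: Qspace_eform.
pose c := ft o; pose psi a (q : M a) := increment ft o q.
have ftE p : ft p = c + \sum_a psi a (p a) := separated_sum hM cM pl o p.
have opsi a b (q : M a) (q' : M b) : a != b -> eform eps (psi a q) (psi b q') = 0.
  exact: (separated_orth hM cM pl ftq).
have ipsi a : immersion (fun q => c + psi a q) := separated_slice_immersion hM pl o a.
have psiQ a (q : M a) : Qspace eps (c + psi a q).
  by rewrite /psi /increment subrKC; exact: ftQ.
have cQ : Qspace eps c := ftQ o.
have [V [psiV oV]] := spanning_family opsi.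
have quad := quadric_case heps hM hdim ftE ipsi psiQ cQ psiV oV.
have [e1|em1] := heps.
  left; split=> //; have := quad (Ordinal hr).
  have -> : (fun a => if a == Ordinal hr then eps else 1) = (fun=> 1).
    by apply/funext => a; rewrite e1 if_same.
  by apply=> a _ x _ x0; rewrite e1; exact: eform1_gt0.
right; split=> //; subst eps.
have [[b pb]|nb] := pselect (exists b, forall a, a != b -> posdef (-1) (V a)).
  by left; exists b; exact: quad.
right.
(* Whichever index is set aside, another one carries a nonzero nonspacelike vector. Used twice, this
   gives two different indices a and b. *)
have nonposdef b : exists2 a, a != b & exists x : 'rV[R]_N,
    [/\ (x <= V a)%MS, x != 0 & eform (-1) x x <= 0].
  apply: contrapT => nab; apply: nb; exists b => a ab x xV x0.
  rewrite ltNge; apply/negP => xx; apply: nab; exists a => //; exists x; split=> //.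
have [a _ [x [xV x0 xx]]] := nonposdef (Ordinal hr).
have [b ba [y [yV y0 yy]]] := nonposdef a.
have oVs a1 b1 (z z' : 'rV[R]_N) : a1 != b1 -> (z <= V a1)%MS -> (z' <= V b1)%MS ->
    eform (-1) z z' = 0.
  move=> ab1 /submxP[u ->] /submxP[u' ->].
  by rewrite eform_mul oV// mulmx0 mul0mx mxE.
have xy : eform (-1) x y = 0 by apply: (oVs a b) => //; rewrite eq_sym.
have [t t0 xty] := nonspacelike_orth x0 y0 xx yy xy.
have xVb : (x <= V b)%MS by rewrite xty scalemx_sub.
have xx0 : eform (-1) x x = 0 by apply: (oVs b a).
(* x lies in both [V a] and [V b], and every d differs from at least one of a and b. *)
have psix d (q : M d) : eform (-1) (psi d q) x = 0.
  have [da|da] := eqVneq d a; last exact: (oVs d a).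
  by apply: (oVs d b) => //; rewrite da eq_sym.
(* Orthogonal to the timelike c, the vector x would be spacelike, but it is null. Hence a multiple w
   of x has product 1 with c. *)
have cx : eform (-1) c x != 0.
  apply/eqP => cx0; have := timelike_orth (t := c) _ cx0 x0.
  by rewrite (Qspace_eform cQ) xx0 ltrN10 ltxx => /(_ isT).
pose w := (eform (-1) c x)^-1 *: x.
have ww : eform (-1) w w = 0 by rewrite eformZl eformZr xx0 !mulr0.
have cw : eform (-1) c w = 1 by rewrite eformZr mulVf.
have psiw d (q : M d) : eform (-1) (psi d q) w = 0 by rewrite eformZr psix mulr0.
have [k [C [kN CC Cw Cc CP]]] := null_frame cQ ww cw.
exact: (horosphere_case hr hM ftE ftq ipsi (fun d q => Qspace_eform (psiQ d q)) opsi cQ ww cw psiw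
  erefl kN CC Cw Cc CP).
Qed.

Theorem theorem23 (R : realType) (eps : R) (heps : eps = 1 \/ eps = -1)
    (r N : nat) (hr : (0 < r)%N)
    (M : 'I_r.+1 -> premanifold R)
    (hM : forall i, is_manifold (M i))
    (hconn : connected [set: prodM M]) :
  (forall (s : nat) (ft : tailM M -> 'rV[R]_N) (E : tailM M -> 'M[R]_N)
      (Phi : tailM M -> 'M[R]_(s, N)) (e1 : 'rV[R]_s)
      (f0 : M ord0 -> 'rV[R]_s),
    tube_data eps ft E Phi e1 f0 ->
    let f := tube_map Phi f0 in
    [/\ immersion f, forall p, Qspace eps (f p),
        polar (induced_metric eps f) & adapted eps f])
  /\
  ((forall a : 'I_r, (0 < mdim (M (lift ord0 a)))%N) ->
   forall f : prodM M -> 'rV[R]_N,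
    immersion f -> (forall p, Qspace eps (f p)) ->
    polar (induced_metric eps f) -> adapted eps f ->
    exists (s : nat) (ft : tailM M -> 'rV[R]_N) (E : tailM M -> 'M[R]_N)
      (Phi : tailM M -> 'M[R]_(s, N)) (e1 : 'rV[R]_s)
      (f0 : M ord0 -> 'rV[R]_s),
      tube_data eps ft E Phi e1 f0 /\ forall p, f p = tube_map Phi f0 p).
Proof.
have cM : forall i, connected [set: M i] := factor_connected hM hconn.
split=> [s ft E Phi e1 f0 td f|hdim f iF fQ pol ad].
  split.
  - exact: (tube_map_immersion heps hM td).
  - exact: (tube_map_Qspace td).
  - exact: (tube_map_polar heps hM cM td).
  - exact: (tube_map_adapted heps hM cM td).
have pt i : exists q : M i, True by have [_ _ [q _] _] := hM i; exists q.
pose q i := projT1 (cid (pt i)).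
pose o : tailM M := fun a => q (lift ord0 a).
(* Any point of M_0 may be chosen: its leaf becomes ft, and the coordinates of that leaf become
   e1. *)
apply: (exists_tube_data (q0 := q ord0) heps hM cM iF fQ pol ad o).
exact: (product_like_extrinsic (M := fun a : 'I_r => M (lift ord0 a)) o heps hr
  (fun a => hM _) (fun a => @cM _) hdim
  (leaf_product_like heps hM iF fQ pol ad (q ord0)) (fun t => fQ _)).
Qed.
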